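(* Let $d\ge2$, $n\ge3$, and $r\ge1$ be integers. Suppose each of the finite loopless digraphs $G_1,\ldots,G_d$ has $n$ vertices and a decomposition into $r$ directed Hamilton cycles. Then the Cartesian product $G_1\square\cdots\square G_d$ has a decomposition into $dr$ directed Hamilton cycles. In particular, every Cartesian power of a Hamilton-decomposable digraph on at least three vertices is Hamilton-decomposable.
   Context: A decomposition into directed Hamilton cycles is a partition of the arc set into directed spanning cycles; a digraph having such a decomposition is called Hamilton-decomposable. The Cartesian product $G_1\square\cdots\square G_d$ has vertex set $\prod_i V(G_i)$; an arc changes exactly one coordinate, along an arc of the corresponding factor, and keeps the other coordinates fixed. Parallel arcs, when present, are separately labelled (they count as different arcs, and the product arcs retain the labels). Digraphs are finite and loopless. *)

(* Defs.v *)
From HB Require Import structures.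
From mathcomp Require Import all_boot.

Set Implicit Arguments.
Unset Strict Implicit.
Unset Printing Implicit Defensive.

(* Arcs form a finite type of their own, so parallel arcs are distinct labels. *)
Record digraph := Digraph {
  vert : finType;
  arc : finType;
  asrc : arc -> vert;
  atgt : arc -> vert;
  loopless : forall a : arc, asrc a != atgt a
}.

Section Hamilton.
Variable G : digraph.

Definition consecutive : rel (arc G) := fun a b => atgt a == asrc b.

(* A cycle is a set of arcs that can be listed in cyclic order; since [cycle]
   holds for the empty list, nonemptiness is required separately. *)
Definition ham_cycle (C : {set arc G}) : Prop :=
  exists s : seq (arc G),
    [/\ C = [set a in s], s != [::], cycle consecutive s,
        uniq (map (@asrc G) s) & forall v : vert G, v \in map (@asrc G) s].

Definition ham_decomposition (P : {set {set arc G}}) : Prop :=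
  partition P [set: arc G] /\ forall C, C \in P -> ham_cycle C.

Definition ham_decomposable_into (r : nat) : Prop :=
  exists2 P, ham_decomposition P & #|P| = r.

Definition ham_decomposable : Prop := exists P, ham_decomposition P.

End Hamilton.

Section CartesianProduct.
Variables (d : nat) (G : 'I_d -> digraph).

Definition cart_vert : finType := {dffun forall i : 'I_d, vert (G i)}.

(* A product arc is a pair (Tagged a, x) of an arc a of some factor G i and a
   product vertex x, its source, whose i-th coordinate is the source of a. *)
Definition cart_arc : finType :=
  {p : {i : 'I_d & arc (G i)} * cart_vert
     | p.2 (tag p.1) == asrc (tagged p.1)}.

Definition cart_src (p : cart_arc) : cart_vert := (val p).2.

Definition cart_tgt (p : cart_arc) : cart_vert :=
  [ffun j => dfwith (val p).2 (atgt (tagged (val p).1)) j].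

Lemma cart_loopless (p : cart_arc) : cart_src p != cart_tgt p.
Proof.
case: p => -[[i a] x] /= xi; rewrite /cart_src /cart_tgt /=.
apply/eqP => /ffunP /(_ i); rewrite ffunE dfwith_in => E.
by move: (loopless a); rewrite -E eq_sym xi.
Qed.

Definition cart_prod : digraph := Digraph cart_loopless.

End CartesianProduct.

Definition cart_pow (d : nat) (G : digraph) : digraph :=
  cart_prod (fun _ : 'I_d => G).

(* Main.v *)
Require Import Defs.
From mathcomp Require Import all_boot ssralg zmodp.
From mathcomp Require Import ring zify.

(** A Hamilton cycle chooses one arc out of every vertex, and the map to the targets of
these arcs is a single cycle. If each factor is decomposed into r cycles, the j-th cycles of the
d factors together form, for each j, a copy of the torus Z_n^d with its d coordinate steps.
So it is enough to distribute the D coordinate steps of Z_n^D, point by point, over D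
colours such that each colour is a single cycle ([torus_decomposition]); this is done for all
D and all n >= 3.

Two cycles of lengths N and M with M | N are decomposed by letting one colour step along
the second cycle exactly when the sum of the positions is 0 modulo M; powers of n satisfy
the coprimality condition that is needed ([decomp_pair]). Since the cycles of Z_n^a and of
Z_n^b can be paired, this doubles dimensions, and more generally it suffices to divide the
cycles of K^3 and W, with K = Z_n^s and W = Z_n^w, into groups that each contain cycles of both
factors. For odd D >= 9 this works with pairs, with triples of equal cycles, and with one
group of the three axes of K^3 and two cycles of W ([decomp_blocks]).

Three cycles are treated by layers: the sum of the positions modulo M increases by 1 with
each step, so a colour is a single cycle when its passage through the M layers is one
([ham_layered]). For odd M constant layers, corrected by exchanges of two colours along
lines, are sufficient ([odd_box]). For even M they are not, by an argument with the signs of the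
permutations, and one layer of a different kind is used ([even_box]).

For three axes and two cycles h, h' of W, the colours 1, 2, 3 follow a decomposition A1,
A2, A3 of the axes over two points of W, and walk along their own axis elsewhere. To move in
W, each of them takes a step of h or h' once in every M steps, at a prescribed phase,
and this makes the colour a single cycle ([ham_excursion]). The colours 4 and 5 walk along h
and h' and take over the steps along the axes that are given up; which of them receives
a step is decided in such a way that their movement on K^3 is a skew product with
coprime totals ([visit_connected]), and the classes that remain are merged by an exchange of
the two colours along one line ([ham_merged]).

The remaining dimensions are 5 and 7. Dimension 5 is of the last kind, with W = Z_n^2,
when n >= 4. For n >= 6 dimension 7 is obtained in the same way from five axes and two
cycles ([decomp_five_two]); for odd n, and for n = 4, it is divided into two pairs and a triple of
cycles of lengths n^3, n^2, n^2 ([torus_decomp7_of_triple]). The triple with n = 4 and the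
case n = 3 of dimension 5 are explicit designs, verified by following each colour until it
returns. *)

Set Implicit Arguments.
Unset Strict Implicit.
Unset Printing Implicit Defensive.

Import GRing.Theory.

(** * Single-cycle maps and families of directions *)

(** A Hamilton cycle of a digraph amounts to one arc out of every vertex such that the
map to the targets of these arcs is a single cycle. *)
Definition ham (T : finType) (f : T -> T) := [forall x, forall y, fconnect f x y].

Lemma hamP (T : finType) (f : T -> T) :
  reflect (forall x y, fconnect f x y) (ham f).
Proof.
apply: (iffP forallP) => [H x y|H x]; first exact: (forallP (H x)).
exact/forallP.
Qed.

Lemma surj_inj (T : finType) (f : T -> T) :
  (forall y, exists x, f x = y) -> injective f.
Proof.
move=> S; have : #|image f T| == #|T|.
  apply/eqP/eq_card => y; rewrite [in RHS]inE; apply/imageP.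
  by have [x <-] := S y; exists x.
by move/image_injP => H x y; apply: H.
Qed.

Lemma ham_inj (T : finType) (f : T -> T) : ham f -> injective f.
Proof.
move/hamP => H; apply: surj_inj => y; have := H (f y) y.
case/connectP => p; elim/last_ind: p => [|p z _] /=; first by move=> _ ->; exists y.
by rewrite rcons_path last_rcons => /andP[_ /eqP <-] ->; exists (last (f y) p).
Qed.

Lemma inj_ham (T : finType) (f : T -> T) (x0 : T) :
  injective f -> (forall x, fconnect f x x0) -> ham f.
Proof.
move=> fI H; apply/hamP => x y; apply: connect_trans (H x) _.
by rewrite fconnect_sym.
Qed.

Lemma eq_ham (T : finType) (f g : T -> T) : f =1 g -> ham f = ham g.
Proof.
move=> E; apply: eq_forallb => x; apply: eq_forallb => y.
by rewrite (eq_fconnect E).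
Qed.

Lemma ham_conj (T T' : finType) (f : T -> T) (g : T' -> T') (p : T -> T')
    (q : T' -> T) : cancel q p -> (forall x, p (f x) = g (p x)) -> ham f -> ham g.
Proof.
move=> qp E /hamP H; apply/hamP => x y.
have {H} := H (q x) (q y); move/iter_findex; move: (findex _ _ _) => k Ek.
have -> : y = iter k g x; last exact: fconnect_iter.
rewrite -(qp y) -Ek; elim: k {Ek} => [|k IH] /=; first by rewrite qp.
by rewrite E IH.
Qed.

(** A Hamiltonian permutation of a set of n points is the successor map of Z_n in
suitable coordinates. *)
Lemma ham_coord (T : finType) (n : nat) (f : T -> T) :
  1 < n -> #|T| = n -> ham f ->
  exists (p : T -> 'Z_n) (q : 'Z_n -> T),
    [/\ cancel p q, cancel q p & forall x, p (f x) = (p x + 1)%R].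
Proof.
move=> n1 cT H; have fI := ham_inj H; move/hamP: H => H.
have /card_gt0P[x0 _] : 0 < #|T| by rewrite cT ltnW.
have ordn x : order f x = n.
  by rewrite -cT; apply: eq_card => y; apply: H.
pose q (i : 'Z_n) := iter i f x0.
pose p x : 'Z_n := inZp (findex f x0 x).
have ltf x : findex f x0 x < n by rewrite -(ordn x0) findex_max.
have Zn : (Zp_trunc n).+2 = n by exact: Zp_cast.
have pq : cancel p q.
  by move=> x; rewrite /q /p /= modn_small ?Zn // iter_findex.
have qp : cancel q p.
  move=> i; apply: val_inj; rewrite /p /= /q findex_iter ?modn_small //.
  by rewrite ordn -[X in _ < X]Zn.
exists p, q; split=> // x.
have itn : iter n f x0 = x0 by rewrite -(ordn x0) iter_order.
have itm k : iter (k %% n) f x0 = iter k f x0.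
  rewrite {2}(divn_eq k n) addnC iterD; congr iter.
  by elim: (_ %/ _) => //= m IH; rewrite mulSn iterD -IH itn.
apply: (can_inj qp); rewrite pq -{1}(pq x) /q /= -iterS Zn !itm.
by rewrite -[X in iter X]addn1 -[LHS]itm -[RHS]itm modnDmr.
Qed.

Section Families.
Variable T : finType.
Implicit Types l : seq (T -> T).

(** At every point the maps of l and of l' offer the same moves: if l lists the
directions of a product and l' some colours, each colour picks its own direction
at each point. *)
Definition recolour l l' := forall x, perm_eq [seq f x | f <- l] [seq f x | f <- l'].

(** The directions in l can be redistributed into Hamilton cycles. *)
Definition decomp l := exists2 l', recolour l l' & all (@ham T) l'.

Lemma recolour_refl l : recolour l l. Proof. by move=> x. Qed.
Lemma recolour_trans l1 l2 l3 : recolour l1 l2 -> recolour l2 l3 -> recolour l1 l3.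
Proof. by move=> H K x; apply: perm_trans (H x) (K x). Qed.
Lemma recolour_cat l1 l2 l1' l2' : recolour l1 l1' -> recolour l2 l2' -> recolour (l1 ++ l2) (l1' ++ l2').
Proof. by move=> H K x; rewrite !map_cat perm_cat. Qed.

Lemma decomp_recolour l l' : recolour l l' -> decomp l' -> decomp l.
Proof. by move=> R [l2 R2 H]; exists l2 => //; apply: recolour_trans R R2. Qed.
Lemma decomp_ham l : all (@ham T) l -> decomp l.
Proof. by move=> H; exists l => //; apply: recolour_refl. Qed.
Lemma decomp_nil : decomp [::]. Proof. exact: decomp_ham. Qed.
Lemma decomp_cat l1 l2 : decomp l1 -> decomp l2 -> decomp (l1 ++ l2).
Proof.
move=> [k1 R1 H1] [k2 R2 H2]; exists (k1 ++ k2); first exact: recolour_cat.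
by rewrite all_cat H1.
Qed.
Lemma decomp_size l : decomp l -> 0 < #|T| ->
  exists2 l', recolour l l' & size l' = size l /\ all (@ham T) l'.
Proof.
move=> [l' R H] /card_gt0P[x _]; exists l' => //; split=> //.
by have /perm_size := R x; rewrite !size_map.
Qed.
End Families.

Lemma decomp_conj (T T' : finType) (p : T -> T') (q : T' -> T) l l' :
  cancel p q -> cancel q p -> recolour l' [seq p \o f \o q | f <- l] ->
  decomp l -> decomp l'.
Proof.
move=> pq qp R [k S H]; apply: (decomp_recolour R).
exists [seq p \o f \o q | f <- k].
  move=> x; have := perm_map p (S (q x)); rewrite -!map_comp.
  by congr perm_eq; apply: eq_map => f.
rewrite all_map; apply: sub_all H => f Hf /=.
by apply: (ham_conj qp) Hf => x /=; rewrite pq.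
Qed.

Section Lifts.
Variables T1 T2 : finType.

Definition lift1 (f : T1 -> T1) (z : T1 * T2) := (f z.1, z.2).
Definition lift2 (f : T2 -> T2) (z : T1 * T2) := (z.1, f z.2).

Lemma lift1_inj (f : T1 -> T1) : injective f -> injective (lift1 f).
Proof. by move=> fI [a b] [c d] [/fI -> ->]. Qed.
Lemma lift2_inj (f : T2 -> T2) : injective f -> injective (lift2 f).
Proof. by move=> fI [a b] [c d] [-> /fI ->]. Qed.

Lemma iter_lift1 m (f : T1 -> T1) :
  (forall x, iter m f x = x) -> forall z, iter m (lift1 f) z = z.
Proof.
move=> E [x y]; have -> : iter m (lift1 f) (x, y) = (iter m f x, y); last by rewrite E.
by elim: (m) => //= k ->.
Qed.
Lemma iter_lift2 m (f : T2 -> T2) :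
  (forall x, iter m f x = x) -> forall z, iter m (lift2 f) z = z.
Proof.
move=> E [x y]; have -> : iter m (lift2 f) (x, y) = (x, iter m f y); last by rewrite E.
by elim: (m) => //= k ->.
Qed.

Lemma recolour_lift1 l l' : recolour l l' -> recolour [seq lift1 f | f <- l] [seq lift1 f | f <- l'].
Proof.
move=> R [x y]; rewrite -!map_comp /=.
by have := perm_map (fun x => (x, y)) (R x); rewrite -!map_comp.
Qed.
Lemma recolour_lift2 l l' : recolour l l' -> recolour [seq lift2 f | f <- l] [seq lift2 f | f <- l'].
Proof.
move=> R [x y]; rewrite -!map_comp /=.
by have := perm_map (fun y => (x, y)) (R y); rewrite -!map_comp.
Qed.

(** Hamiltonian maps of the two factors can be matched up and each matched pair
treated on its own. *)
Lemma decomp_matching (l1 : seq (T1 -> T1)) (l2 : seq (T2 -> T2)) :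
  size l1 = size l2 -> all (@ham T1) l1 -> all (@ham T2) l2 ->
  (forall f g, ham f -> ham g -> decomp [:: lift1 f; lift2 g]) ->
  decomp ([seq lift1 f | f <- l1] ++ [seq lift2 g | g <- l2]).
Proof.
move=> S H1 H2 H; elim: l1 l2 S H1 H2 => [|f l1 IH] [|g l2] //=.
  by move=> _ _ _; apply: decomp_nil.
case=> S /andP[Hf H1] /andP[Hg H2].
apply: (decomp_recolour (l' := [:: lift1 f; lift2 g] ++
  ([seq lift1 f | f <- l1] ++ [seq lift2 g | g <- l2]))).
  move=> x; rewrite /= perm_cons !map_cat /=.
  by rewrite -cat1s perm_catCA.
by apply: decomp_cat; [apply: H|apply: IH].
Qed.
End Lifts.

(** * Positions along a cycle and skew products *)

Lemma natZp_eq0 (M k : nat) : 1 < M -> ((k%:R : 'Z_M)%R == 0%R) = (M %| k).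
Proof.
move=> M1; rewrite -(inj_eq val_inj) /= Zp_nat /= (Zp_cast M1).
by rewrite /dvdn.
Qed.

Lemma natZp_eq (M j k : nat) : 1 < M -> (j%:R = k%:R :> 'Z_M)%R -> j = k %[mod M].
Proof.
move=> M1 /(congr1 val); rewrite !Zp_nat /= (Zp_cast M1) => E.
by [].
Qed.

Lemma natZp_mod (M k N : nat) : 1 < M -> M %| N -> ((k %% N)%:R = k%:R :> 'Z_M)%R.
Proof.
move=> M1 dv; apply/val_inj; rewrite !Zp_nat /= (Zp_cast M1).
by rewrite modn_dvdm.
Qed.

Lemma iterZ (M : nat) (T : Type) (f : T -> T) (i : T -> 'Z_M) k x :
  (forall x, i (f x) = (i x + 1)%R) -> i (iter k f x) = (i x + k%:R)%R.
Proof.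
by move=> H; elim: k => [|k IH] /=; rewrite ?addr0 // H IH -addrA -natr1.
Qed.

Lemma ham_order (T : finType) (f : T -> T) x : ham f -> order f x = #|T|.
Proof. by move/hamP => H; apply: eq_card => y; apply: H. Qed.

Lemma ham_iter_card (T : finType) (f : T -> T) x : ham f -> iter #|T| f x = x.
Proof. by move=> H; rewrite -(ham_order x H) iter_order //; apply: ham_inj. Qed.

(** The position along the cycle, read modulo a divisor M of its length. *)
Lemma ham_index (T : finType) (f : T -> T) (M : nat) (x0 : T) :
  ham f -> 1 < M -> M %| #|T| ->
  exists2 i : T -> 'Z_M, i x0 = 0%R & forall x, i (f x) = (i x + 1)%R.
Proof.
move=> H M1 dv.
have T1 : 1 < #|T|.
  have T0 : 0 < #|T| by apply/card_gt0P; exists x0.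
  by apply: leq_trans M1 (dvdn_leq T0 dv).
have [p [q [pq qp E]]] := ham_coord T1 erefl H.
have val1 (u : 'Z_#|T|) : ((val (u + 1))%:R = (val u)%:R + 1 :> 'Z_M)%R.
  have dv' : M %| (Zp_trunc #|T|).+2 by rewrite Zp_cast.
  by rewrite /= natZp_mod // natrD natZp_mod.
exists (fun x => (val (p x))%:R - (val (p x0))%:R)%R; first by rewrite subrr.
by move=> x; rewrite E val1 addrAC.
Qed.

Lemma ham_sum (T : finType) (f : T -> T) (g : T -> nat) x :
  ham f -> \sum_(j < #|T|) g (iter j f x) = \sum_y g y.
Proof.
move=> H; rewrite -(big_mkord xpredT (fun j => g (iter j f x))).
have U : perm_eq (orbit f x) (index_enum T).
  apply: uniq_perm; rewrite ?orbit_uniq ?index_enum_uniq // => y.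
  by rewrite mem_index_enum -fconnect_orbit; move/hamP: H; apply.
rewrite -(perm_big _ U) /orbit (ham_order x H) /=.
rewrite /index_iota subn0.
elim: #|T| x {U} => [|n IH] x; first by rewrite !big_nil.
rewrite -addn1 iotaD big_cat /= IH trajectD big_cat /=.
by rewrite !big_cons !big_nil.
Qed.

Lemma mul_mod_surj (S N j : nat) : 0 < N -> coprime S N -> exists m, m * S = j %[mod N].
Proof.
move=> N0 cp; case: (posnP S) cp => [->|S0] cp.
  by exists 0; move: cp; rewrite /coprime gcd0n => /eqP ->; rewrite !modn1.
have [km kn E _] := egcdnP N S0; exists (j * km).
by rewrite -mulnA E (eqP cp) mulnDr muln1 mulnA modnMDl.
Qed.

Lemma ham_iter_mod (T : finType) (f : T -> T) k x :
  ham f -> iter (k %% #|T|) f x = iter k f x.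
Proof.
move=> H; rewrite {2}(divn_eq k #|T|) addnC iterD; congr iter.
by elim: (_ %/ _) => //= n IH; rewrite mulSn iterD -IH ham_iter_card.
Qed.

Lemma ham_reach (T : finType) (f : T -> T) S x y :
  ham f -> coprime S #|T| -> exists m, iter (m * S) f x = y.
Proof.
move=> H cp; have /hamP/(_ x y)/iter_findex <- := H.
have T0 : 0 < #|T| by apply/card_gt0P; exists x.
have [m E] := mul_mod_surj (findex f x y) T0 cp; exists m.
by rewrite -(ham_iter_mod _ _ H) E ham_iter_mod.
Qed.

Section Skew.
Variables (T U : finType) (b : T -> T) (h : U -> U) (g : T -> nat).
Definition skew (z : T * U) := (b z.1, iter (g z.1) h z.2).

Lemma iter_skew k x y :
  iter k skew (x, y) = (iter k b x, iter (\sum_(j < k) g (iter j b x)) h y).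
Proof.
elim: k => [|k IH] /=; first by rewrite big_ord0.
by rewrite IH /skew /= big_ord_recr /= addnC iterD.
Qed.

(** Once around the base, the fibre is moved by the total of g, which is prime to the
length of the cycle h. *)
Lemma ham_skew :
  ham b -> ham h -> coprime (\sum_x g x) #|U| -> ham skew.
Proof.
move=> Hb Hh cp; apply/hamP => -[x y] [x' y'].
have [k E] : exists k, iter k b x = x'.
  by exists (findex b x x'); apply: iter_findex; move/hamP: Hb; apply.
apply: connect_trans (fconnect_iter _ k _) _; rewrite iter_skew E.
set z := iter _ h y.
have [m Em] := ham_reach z y' Hh cp.
have R n u : iter (n * #|T|) skew (x', u) = (x', iter (n * \sum_x g x) h u).
  elim: n => [|n IH] //=; rewrite mulSn iterD IH iter_skew ham_iter_card //.
  by rewrite ham_sum // -iterD mulSn.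
by rewrite -Em -R fconnect_iter.
Qed.
End Skew.

(** * Products of two cycles *)

Section Alternate.
Variables (T1 T2 : finType) (f : T1 -> T1) (g : T2 -> T2) (M : nat).
Variables (i : T1 -> 'Z_M) (k : T2 -> 'Z_M).
Hypothesis M1 : 1 < M.
Hypothesis if_ : forall x, i (f x) = (i x + 1)%R.
Hypothesis kg : forall y, k (g y) = (k y + 1)%R.
Hypothesis fI : injective f.
Hypothesis gI : injective g.

Definition alternate (z : T1 * T2) :=
  if (i z.1 + k z.2 == 0)%R then (z.1, g z.2) else (f z.1, z.2).

Lemma alternate_inj : injective alternate.
Proof.
have aux x y x' y' : (i x + k y == 0)%R -> (i x' + k y' == 0)%R = false ->
  (x, g y) = (f x', y') -> False.
  move=> /eqP E /eqP N [Ex Ey]; apply: N; rewrite -Ey kg addrA addrAC -if_ -Ex.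
  exact: E.
move=> [x y] [x' y']; rewrite /alternate /=.
case: ifP => E; case: ifP => E'.
- by case=> -> /gI ->.
- by move/(aux _ _ _ _ E E').
- by move/esym/(aux _ _ _ _ E' E).
- by case=> /fI -> ->.
Qed.

Lemma alternate_run d x y : d < M -> (i x + k y = 1)%R ->
  fconnect alternate (x, y) (iter d f x, y).
Proof.
elim: d => [|d IH] dM E; first exact: connect0.
apply: connect_trans (IH (ltnW dM) E) _; apply: connect1; apply/eqP.
rewrite /alternate /= (iterZ d x if_) addrAC E nat1r natZp_eq0 //.
by rewrite gtnNdvd.
Qed.

Lemma alternate_round x y : (i x + k y = 0)%R ->
  fconnect alternate (x, y) (iter M.-1 f x, g y).
Proof.
move=> E; apply: (connect_trans (y := (x, g y))).
  by apply: connect1; rewrite /= /alternate E eqxx.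
apply: alternate_run; first by rewrite prednK // ltnW.
by rewrite kg addrA E add0r.
Qed.

Lemma alternate_section x y :
  exists2 x', fconnect alternate (x, y) (x', y) & (i x' + k y = 0)%R.
Proof.
pose d := val (- (i x + k y))%R.
have Ed : (d%:R = - (i x + k y) :> 'Z_M)%R by rewrite natr_Zp.
have dM : d < M by rewrite -[X in _ < X](Zp_cast M1); apply: ltn_ord.
have : (i x + k y + d%:R = 0)%R by rewrite Ed subrr.
have : forall e, e < d -> (i x + k y + e%:R != 0)%R.
  move=> e ed; apply/eqP => E.
  have : (d%:R = e%:R :> 'Z_M)%R by rewrite Ed -[LHS]addr0 -E addrA addNr add0r.
  move/(natZp_eq M1); rewrite !modn_small ?(ltn_trans ed) // => Ede.
  by rewrite Ede ltnn in ed.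
move: {Ed dM} d => d; elim: d x => [|d IH] x H E.
  by exists x; [apply: connect0|rewrite addr0 in E].
have [||x' C' E'] := IH (f x).
- move=> e ed; have -> : (i (f x) + k y + e%:R = i x + k y + e.+1%:R)%R.
    by rewrite if_ -nat1r; ring.
  exact: H.
- by rewrite if_ -[RHS]E -nat1r; ring.
exists x' => //; apply: connect_trans C'; apply: connect1; apply/eqP.
by rewrite /= /alternate; have := H 0 isT; rewrite addr0 => /negPf ->.
Qed.

(* m rounds consist of m (M - 1) steps along f and m steps along g *)
Hypothesis Hg : ham g.
Hypothesis K : forall x x' y, i x = i x' ->
  exists m, iter (m * M.-1) f x = x' /\ iter m g y = y.

Lemma alternate_rounds j x y : (i x + k y = 0)%R ->
  fconnect alternate (x, y) (iter (j * M.-1) f x, iter j g y) /\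
  (i (iter (j * M.-1) f x) + k (iter j g y) = 0)%R.
Proof.
move=> E; elim: j => [|j [IH IE]]; first by split; first exact: connect0.
split; first by rewrite /= mulSn iterD; apply: connect_trans IH (alternate_round IE).
rewrite /= mulSn iterD kg (iterZ _ _ if_) addrACA IE add0r.
by apply/eqP; rewrite natr1 prednK ?(ltnW M1) // natZp_eq0.
Qed.

Lemma alternate_ham : ham alternate.
Proof.
apply/hamP => -[x y] [x1 y1].
have [x2 C2 E2] := alternate_section x y.
have [x3 C3 E3] := alternate_section x1 y1.
apply: connect_trans C2 _.
rewrite (fconnect_sym alternate_inj); apply: connect_trans C3 _.
rewrite (fconnect_sym alternate_inj).
have [j Ej] : exists j, iter j g y = y1.
  by exists (findex g y y1); apply: iter_findex; move/hamP: Hg.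
have [C4 E4] := alternate_rounds j E2; rewrite Ej in C4 E4.
apply: connect_trans C4 _; set x4 := iter _ f x2 in E4 *.
have [|m [Em Ey]] := K (x := x4) (x' := x3) y1.
  by apply: (addIr (k y1)); rewrite E4 E3.
by have [] := alternate_rounds m E4; rewrite Em Ey.
Qed.
End Alternate.

(** One colour steps along the second cycle exactly when the sum of the two positions
is 0 modulo the length M of that cycle. A round of M steps then moves the first position by
M - 1 and the second by 1; the rounds exhaust each of the two cycles because M - 1 is
prime to the length of the first one. The other colour is the same construction with the
roles exchanged. *)
Lemma decomp_pair_dvd (T1 T2 : finType) (f : T1 -> T1) (g : T2 -> T2) :
  ham f -> ham g -> 1 < #|T2| -> #|T2| %| #|T1| -> coprime #|T2|.-1 #|T1| ->
  decomp [:: lift1 f; lift2 g].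
Proof.
move=> Hf Hg M1 dv cp.
have [y0 _] : exists y0 : T2, true by case/card_gt0P: (ltnW M1) => y; exists y.
case: (pickP (@predT T1)) => [x0 _|T0]; last first.
  exists [:: lift1 f; lift2 g]; first exact: recolour_refl.
  by rewrite /= !andbT; apply/andP; split; apply/hamP => -[x]; have := T0 x.
have [i _ ie] := ham_index x0 Hf M1 dv.
have [k _ ke] := ham_index y0 Hg M1 (dvdnn _).
exists [:: alternate f g i k; fun z => let u := alternate g f k i (z.2, z.1) in (u.2, u.1)].
  move=> [x y]; rewrite /= /alternate /= [(k y + i x)%R]addrC.
  case: ifP => _ //; rewrite -cat1s -[X in perm_eq _ X]cat1s perm_catC //.
have step (T : finType) (h : T -> T) (j : T -> 'Z_#|T2|) x x' :
    (forall x, j (h x) = (j x + 1)%R) -> ham h -> j x = j x' ->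
    exists m, iter (m * #|T2|) h x = x'.
  move=> jh H E; have /hamP/(_ x x')/iter_findex Ed := H.
  have : (#|T2| %| findex h x x').
    rewrite -natZp_eq0 //; apply/eqP; apply: (addrI (j x)).
    by rewrite -(iterZ _ _ jh) Ed addr0.
  by case/dvdnP => m Em; exists m; rewrite -Em.
rewrite /= andbT; apply/andP; split.
  apply: (alternate_ham M1 ie ke (ham_inj Hf) (ham_inj Hg) Hg) => x x' y E.
  have [m Em] := step _ f i x x' ie Hf E.
  have T0 : 0 < #|T1| by apply/card_gt0P; exists x0.
  have [e Ee] := mul_mod_surj m T0 cp.
  exists (e * #|T2|); split; last first.
    by elim: e {Ee} => //= e IH; rewrite mulSn iterD IH ham_iter_card.
  by rewrite mulnAC -(ham_iter_mod _ _ Hf) -modnMml Ee modnMml (ham_iter_mod _ _ Hf).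
have H : ham (alternate g f k i).
  apply: (alternate_ham M1 ke ie (ham_inj Hg) (ham_inj Hf) Hf) => y y' x E.
  have [m <-] := step _ g k y y' ke Hg E; exists 0; split=> //=.
  by elim: m => //= e IH; rewrite mulSn iterD -IH ham_iter_card.
by apply: (ham_conj (p := fun u => (u.2, u.1)) (q := fun z => (z.2, z.1))) H => [[]|[]].
Qed.

(** * Powers of n and the torus *)

Lemma decomp_swap (T1 T2 : finType) (f : T1 -> T1) (g : T2 -> T2) :
  decomp [:: lift1 g; lift2 f] -> decomp [:: lift1 f; lift2 g].
Proof.
apply: (decomp_conj (p := fun u => (u.2, u.1)) (q := fun z => (z.2, z.1))).
- by case.
- by case.
by move=> [x y]; rewrite /= -cat1s -[X in perm_eq _ X]cat1s perm_catC.
Qed.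

Lemma coprime_pred_exp n a b : 1 < n -> 0 < b -> coprime (n ^ b).-1 (n ^ a).
Proof.
move=> n1 b0; apply: coprimeXr; have N0 : 0 < n ^ b by rewrite expn_gt0 ltnW.
by rewrite -(coprime_pexpr _ _ b0) coprime_sym -{1}(prednK N0) coprimeSn.
Qed.

(** The smaller power M of n divides the larger one, and M - 1 is prime to n. *)
Lemma decomp_pair (T1 T2 : finType) n a b (f : T1 -> T1) (g : T2 -> T2) :
  1 < n -> 0 < a -> 0 < b -> #|T1| = n ^ a -> #|T2| = n ^ b ->
  ham f -> ham g -> decomp [:: lift1 f; lift2 g].
Proof.
move=> n1 a0 b0 c1 c2 Hf Hg.
have gt1 e : 0 < e -> 1 < n ^ e by move=> e0; rewrite -(exp1n e) ltn_exp2r.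
have [ab|/ltnW ba] := leqP b a.
  apply: decomp_pair_dvd; rewrite ?c1 ?c2 ?gt1 //; first exact: dvdn_exp2l.
  exact: coprime_pred_exp.
apply: decomp_swap; apply: decomp_pair_dvd; rewrite ?c1 ?c2 ?gt1 //.
  exact: dvdn_exp2l.
exact: coprime_pred_exp.
Qed.

Lemma decomp_matching3 (K : finType) (l1 l2 l3 : seq (K -> K)) :
  size l1 = size l2 -> size l2 = size l3 ->
  all (@ham K) l1 -> all (@ham K) l2 -> all (@ham K) l3 ->
  (forall f g h, ham f -> ham g -> ham h ->
     decomp [:: @lift1 K (K * K)%type f; lift2 (lift1 g); lift2 (lift2 h)]) ->
  decomp ([seq @lift1 K (K * K)%type f | f <- l1] ++ [seq lift2 (lift1 g) | g <- l2] ++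
        [seq lift2 (lift2 h) | h <- l3]).
Proof.
move=> S12 S23 H1 H2 H3 H.
elim: l1 l2 l3 S12 S23 H1 H2 H3 => [|f l1 IH] [|g l2] [|h l3] //=.
  by move=> *; apply: decomp_nil.
case=> S12 [S23] /andP[Hf H1] /andP[Hg H2] /andP[Hh H3].
apply: decomp_recolour (decomp_cat (H _ _ _ Hf Hg Hh) (IH _ _ S12 S23 H1 H2 H3)) => x.
rewrite /= !map_cat /=; apply/permP => P; rewrite !(count_cat, map_cat) /= !count_cat /= ?count_cat /=; clear; lia.
Qed.

Fixpoint tor n D : finType := if D is D'.+1 then ('Z_n * tor n D')%type else unit.

Fixpoint dirs n D : seq (tor n D -> tor n D) :=
  match D with
  | 0 => [::]
  | D'.+1 => @lift1 'Z_n (tor n D') (fun x => (x + 1)%R) :: [seq lift2 f | f <- dirs n D']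
  end.

Definition torus_decomp n D := decomp (dirs n D).

Lemma card_tor n D : 1 < n -> #|tor n D| = n ^ D.
Proof.
move=> n1; elim: D => [|D IH] /=; first by rewrite card_unit.
by rewrite card_prod IH card_ord expnS Zp_cast.
Qed.

Lemma size_dirs n D : size (dirs n D) = D.
Proof. by elim: D => //= D IH; rewrite size_map IH. Qed.

Lemma torus_hams n D : 1 < n -> torus_decomp n D ->
  exists2 l, recolour (dirs n D) l & size l = D /\ all (@ham _) l.
Proof.
move=> n1 G; have [|l R [S H]] := decomp_size G; first by rewrite card_tor // expn_gt0 ltnW.
by exists l => //; rewrite S size_dirs.
Qed.

Fixpoint tjoin n a b : tor n a * tor n b -> tor n (a + b) :=
  match a with
  | 0 => fun z => z.2
  | a'.+1 => fun z => (z.1.1, tjoin (z.1.2, z.2))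
  end.

Fixpoint tsplit n a b : tor n (a + b) -> tor n a * tor n b :=
  match a with
  | 0 => fun z => (tt, z)
  | a'.+1 => fun z => let u := tsplit z.2 in ((z.1, u.1), u.2)
  end.

Lemma tjoinK n a b : cancel (@tjoin n a b) (@tsplit n a b).
Proof.
elim: a => [|a IH] /=; first by move=> [[] y].
by move=> [[u x] y] /=; rewrite IH.
Qed.

Lemma tsplitK n a b : cancel (@tsplit n a b) (@tjoin n a b).
Proof.
elim: a => [|a IH] //= [u z] /=; congr (_, _).
by have := IH z; case: (tsplit z).
Qed.

Lemma dirs_join n a b (z : tor n a * tor n b) :
  [seq f (tjoin z) | f <- dirs n (a + b)] =
  [seq tjoin (f z) | f <- [seq lift1 f | f <- dirs n a] ++ [seq lift2 f | f <- dirs n b]].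
Proof.
elim: a z => [|a IH] /=; first by move=> [[] y]; rewrite -map_comp; apply: eq_map.
move=> [[u x] y] /=; congr (_ :: _).
have := congr1 (map (fun t => (u, t))) (IH (x, y)).
by rewrite !map_cat -!map_comp.
Qed.

Lemma torus_split n a b :
  decomp ([seq @lift1 (tor n a) (tor n b) f | f <- dirs n a] ++
        [seq @lift2 (tor n a) (tor n b) f | f <- dirs n b]) ->
  torus_decomp n (a + b).
Proof.
apply: (decomp_conj (@tjoinK n a b) (@tsplitK n a b)) => x.
by rewrite -{1}(tsplitK x) dirs_join -map_comp.
Qed.

Lemma torus_double n m : 1 < n -> 0 < m -> torus_decomp n m -> torus_decomp n (m + m).
Proof.
move=> n1 m0 G; have [l R [S H]] := torus_hams n1 G.
apply: torus_split.
apply: decomp_recolour (recolour_cat (recolour_lift1 R) (recolour_lift2 R)) _.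
apply: decomp_matching => // f g Hf Hg.
exact: (decomp_pair n1 m0 m0 (card_tor m n1) (card_tor m n1)).
Qed.

Lemma eqP_perm (T : eqType) (s1 s2 : seq T) : s1 = s2 -> perm_eq s1 s2.
Proof. by move->. Qed.

Section Cube.
Variables n m : nat.
Let K := tor n m.
Definition cube_dirs : seq (K * (K * K) -> K * (K * K)) :=
  [seq lift1 f | f <- dirs n m] ++ [seq lift2 (lift1 f) | f <- dirs n m] ++
  [seq lift2 (lift2 f) | f <- dirs n m].
Definition cube_join (z : K * (K * K)) : tor n (m + (m + m)) :=
  tjoin (z.1, tjoin z.2).
Definition cube_split (x : tor n (m + (m + m))) : K * (K * K) :=
  ((tsplit x).1, tsplit (tsplit x).2).

Lemma cube_joinK : cancel cube_join cube_split.
Proof. by move=> [x y]; rewrite /cube_split /cube_join !tjoinK. Qed.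
Lemma cube_splitK : cancel cube_split cube_join.
Proof. by move=> x; rewrite /cube_join /cube_split tsplitK -surjective_pairing tsplitK. Qed.

Lemma dirs_cube z :
  [seq f (cube_join z) | f <- dirs n (m + (m + m))] = [seq cube_join (f z) | f <- cube_dirs].
Proof.
rewrite dirs_join /cube_dirs !map_cat -!map_comp; congr (_ ++ _).
have := congr1 (map (fun t => tjoin (z.1, t))) (dirs_join z.2).
by rewrite !map_cat -!map_comp.
Qed.
End Cube.

Lemma torus_cube n m : decomp (cube_dirs n m) -> torus_decomp n (m + (m + m)).
Proof.
apply: (decomp_conj (@cube_joinK n m) (@cube_splitK n m)) => x.
by rewrite -{1}(cube_splitK x) dirs_cube -map_comp.
Qed.

Lemma torus_cube_split n m w :
  decomp ([seq @lift1 _ (tor n w) f | f <- cube_dirs n m] ++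
        [seq lift2 f | f <- dirs n w]) ->
  torus_decomp n (m + (m + m) + w).
Proof.
move=> G; apply: torus_split; move: G.
apply: (decomp_conj (p := fun z => (cube_join z.1, z.2))
                  (q := fun z => (cube_split z.1, z.2))).
- by move=> [x y] /=; rewrite cube_joinK.
- by move=> [x y] /=; rewrite cube_splitK.
move=> [x y]; rewrite !map_cat -!map_comp /=; apply: perm_cat.
  have := congr1 (map (fun t => (t, y))) (dirs_cube (cube_split x)).
  by rewrite cube_splitK /cube_dirs !map_cat -!map_comp => E; apply: eqP_perm; apply: E.
by apply: eqP_perm; apply: eq_map => f; rewrite /= /lift2 /= cube_splitK.
Qed.

Lemma recolour_cube_dirs n m l : recolour (dirs n m) l ->
  recolour (cube_dirs n m) ([seq lift1 g | g <- l] ++ [seq lift2 (lift1 g) | g <- l] ++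
    [seq lift2 (lift2 g) | g <- l]).
Proof.
move=> R; apply: recolour_cat (recolour_lift1 R) _.
rewrite [map (fun f => lift2 (lift1 f)) (dirs _ _)]map_comp.
rewrite [map (fun f => lift2 (lift2 f)) (dirs _ _)]map_comp.
rewrite [map (fun f => lift2 (lift1 f)) l]map_comp.
rewrite [map (fun f => lift2 (lift2 f)) l]map_comp.
by apply: recolour_cat; apply: recolour_lift2; [apply: recolour_lift1|apply: recolour_lift2].
Qed.

(** The m Hamilton cycles of Z_n^m are taken in turn, each along all three factors. *)
Lemma torus_triple n m : 1 < n -> 0 < m ->
  (forall (K : finType) (f g h : K -> K), #|K| = n ^ m -> ham f -> ham g -> ham h ->
     decomp [:: @lift1 K (K * K)%type f; lift2 (lift1 g); lift2 (lift2 h)]) ->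
  torus_decomp n m -> torus_decomp n (m + (m + m)).
Proof.
move=> n1 m0 T3 G; have [l R [S H]] := torus_hams n1 G.
have T3' := fun f g h => T3 _ f g h (card_tor m n1).
apply: torus_cube.
apply: decomp_recolour (decomp_matching3 erefl erefl H H H T3').
exact: recolour_cube_dirs.
Qed.

(** * Groups of cycles on a product of four factors *)

Section Blocks.
Variables K W : finType.
Local Notation V := (K * (K * K))%type.
Definition axis1 (f : K -> K) : V * W -> V * W := lift1 (lift1 f).
Definition axis2 (f : K -> K) : V * W -> V * W := lift1 (lift2 (lift1 f)).
Definition axis3 (f : K -> K) : V * W -> V * W := lift1 (lift2 (lift2 f)).
Definition axisW (f : W -> W) : V * W -> V * W := lift2 f.

(** Pairing the second axis with the third, and the first with W, leaves two cycles
on each of the two halves, which can be paired again. *)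
Lemma decomp_four n s w (f g h : K -> K) (u : W -> W) :
  1 < n -> 0 < s -> 0 < w -> #|K| = n ^ s -> #|W| = n ^ w ->
  ham f -> ham g -> ham h -> ham u ->
  decomp [:: axis1 f; axis2 g; axis3 h; axisW u].
Proof.
move=> n1 s0 w0 cK cW Hf Hg Hh Hu.
have c2 : #|{: K * K}| = n ^ (s + s) by rewrite card_prod cK expnD.
have c1 : #|{: K * W}| = n ^ (s + w) by rewrite card_prod cK cW expnD.
have gs (T : finType) l : #|T| = n ^ (s + s) \/ #|T| = n ^ (s + w) -> @decomp T l ->
    exists2 l', recolour l l' & size l' = size l /\ all (@ham T) l'.
  by move=> c G; apply: decomp_size G _; case: c => ->; rewrite expn_gt0 ltnW.
have [l1 R1 [S1 H1]] := gs _ _ (or_introl c2) (decomp_pair n1 s0 s0 cK cK Hg Hh).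
have [l2 R2 [S2 H2]] := gs _ _ (or_intror c1) (decomp_pair n1 s0 w0 cK cW Hf Hu).
have G := decomp_matching (etrans S1 (esym S2)) H1 H2
  (fun x y => @decomp_pair _ _ n _ _ x y n1 (ltn_addr _ s0) (ltn_addr _ s0) c2 c1).
have {G R1 R2} := decomp_recolour (recolour_cat (recolour_lift1 R1) (recolour_lift2 R2)) G.
apply: (decomp_conj (p := fun z => ((z.2.1, z.1), z.2.2))
                  (q := fun z => (z.1.2, (z.1.1, z.2)))).
- by move=> [[? ?] [? ?]].
- by move=> [[? [? ?]] ?].
move=> [[x [y z]] t]; apply/permP => P.
by rewrite /= /axis1 /axis2 /axis3 /axisW /lift1 /lift2 /=; clear; lia.
Qed.

Lemma decomp_fours n s w (l : seq (K -> K)) (m : seq (W -> W)) :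
  1 < n -> 0 < s -> 0 < w -> #|K| = n ^ s -> #|W| = n ^ w ->
  size l = size m -> all (@ham K) l -> all (@ham W) m ->
  decomp ([seq axis1 f | f <- l] ++ [seq axis2 f | f <- l] ++ [seq axis3 f | f <- l] ++
        [seq axisW u | u <- m]).
Proof.
move=> n1 s0 w0 cK cW; elim: l m => [|f l IH] [|u m] //=; first by move=> *; apply: decomp_nil.
case=> S /andP[Hf Hl] /andP[Hu Hm].
apply: decomp_recolour (decomp_cat (decomp_four n1 s0 w0 cK cW Hf Hf Hf Hu) (IH _ S Hl Hm)) => x.
apply/permP => P; rewrite /= !(count_cat, map_cat) /= !(count_cat, map_cat) /= ?(count_cat, map_cat) /=; clear; lia.
Qed.

End Blocks.

(** Three cycles of the same length, a power of n; and one cycle of K along the three axes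
of K^3 together with two cycles of W. *)
Definition triple_decomp n := forall (K : finType) (f g h : K -> K) m, 0 < m ->
  #|K| = n ^ m -> ham f -> ham g -> ham h ->
  decomp [:: @lift1 K (K * K)%type f; lift2 (lift1 g); lift2 (lift2 h)].

Definition quintuple_decomp n s w := forall (K W : finType) (f : K -> K) (u v : W -> W),
  #|K| = n ^ s -> #|W| = n ^ w -> ham f -> ham u -> ham v ->
  decomp [:: @axis1 K W f; @axis2 K W f; @axis3 K W f; @axisW K W u; @axisW K W v].

Lemma all_catE (T : Type) (a : pred T) (l : seq T) k :
  all a l -> all a (take k l) /\ all a (drop k l).
Proof. by rewrite -{1}(cat_take_drop k l) all_cat => /andP. Qed.

(** One cycle of K is taken along all three axes together with two cycles of W, each of
b cycles of K is taken along the three axes together with one cycle of W, and the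
remaining e cycles of K yield 3 e cycles of K^3, which are matched with the remaining
3 e cycles of W. *)
Lemma decomp_blocks n s w b e (K W : finType) (l : seq (K -> K)) (m : seq (W -> W)) :
  1 < n -> 0 < s -> 0 < w -> triple_decomp n -> quintuple_decomp n s w ->
  #|K| = n ^ s -> #|W| = n ^ w -> all (@ham K) l -> all (@ham W) m ->
  size l = (b + e).+1 -> size m = (3 * e + b).+2 ->
  decomp ([seq @axis1 K W f | f <- l] ++ [seq axis2 f | f <- l] ++ [seq axis3 f | f <- l] ++
        [seq axisW g | g <- m]).
Proof.
move=> n1 s0 w0 T3 Q5 cK cW.
case: l => // f l /= /andP[Hf Hl].
case: m => // u [//|v m] /= /and3P[Hu Hv Hm] [Sl] [Sm].
have [Hlb Hle] := all_catE b Hl; have [Hmb Hme] := all_catE b Hm.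
have Slb : size (take b l) = b by rewrite size_takel // Sl leq_addr.
have Smb : size (take b m) = b by rewrite size_takel // Sm leq_addl.
have Sle : size (drop b l) = e by rewrite size_drop Sl addKn.
have Sme : size (drop b m) = 3 * e by rewrite size_drop Sm addnK.
rewrite -(cat_take_drop b l) -(cat_take_drop b m).
move: (take b l) (drop b l) (take b m) (drop b m) Hlb Hle Hmb Hme Slb Smb Sle Sme.
move=> lb le mb me Hlb Hle Hmb Hme Slb Smb Sle Sme.
have c3 : #|{: K * (K * K)}| = n ^ (s + (s + s)) by rewrite !expnD -!cK !card_prod.
have [|l3 R3 [S3 H3]] := decomp_size (decomp_matching3 erefl erefl Hle Hle Hle
   (fun f g h => @T3 K f g h s s0 cK)); first by rewrite c3 expn_gt0 ltnW.
have G1 := Q5 K W f u v cK cW Hf Hu Hv.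
have G2 := decomp_fours n1 s0 w0 cK cW (etrans Slb (esym Smb)) Hlb Hmb.
have G3 : decomp ([seq @lift1 _ W x | x <- l3] ++ [seq lift2 x | x <- me]).
  apply: decomp_matching => //; first by rewrite S3 !size_cat !size_map Sme Sle; clear; lia.
  by move=> x y; apply: (decomp_pair n1 _ w0 c3 cW); rewrite addn_gt0 s0.
have {R3} G3 : decomp ([seq @axis1 K W f | f <- le] ++ [seq axis2 f | f <- le] ++
    [seq axis3 f | f <- le] ++ [seq axisW g | g <- me]).
  move: (recolour_lift1 (T2 := W) R3); rewrite !map_cat -!map_comp => R3'.
  have := decomp_recolour (recolour_cat R3' (@recolour_refl _ _)) G3.
  by rewrite -!catA.
apply: decomp_recolour (decomp_cat G1 (decomp_cat G2 G3)) => x.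
apply/permP => P; rewrite !(map_cat, map_cons) /= !(map_cat, count_cat) /= !(map_cat, count_cat) /= ?(map_cat, count_cat) /= ?count_cat; clear; lia.
Qed.

(** The dimension is 6 e + 4 b + 5. *)
Lemma torus_blocks n b e (s := (b + e).+1) (w := (3 * e + b).+2) :
  1 < n -> triple_decomp n -> quintuple_decomp n s w ->
  torus_decomp n s -> torus_decomp n w -> torus_decomp n (s + (s + s) + w).
Proof.
move=> n1 T3 Q5 Gs Gw.
have [l Rl [Sl Hl]] := torus_hams n1 Gs; have [m Rm [Sm Hm]] := torus_hams n1 Gw.
apply: torus_cube_split.
have G := decomp_blocks (s := s) (w := w) n1 (ltn0Sn _) (ltn0Sn _) T3 Q5 (card_tor s n1) (card_tor w n1) Hl Hm Sl Sm.
have R := recolour_cube_dirs Rl.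
have {}R := recolour_cat (@recolour_lift1 _ (tor n w) _ _ R) (@recolour_lift2 (tor n s * (tor n s * tor n s))%type _ _ _ Rm).
apply: decomp_recolour R _; rewrite !map_cat -!map_comp -!catA.
exact: G.
Qed.

(** * Reduction to few dimensions *)

Lemma torus_decomp1 n : 1 < n -> torus_decomp n 1.
Proof.
move=> n1; apply: decomp_ham; rewrite /= andbT; apply/hamP => -[x []] [y []].
have E k (z : 'Z_n) : iter k (@lift1 _ unit (fun x : 'Z_n => (x + 1)%R)) (z, tt) = ((z + k%:R)%R, tt).
  by elim: k => [|k IH]; rewrite ?addr0 //= IH /lift1 /= -natr1 addrA.
have -> : (y, tt) = iter (val (y - x)%R) (@lift1 _ unit (fun x : 'Z_n => (x + 1)%R)) (x, tt).
  by rewrite E natr_Zp addrC subrK.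
exact: fconnect_iter.
Qed.

(** An even D is twice a smaller dimension. For odd D >= 9 the equation D = 6 e + 4 b + 5
has a solution with e <= 1 and b + e > 0. *)
Lemma torus_decomp_all n :
  2 < n -> triple_decomp n -> (forall s w, 1 < s -> s < w -> quintuple_decomp n s w) ->
  torus_decomp n 5 -> torus_decomp n 7 -> forall D, torus_decomp n D.
Proof.
move=> n2 T3 Q5 G5 G7 D; have n1 : 1 < n by exact: ltnW.
have [k] := ubnP D; elim: k D => // k IH D Dk.
have [->|D0] := eqVneq D 0; first exact: decomp_nil.
case: (boolP (odd D)) => oD; last first.
  have E : D = D./2 + D./2 by rewrite addnn -[LHS]odd_double_half (negPf oD).
  rewrite E; apply: torus_double => //; first by case: (D./2) E D0 => // ->.
  by apply: IH; move: E D0 Dk; clear; lia.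
have [->|D1] := eqVneq D 1; first exact: torus_decomp1.
have [->|D3] := eqVneq D 3.
  apply: (@torus_triple n 1) => //; last exact: torus_decomp1.
  by move=> K f g h cK; apply: T3 cK.
have [->|D5] := eqVneq D 5 => //.
have [->|D7] := eqVneq D 7 => //.
have [b [e [be E]]] : exists b e, 0 < b + e /\ D = (b + e).+1 + ((b + e).+1 + (b + e).+1) + (3 * e + b).+2.
  have oE := odd_double_half D; rewrite oD in oE.
  case: (boolP (odd D./2)) => o2; have oE2 := odd_double_half D./2.
    rewrite o2 in oE2; exists (D./2./2 - 2), 1.
    by move: oE oE2 D1 D3 D5 D7 D0; clear; lia.
  rewrite (negPf o2) in oE2; exists (D./2./2 - 1), 0.
  by move: oE oE2 D1 D3 D5 D7 D0; clear; lia.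
rewrite E; apply: torus_blocks => //.
- by apply: Q5; move: be; clear; lia.
- by apply: IH; move: Dk; rewrite E; clear; lia.
by apply: IH; move: Dk; rewrite E; clear; lia.
Qed.

(** * Layered maps *)

Lemma val_natZ M k : k < M -> 1 < M -> val (k%:R : 'Z_M)%R = k.
Proof. by move=> kM M1; rewrite -[RHS](modn_small kM); apply: val_Zp_nat. Qed.

Lemma ltn_Zp M (x : 'Z_M) : 1 < M -> val x < M.
Proof. by move=> M1; have := ltn_ord x; rewrite [X in _ < X]Zp_cast. Qed.

Lemma connect_from (T : finType) (e : rel T) y x z :
  connect e y z -> connect e x y -> connect e x z.
Proof. by move=> H K; apply: connect_trans K H. Qed.

Lemma fconnect_run (T : finType) (f : T -> T) (x : nat -> T) k :
  (forall j, j < k -> f (x j) = x j.+1) -> fconnect f (x 0) (x k).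
Proof.
elim: k => [|k IH] H; first exact: connect0.
apply: connect_trans (IH _) _; first by move=> j jk; apply: H; apply: ltnW.
by apply: connect1; rewrite /= H.
Qed.

Section Layers.
Variables (T : finType) (M : nat) (s : nat -> T -> T).
Hypothesis M1 : 1 < M.

Definition layered (z : 'Z_M * T) : 'Z_M * T := ((z.1 + 1)%R, s (val z.1) z.2).

Fixpoint descend k z := if k is k'.+1 then s k' (descend k' z) else z.

Lemma iter_layered k z : k <= M -> iter k layered (0%R, z) = ((k%:R)%R, descend k z).
Proof.
elim: k => [|k IH] //= kM; rewrite IH 1?ltnW // /layered natr1 /=.
by have /= -> := val_natZ kM M1.
Qed.

Lemma layered_inj : (forall t, t < M -> injective (s t)) -> injective layered.
Proof.
move=> H [t z] [t' z'] E; have /= /addIr Et := congr1 fst E; rewrite -Et in E *; congr (_, _).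
move: E => /(congr1 snd) /= E.
by apply: H E; apply: ltn_Zp.
Qed.

(** A map that sends layer t to layer t + 1 is a single cycle as soon as its passage
through all the layers is a single cycle on one of them. *)
Lemma ham_layered :
  (forall t, t < M -> injective (s t)) -> ham (descend M) -> ham layered.
Proof.
move=> H /hamP C; have I := layered_inj H.
have Z0 (t : 'Z_M) z : exists z', fconnect layered (t, z) (0%R, z').
  have [k Ek] : exists k, (t + k%:R = 0)%R by exists (val (- t)%R); rewrite natr_Zp subrr.
  have E : (iter k layered (t, z)).1 = 0%R.
    rewrite -Ek; elim: (k) => [|j IH] /=; first by rewrite addr0.
    by rewrite IH -natr1 addrA.
  exists (iter k layered (t, z)).2; rewrite -E -surjective_pairing.
  exact: fconnect_iter.
have step z : fconnect layered (0%R, z) (0%R, descend M z).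
  have E : (M%:R = 0 :> 'Z_M)%R by apply/eqP; rewrite natZp_eq0.
  by rewrite -[X in (X, descend M z)]E -iter_layered // fconnect_iter.
apply/hamP => -[t z] [t' z']; have [u Cu] := Z0 t z; have [u' Cu'] := Z0 t' z'.
apply: connect_trans Cu _; rewrite (fconnect_sym I).
apply: connect_trans Cu' _; rewrite (fconnect_sym I).
have /iter_findex <- := C u u'; elim: findex => [|k IH]; first exact: connect0.
exact: connect_trans IH (step _).
Qed.
End Layers.

Section LayeredTorus.
Variables N M : nat.
Local Notation L := ('Z_N * 'Z_M)%type.
Definition moveP (z : L) : L := ((z.1 + 1)%R, z.2).
Definition moveR (z : L) : L := (z.1, (z.2 + 1)%R).

(** The sum of the three coordinates modulo M grows by 1 with each step, so it serves as
the layer; the first two coordinates remain. In these coordinates the steps are moveP,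
moveR and the identity, and each layer distributes them independently of the others. *)
Lemma decomp_layered (s0 s1 s2 : nat -> L -> L) :
  1 < M -> 1 < N -> M %| N ->
  (forall t z, t < M -> perm_eq [:: s0 t z; s1 t z; s2 t z] [:: moveP z; moveR z; z]) ->
  all (@ham _) [:: layered (M := M) s0; layered s1; layered s2] ->
  forall (K1 K2 : finType) (f : K1 -> K1) (g h : K2 -> K2),
  #|K1| = N -> #|K2| = M -> ham f -> ham g -> ham h ->
  decomp [:: @lift1 K1 (K2 * K2)%type f; lift2 (lift1 g); lift2 (lift2 h)].
Proof.
move=> M1 N1 dv R H K1 K2 f g h c1 c2 Hf Hg Hh.
have [p [p' [pK p'K pE]]] := ham_coord N1 c1 Hf.
have [q [q' [qK q'K qE]]] := ham_coord M1 c2 Hg.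
have [r [r' [rK r'K rE]]] := ham_coord M1 c2 Hh.
pose red (x : 'Z_N) : 'Z_M := ((val x)%:R)%R.
have redD x : red (x + 1)%R = (red x + 1)%R.
  have dv' : M %| (Zp_trunc N).+2 by rewrite Zp_cast.
  by rewrite /red /= natZp_mod // natrD natZp_mod.
apply: (decomp_conj (l := [:: layered (M := M) s0; layered s1; layered s2])
  (p := fun z : 'Z_M * L => (p' z.2.1, (q' z.2.2, r' (z.1 - red z.2.1 - z.2.2)%R)))
  (q := fun u : K1 * (K2 * K2) =>
    ((red (p u.1) + q u.2.1 + r u.2.2)%R, (p u.1, q u.2.1)))).
- by move=> [t [a b]] /=; rewrite p'K q'K r'K; congr (_, _); ring.
- move=> [x [y z]] /=; rewrite pK qK; congr (_, (_, _)).
  by rewrite -[RHS]rK; congr r'; ring.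
- move=> [x [y z]] /=.
  set t : 'Z_M := (red (p x) + q y + r z)%R.
  have := R (val t) (p x, q y) (ltn_Zp t M1).
  move/(perm_map (fun w : L => (p' w.1, (q' w.2, r' (t + 1 - red w.1 - w.2)%R)))) => /=.
  rewrite perm_sym; congr perm_eq.
  rewrite /lift1 /lift2 /= -pE -qE !pK !qK; congr [:: (_, (_, _)); (_, (_, _)); (_, (_, _))].
  + by rewrite -[RHS]rK pE redD; congr r'; rewrite /t; ring.
  + by rewrite -[RHS]rK qE; congr r'; rewrite /t; ring.
  by rewrite -[RHS]rK rE; congr r'; rewrite /t; ring.
exact: decomp_ham.
Qed.
End LayeredTorus.

(** * Three cycles: odd lengths *)

Lemma descend_const (T : finType) (s : nat -> T -> T) (r : T -> T) m j z :
  (forall t y, m <= t -> s t y = r y) ->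
  descend s (j + m) z = iter j r (descend s m z).
Proof. by move=> H; elim: j => //= j IH; rewrite H ?IH // leq_addl. Qed.

Lemma descend_inj (T : finType) (s : nat -> T -> T) k :
  (forall t, injective (s t)) -> injective (descend s k).
Proof. by move=> H; elim: k => //= k IH x y /H /IH. Qed.

Lemma ham_succ n : 1 < n -> ham (fun x : 'Z_n => (x + 1)%R).
Proof.
move=> n1; apply/hamP => x y.
have E k : iter k (fun x : 'Z_n => (x + 1)%R) x = (x + k%:R)%R.
  by elim: k => [|k IH]; rewrite ?addr0 //= IH -natr1 addrA.
have -> : y = iter (val (y - x)%R) (fun x : 'Z_n => (x + 1)%R) x.
  by rewrite E natr_Zp addrC subrK.
exact: fconnect_iter.
Qed.

Lemma natZp_step M q (b : 'Z_M) : 1 < M -> coprime q M -> exists k, (b + (k * q)%:R = 0)%R.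
Proof.
move=> M1 cp; have [k E] := mul_mod_surj (val (- b)%R) (ltnW M1) cp; exists k.
rewrite -[b]opprK -(natr_Zp (- b)%R) -(natZp_mod (k * q) M1 (dvdnn M)) E.
by rewrite natZp_mod // addrC subrr.
Qed.

Section OddDesign.
Variables N M : nat.
Hypotheses (M2 : 2 < M) (dv : M %| N) (N0 : 0 < N).
Hypotheses (cp1 : coprime M.-1 N) (cp2 : coprime M.-2 N).
Local Notation L := ('Z_N * 'Z_M)%type.
Let M1 : 1 < M. Proof. exact: ltnW. Qed.
Let N1 : 1 < N. Proof. exact: leq_trans M1 (dvdn_leq N0 dv). Qed.
Let cpM q : coprime q N -> coprime q M. Proof. exact: coprime_dvdr. Qed.
Local Open Scope ring_scope.

(** The colours are constant on a layer, except that in each of the layers 0, 1, 2 two of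
them are exchanged along one line; such a line is closed under the exchange. *)
Definition oddX t (z : L) : L :=
  match t with
  | 0%N => if z.2 == 0 then moveP z else z
  | 1%N => if z.1 == 0 then z else moveR z
  | 2%N => if z.1 == 1 then z else moveR z
  | _ => moveR z
  end.
Definition oddY t (z : L) : L :=
  match t with
  | 0%N => if z.2 == 0 then z else moveP z
  | 1%N => if z.1 == 0 then moveR z else z
  | _ => moveP z
  end.
Definition oddZ t (z : L) : L :=
  match t with
  | 0%N => moveR z
  | 1%N => moveP z
  | 2%N => if z.1 == 1 then moveR z else z
  | _ => z
  end.

Lemma odd_perm t z :
  perm_eq [:: oddX t z; oddY t z; oddZ t z] [:: moveP z; moveR z; z].
Proof.
case: t => [|[|[|t]]] /=; try case: ifP => _;
  by apply/permP => P /=; clear; lia.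
Qed.

Lemma moveP_inj : injective (@moveP N M).
Proof.
move=> [a b] [a' b'] E.
by have /= /addIr -> := congr1 fst E; have /= -> := congr1 snd E.
Qed.
Lemma moveR_inj : injective (@moveR N M).
Proof.
move=> [a b] [a' b'] E.
by have /= /addIr -> := congr1 snd E; have /= -> := congr1 fst E.
Qed.

Lemma if_moveP_inj (P : pred 'Z_M) :
  injective (fun z : L => if P z.2 then moveP z else z).
Proof.
move=> [a b] [a' b'] /= E.
have Eb : b = b' by move: E; case: ifP; case: ifP => _ _ [].
by move: E; rewrite -Eb; case: ifP => // _ /moveP_inj.
Qed.
Lemma if_moveR_inj (P : pred 'Z_N) :
  injective (fun z : L => if P z.1 then moveR z else z).
Proof.
move=> [a b] [a' b'] /= E.
have Ea : a = a' by move: E; case: ifP; case: ifP => _ _ [].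
by move: E; rewrite -Ea; case: ifP => // _ /moveR_inj.
Qed.

Lemma oddX_inj t : injective (oddX t).
Proof.
case: t => [|[|[|t]]] x y.
- exact: (@if_moveP_inj (pred1 0)).
- move=> E; apply: (@if_moveR_inj (predC1 0)); move: E => /=.
  by case: eqP => _; case: eqP => _.
- move=> E; apply: (@if_moveR_inj (predC1 1)); move: E => /=.
  by case: eqP => _; case: eqP => _.
exact: moveR_inj.
Qed.

Lemma oddY_inj t : injective (oddY t).
Proof.
case: t => [|[|t]] x y.
- move=> E; apply: (@if_moveP_inj (predC1 0)); move: E => /=.
  by case: eqP => _; case: eqP => _.
- exact: (@if_moveR_inj (pred1 0)).
exact: moveP_inj.
Qed.

Lemma oddZ_inj t : injective (oddZ t).
Proof.
case: t => [|[|[|t]]] x y //; first exact: moveR_inj.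
  exact: moveP_inj.
exact: (@if_moveR_inj (pred1 1)).
Qed.

Lemma iter_moveR j (z : L) : iter j (@moveR N M) z = (z.1, z.2 + j%:R).
Proof.
elim: j => [|j IH] /=; first by rewrite addr0; case: z.
by rewrite IH /moveR /= -natr1 addrA.
Qed.
Lemma iter_moveP j (z : L) : iter j (@moveP N M) z = (z.1 + j%:R, z.2).
Proof.
elim: j => [|j IH] /=; first by rewrite addr0; case: z.
by rewrite IH /moveP /= -natr1 addrA.
Qed.

Let stepX (a : 'Z_N) : nat := (if (a == 0%R) || (a == 1%R) then M.-2 else M.-1)%N.

Lemma descend_oddX a b :
  let a' := if b == 0 then a + 1 else a in
  descend oddX M (a, b) = (a', b + (stepX a')%:R).
Proof.
move=> a'; have E : descend oddX M (a, b) = iter (M - 3) (@moveR N M) (descend oddX 3 (a, b)).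
  have := @descend_const _ oddX (@moveR N M) 3 (M - 3) (a, b); rewrite subnK // => -> //.
  by case=> [|[|[]]].
rewrite {}E.
have -> : descend oddX 3 (a, b) = oddX 2 (oddX 1 (a', b)).
  have E0 : oddX 0 (a, b) = (a', b) by rewrite /a' /=; case: ifP.
  by rewrite -E0.
have e1 : (0 + 1 + (M - 3) = M.-2)%N by move: M2; clear; lia.
have e2 : (1 + 1 + (M - 3) = M.-1)%N by move: M2; clear; lia.
rewrite iter_moveR /stepX /=; case: (a' =P 0) => [E0|_] /=; case: (a' =P 1) => [E1|_] /=.
- by case/eqP: (oner_neq0 'Z_N); rewrite -E1.
- by rewrite -e1 !natrD; congr (_, _); ring.
- by rewrite -e1 !natrD; congr (_, _); ring.
by rewrite -e2 !natrD; congr (_, _); ring.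
Qed.

(** The return map moves b by a step prime to M, and raises a at b = 0 only. *)
Lemma ham_oddX : ham (layered (M := M) oddX).
Proof.
apply: ham_layered => //; first by move=> t _; apply: oddX_inj.
set F := descend oddX M.
have FI : injective F by apply: descend_inj; apply: oddX_inj.
have cpX a : coprime (stepX a) M by rewrite /stepX; case: ifP => _; apply: cpM.
have C0 a b : fconnect F (a, b) (a, 0).
  have : exists k, b + (k * stepX a)%:R == 0.
    by have [k Ek] := natZp_step b M1 (cpX a); exists k; apply/eqP.
  move=> ex; case: (ex_minnP ex) => k /eqP Ek kmin; rewrite -Ek.
  have -> : (a, b) = (a, b + (0 * stepX a)%:R) by rewrite mul0n addr0.
  apply: (fconnect_run (x := fun j => (a, b + (j * stepX a)%:R))) => j jk.
  rewrite /F descend_oddX; case: ifP => [/kmin|_]; first by rewrite leqNgt jk.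
  by rewrite mulSn natrD; congr (_, _); ring.
have step a : fconnect F (a, 0) (a + 1, 0).
  apply: connect_trans (C0 _ (0 + (stepX (a + 1))%:R)); apply: connect1.
  by rewrite /= /F descend_oddX eqxx.
apply: (inj_ham (x0 := ((0, 0) : L)) FI) => -[a b]; apply: connect_trans (C0 a b) _.
have K k : fconnect F (a, 0) (a + k%:R, 0).
  elim: k => [|k IH]; first by rewrite addr0; apply: connect0.
  by apply: connect_trans IH _; rewrite -natr1 addrA; apply: step.
by have := K (val (- a)%R); rewrite natr_Zp subrr.
Qed.

Lemma descend_oddY a b :
  let a' := if b == 0 then a else a + 1 in
  descend oddY M (a, b) = (a' + (M.-2)%:R, if a' == 0 then b + 1 else b).
Proof.
move=> a'; have E : descend oddY M (a, b) = iter (M - 2) (@moveP N M) (descend oddY 2 (a, b)).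
  have := @descend_const _ oddY (@moveP N M) 2 (M - 2) (a, b); rewrite subnK // => -> //.
  by case=> [|[|[]]].
rewrite {}E.
have -> : descend oddY 2 (a, b) = oddY 1 (a', b).
  have E0 : oddY 0 (a, b) = (a', b) by rewrite /a' /=; case: ifP.
  by rewrite -E0.
have e1 : (M - 2 = M.-2)%N by move: M2; clear; lia.
by rewrite iter_moveP e1 /=; case: (a' =P 0).
Qed.

(** Likewise a is moved by a step prime to N, and b is raised once in a full turn. *)
Lemma ham_oddY : ham (layered (M := M) oddY).
Proof.
apply: ham_layered => //; first by move=> t _; apply: oddY_inj.
set F := descend oddY M.
have FI : injective F by apply: descend_inj; apply: oddY_inj.
pose q (b : 'Z_M) : nat := (if b == 0%R then M.-2 else M.-1)%N.
have cpq b : coprime (q b) N by rewrite /q; case: ifP.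
have C0 a b : fconnect F (a, b) ((M.-2)%:R, b + 1).
  pose c : 'Z_N := if b == 0 then 0 else 1.
  have : exists k, a + c + (k * q b)%:R == 0.
    by have [k Ek] := natZp_step (a + c) N1 (cpq b); exists k; apply/eqP.
  move=> ex; case: (ex_minnP ex) => k /eqP Ek kmin.
  have qE : (q b)%:R = c + (M.-2)%:R :> 'Z_N.
    rewrite /q /c; case: ifP => _; first by rewrite add0r.
    by rewrite nat1r; congr (_%:R); move: M2; clear; lia.
  have FE x : F (x, b) = (x + (q b)%:R, if x + c == 0 then b + 1 else b).
    rewrite /F descend_oddY qE /c; case: (b == 0); first by rewrite addr0 add0r.
    by rewrite addrA.
  apply: (connect_trans (y := (a + (k * q b)%:R, b))); last first.
    have Ek' : a + (k * q b)%:R + c = 0 by rewrite addrAC.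
    by apply: connect1; rewrite /= FE Ek' eqxx qE addrA Ek' add0r.
  have E0 : (a, b) = (a + (0 * q b)%:R, b) by rewrite mul0n addr0.
  rewrite {1}E0; apply: (fconnect_run (x := fun j => (a + (j * q b)%:R, b))) => j jk.
  rewrite FE [_ + c]addrAC; case: ifP => [/kmin|_]; first by rewrite leqNgt jk.
  by rewrite mulSn natrD; congr (_, _); ring.
apply: (inj_ham (x0 := (((M.-2)%:R, 0) : L)) FI) => -[a b]; apply: connect_trans (C0 a b) _.
have K k : fconnect F ((M.-2)%:R, b + 1) ((M.-2)%:R, b + 1 + k%:R).
  elim: k => [|k IH]; first by rewrite addr0; apply: connect0.
  by apply: connect_trans IH _; rewrite -natr1 addrA; apply: C0.
by have := K (val (- (b + 1))%R); rewrite natr_Zp subrr.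
Qed.

Lemma descend_oddZ a b : descend oddZ M (a, b) = (a + 1, b + (1 + (a == 0%R))%:R).
Proof.
have E : descend oddZ M (a, b) = iter (M - 3) id (descend oddZ 3 (a, b)).
  have := @descend_const _ oddZ id 3 (M - 3) (a, b); rewrite subnK // => -> //.
  by case=> [|[|[]]].
have -> : (a == 0) = (a + 1 == 1) by rewrite -[RHS]subr_eq0 addrK.
have It k (z : L) : iter k id z = z by elim: k.
rewrite {}E It /=.
by case: (a + 1 == 1); rewrite natrD /moveR /moveP /= ?addr0 ?addrA.
Qed.

(** A skew product of total N + 1, which is prime to M. *)
Lemma ham_oddZ : ham (layered (M := M) oddZ).
Proof.
apply: ham_layered => //; first by move=> t _; apply: oddZ_inj.
have S k (z : 'Z_M) : iter k (fun x : 'Z_M => (x + 1)%R) z = z + k%:R.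
  by elim: k => [|k IH]; rewrite ?addr0 //= IH -natr1 addrA.
have E : skew (fun x : 'Z_N => x + 1) (fun y : 'Z_M => y + 1) (fun a => 1 + (a == 0%R))%N
    =1 descend oddZ M.
  by move=> [a b]; rewrite descend_oddZ /skew S.
rewrite -(eq_ham E); apply: ham_skew; [exact: ham_succ|exact: ham_succ|].
rewrite big_split /= sum1_card (bigD1 (0 : 'Z_N)) //= big1 => [|i /negPf ->] //.
rewrite !card_ord addn0 addn1 (Zp_cast N1) (Zp_cast M1).
by case/dvdnP: dv => k ->; rewrite -addn1 coprime_sym /coprime gcdnMDl gcdn1.
Qed.
End OddDesign.

Theorem odd_box N M (K1 K2 : finType) (f : K1 -> K1) (g h : K2 -> K2) :
  2 < M -> M %| N -> coprime M.-1 N -> coprime M.-2 N ->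
  #|K1| = N -> #|K2| = M -> ham f -> ham g -> ham h ->
  decomp [:: @lift1 K1 (K2 * K2)%type f; lift2 (lift1 g); lift2 (lift2 h)].
Proof.
move=> M2 dv c1 c2 cK1 cK2 Hf Hg Hh.
have M1 : 1 < M by apply: ltnW.
have N0 : 0 < N.
  have [N0|//] := posnP N; move: c1 M2; rewrite N0 /coprime gcdn0 => /eqP E.
  by rewrite -(prednK (ltnW M1)) E.
have N1 : 1 < N by apply: leq_trans M1 (dvdn_leq N0 dv).
apply: (decomp_layered (s0 := oddX (M := M)) (s1 := oddY (M := M)) (s2 := oddZ (M := M)) M1 N1 dv) cK1 cK2 Hf Hg Hh.
  by move=> t z _; apply: odd_perm.
by rewrite /= ham_oddX // ham_oddY // ham_oddZ.
Qed.

(** * Three cycles: one even length *)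

Inductive step := SP | SR | SU.

Section EvenDesign.
Variable M : nat.
Hypotheses (M4 : 3 < M) (evenM : ~~ odd M).
Local Notation L := ('Z_M * 'Z_M)%type.
Let M1 : 1 < M. Proof. exact: leq_trans M4. Qed.

(** For even M no design by exchanges of two colours along closed lines can succeed: an
exchange keeps the product of the signs of the permutations, and the parity of the total
number of cycles with it, which is even at the start and has to be odd at the end. Layer 0
below is a distribution that has the other sign; the colours are bent around the lines
a + b = M, b = 2 and a = 0. The remaining layers are constant, up to an exchange along
the row b = 2 in layer 1 and along the last column in layer 2. *)
Definition gad0 a b :=
  if 2 < b then if a + b == M then SR else SP
  else if b == 2 then if a + b == M then SR else SU
  else if a + b == M.-1 then SR
  else if (a == 0) && (b == 0) then SU else SP.
Definition gad1 a b :=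
  if 2 < b then if a == 0 then SU else if a + b == M then SP else SR
  else if b == 2 then if a == 0 then SP else if a + b == M then SU else SR
  else if a == 1 then SU else if a + b == M.-1 then SP else SR.
Definition gad2 a b :=
  if 2 < b then if a == 0 then SR else SU
  else if b == 2 then if a == 0 then SR else SP
  else if a == 1 then SR else if (a == 0) && (b == 0) then SP else SU.

Definition even0 t a b :=
  match t with 0 => gad0 a b | 1 => SR | _ => SP end.
Definition even1 t a b :=
  match t with
  | 0 => gad1 a b | 1 => if b == 2 then SP else SU
  | 2 => if a == M.-1 then SU else SR | _ => SR end.
Definition even2 t a b :=
  match t with
  | 0 => gad2 a b | 1 => if b == 2 then SU else SP
  | 2 => if a == M.-1 then SR else SU | _ => SU end.

Definition take_step (d : step) (z : L) :=
  match d with SP => moveP z | SR => moveR z | SU => z end.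

Definition plan (d : nat -> nat -> nat -> step) t (z : L) : L :=
  take_step (d t (val z.1) (val z.2)) z.

Lemma even_perm t z :
  perm_eq [:: plan even0 t z; plan even1 t z; plan even2 t z] [:: moveP z; moveR z; z].
Proof.
rewrite /plan; move: (val z.1) (val z.2) (ltn_Zp z.1 M1) (ltn_Zp z.2 M1) => a b aM bM.
case: t => [|[|[|t]]] /=.
- rewrite /gad0 /gad1 /gad2.
  case: (ltnP 2 b) => b2.
    case: (a =P 0) => a0; case: (a + b =P M) => abM; try (by move: a0 abM aM bM; clear; lia);
      by apply/permP => P /=; clear; lia.
  case: (b =P 2) => b2'.
    case: (a =P 0) => a0; case: (a + b =P M) => abM; try (by move: a0 abM aM b2' M4; clear; lia);
      by apply/permP => P /=; clear; lia.
  case: (a =P 1) => a1; case: (a + b =P M.-1) => abM; case: (a =P 0) => a0; case: (b =P 0) => b0 /=;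
   try (by move: a0 a1 b0 b2 b2' abM aM M4; clear; lia);
      by apply/permP => P /=; clear; lia.
- by case: ifP => _ /=; apply/permP => P /=; clear; lia.
- by case: ifP => _ /=; apply/permP => P /=; clear; lia.
by apply/permP => P /=; clear; lia.
Qed.

Definition up a := if a.+1 == M then 0 else a.+1.

Lemma val_up (x : 'Z_M) : val (x + 1)%R = up (val x).
Proof.
have E : (x + 1 = (val x).+1%:R)%R by rewrite -natr1 natr_Zp.
rewrite E; apply: etrans (val_Zp_nat M1 _) _; rewrite /up.
have := ltn_Zp x M1; rewrite leq_eqVlt; case: eqP => [->|_] /=; first by rewrite modnn.
by move=> H; rewrite modn_small.
Qed.

(** No point is reached by two different steps. *)
Definition compatible (g : nat -> nat -> step) :=
  forall a b, a < M -> b < M ->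
  [/\ g a (up b) = SP -> g (up a) b = SR -> False,
      g a b = SP -> g (up a) b = SU -> False &
      g a b = SR -> g a (up b) = SU -> False].

Lemma plan_inj d t : compatible (d t) -> injective (plan d t).
Proof.
move=> C z z' E.
have lt (x : 'Z_M) : val x < M := ltn_Zp x M1.
have aux (u v : L) : take_step SP u = take_step SR v -> d t (val u.1) (val u.2) = SP ->
    d t (val v.1) (val v.2) = SR -> False.
  case: u v => [a b] [a' b'] /= [] /(congr1 val) E1 /(congr1 val) E2.
  have [+ _ _] := C (val a) (val b') (lt _) (lt _).
  by rewrite -!val_up -E2 E1.
have aux2 (u v : L) : take_step SP u = v -> d t (val u.1) (val u.2) = SP ->
    d t (val v.1) (val v.2) = SU -> False.
  move=> <-; have [_ + _] := C _ _ (lt u.1) (lt u.2).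
  by rewrite -val_up.
have aux3 (u v : L) : take_step SR u = v -> d t (val u.1) (val u.2) = SR ->
    d t (val v.1) (val v.2) = SU -> False.
  move=> <-; have [_ _ +] := C _ _ (lt u.1) (lt u.2).
  by rewrite -val_up.
move: E; rewrite /plan; case D: (d t _ _); case D': (d t _ _) => /=.
- exact: moveP_inj.
- by move/aux => /(_ D D').
- by move/aux2 => /(_ D D').
- by move/esym/aux => /(_ D' D).
- exact: moveR_inj.
- by move/aux3 => /(_ D D').
- by move/esym/aux2 => /(_ D' D).
- by move/esym/aux3 => /(_ D' D).
by [].
Qed.

Lemma gad0_compatible : compatible gad0.
Proof.
move=> a b aM bM; rewrite /up /gad0; move: aM bM M4; clear => aM bM M4.
case: (a.+1 =P M) => a1; case: (b.+1 =P M) => b1; split;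
  (do ![case: ifP => ?] => //; lia).
Qed.
Lemma gad1_compatible : compatible gad1.
Proof.
move=> a b aM bM; rewrite /up /gad1; move: aM bM M4; clear => aM bM M4.
case: (a.+1 =P M) => a1; case: (b.+1 =P M) => b1; split;
  (do ![case: ifP => ?] => //; lia).
Qed.
Lemma gad2_compatible : compatible gad2.
Proof.
move=> a b aM bM; rewrite /up /gad2; move: aM bM M4; clear => aM bM M4.
case: (a.+1 =P M) => a1; case: (b.+1 =P M) => b1; split;
  (do ![case: ifP => ?] => //; lia).
Qed.

Lemma even0_inj t : injective (plan even0 t).
Proof.
by apply: plan_inj; case: t => [|[|t]]; [exact: gad0_compatible|split|split].
Qed.
Lemma even1_inj t : injective (plan even1 t).
Proof.
apply: plan_inj; case: t => [|[|[|t]]]; first exact: gad1_compatible.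
- by move=> a b aM bM; rewrite /even1; split; do ?case: ifP.
- by move=> a b aM bM; rewrite /even1; split; do ?case: ifP.
by split.
Qed.
Lemma even2_inj t : injective (plan even2 t).
Proof.
apply: plan_inj; case: t => [|[|[|t]]]; first exact: gad2_compatible.
- by move=> a b aM bM; rewrite /even2; split; do ?case: ifP.
- by move=> a b aM bM; rewrite /even2; split; do ?case: ifP.
by split.
Qed.

Definition pt a b : L := ((a%:R)%R, (b%:R)%R).

Lemma pt_addl a b : pt (a + M) b = pt a b.
Proof. by rewrite /pt natrD (_ : M%:R = 0)%R ?addr0 //; apply/eqP; rewrite natZp_eq0. Qed.
Lemma pt_addr a b : pt a (b + M) = pt a b.
Proof. by rewrite /pt natrD (_ : M%:R = 0)%R ?addr0 //; apply/eqP; rewrite natZp_eq0. Qed.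

Lemma pt_val (z : L) : z = pt (val z.1) (val z.2).
Proof. by rewrite /pt !natr_Zp; case: z. Qed.

Lemma plan_pt d t a b : a < M -> b < M ->
  plan d t (pt a b) = match d t a b with
    | SP => pt a.+1 b | SR => pt a b.+1 | SU => pt a b end.
Proof.
move=> aM bM; rewrite /plan.
have -> : val (pt a b).1 = a by apply: val_natZ.
have -> : val (pt a b).2 = b by apply: val_natZ.
by case: (d t a b); rewrite //= /moveP /moveR /pt /= -natr1.
Qed.

Lemma descend_plan d (r : step) (z : L) :
  (forall t a b, 3 <= t -> d t a b = r) ->
  descend (plan d) M z = iter (M - 3) (take_step r) (plan d 2 (plan d 1 (plan d 0 z))).
Proof.
move=> H; have := @descend_const _ (plan d) (take_step r) 3 (M - 3) z.
rewrite subnK ?(ltnW M4) // => -> //.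
by move=> t y t3; rewrite /plan H.
Qed.

Lemma iter_SP j a b : iter j (take_step SP) (pt a b) = pt (a + j) b.
Proof.
elim: j => [|j IH]; first by rewrite addn0.
by rewrite iterS IH /= /moveP /pt /= addnS -natr1.
Qed.
Lemma iter_SR j a b : iter j (take_step SR) (pt a b) = pt a (b + j).
Proof.
elim: j => [|j IH]; first by rewrite addn0.
by rewrite iterS IH /= /moveR /pt /= addnS -natr1.
Qed.
Lemma iter_SU j z : iter j (take_step SU) z = z.
Proof. by elim: j. Qed.

Section Colour0.
Let F := descend (plan even0) M.

(** The return map of colour 0 follows the antidiagonals. *)
Lemma F0_pt a b : a < M -> b < M ->
  F (pt a b) = match gad0 a b with
    | SP => pt (a + M.-1) b.+1 | SR => pt (a + M.-2) b.+2 | SU => pt (a + M.-2) b.+1 end.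
Proof.
move=> aM bM; rewrite /F (descend_plan (r := SP)); last by case=> [|[|[]]].
rewrite [plan even0 0 _]plan_pt //.
have S1 c d : plan even0 1 (pt c d) = pt c d.+1 by rewrite /plan /= /moveR /pt -natr1.
have S2 c d : plan even0 2 (pt c d) = pt c.+1 d by rewrite /plan /= /moveP /pt -natr1.
rewrite [even0 0 a b]/=; case: (gad0 a b); rewrite S1 S2 iter_SP;
  congr (pt _ _); move: M4; clear; lia.
Qed.

(** Points by their antidiagonal s = a + b and their row b. *)
Let q s b : L := ((s%:R - b%:R)%R, b%:R%R).

Let M0 : (M%:R = 0 :> 'Z_M)%R. Proof. by apply/eqP; rewrite natZp_eq0. Qed.

Lemma q_mod s b : q s (b + M) = q s b.
Proof. by rewrite /q natrD M0 addr0. Qed.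

Lemma q_pt s b : s < M -> b < M -> q s b = pt (if b <= s then s - b else s + M - b) b.
Proof.
move=> sM bM; rewrite /q /pt; congr (_, _); case: leqP => sb; first by rewrite natrB.
by rewrite natrB ?natrD ?M0 ?addr0 // ltnW // (leq_trans bM) // leq_addl.
Qed.

Lemma F0_q s b : s < M -> b < M ->
  F (q s b) =
   if s == 0 then if 1 < b then q 0 b.+2 else if b == 1 then q 0 2 else q M.-1 1
   else if s == M.-1 then
     if b <= 1 then q s b.+2 else if b == 2 then q M.-2 3 else q s b.+1
   else if b == 2 then q s.-1 3 else q s b.+1.
Proof.
move=> sM bM.
have m1 : (M.-1%:R = -1 :> 'Z_M)%R.
  by apply/eqP; rewrite -subr_eq0 opprK natr1 prednK ?(ltnW M1) // M0.
have m2 : (M.-2%:R = -1 -1 :> 'Z_M)%R.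
  apply: (addIr 1%R); rewrite natr1 subrK -m1; congr (_%:R)%R; move: M4; clear; lia.
set a := if b <= s then s - b else s + M - b.
have aM : a < M by rewrite /a; case: (leqP b s); move: sM bM; clear; lia.
have aE : ((a%:R : 'Z_M) = s%:R - b%:R)%R by have := q_pt sM bM; rewrite /q /pt -/a => -[->].
have QP : pt (a + M.-1) b.+1 = q s b.+1.
  by rewrite /pt /q natrD aE m1 -!natr1; congr (_, _); ring.
have QR : pt (a + M.-2) b.+2 = q s b.+2.
  by rewrite /pt /q natrD aE m2 -!natr1; congr (_, _); ring.
have QU : 0 < s -> pt (a + M.-2) b.+1 = q s.-1 b.+1.
  move=> s0; rewrite /pt /q natrD aE m2 -[in LHS](prednK s0) -!natr1; congr (_, _); ring.
have QU0 : s = 0 -> pt (a + M.-2) b.+1 = q M.-1 b.+1.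
  by move=> s0; rewrite /pt /q natrD aE m1 m2 s0 -!natr1; congr (_, _); ring.
rewrite (q_pt sM bM) -/a F0_pt //.
have ab : (a + b == M) = (s == 0) && (0 < b).
  by rewrite /a; case: (leqP b s); move: sM bM; clear; lia.
have ab1 : (a + b == M.-1) = (s == M.-1).
  by rewrite /a; case: (leqP b s); move: sM bM M4; clear; lia.
have ab0 : (a == 0) && (b == 0) = (s == 0) && (b == 0).
  by rewrite /a; case: (leqP b s); move: sM bM M4; clear; lia.
rewrite /gad0 ab ab1 ab0 {ab ab1 ab0}.
rewrite QP QR; case: (s =P 0) => [s0|s0] /=.
  have -> : (s == M.-1) = false by rewrite s0; move: M4; clear; lia.
  rewrite QU0 // s0.
  by case: b {bM a aM aE QP QR QU QU0} => [|[|[|b]]].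
rewrite QU ?lt0n; last by apply/eqP.
case: (s =P M.-1) => [->|s1]; by case: b {bM a aM aE QP QR QU QU0} => [|[|[|b]]].
Qed.

Lemma F0_run s k b j : s < M ->
  (forall i, i < j -> F (q s (b + i * k)) = q s (b + i.+1 * k)) ->
  fconnect F (q s b) (q s (b + j * k)).
Proof.
move=> sM H; have := @fconnect_run _ F (fun i => q s (b + i * k)) j.
by rewrite mul0n addn0; apply => i ij; apply: H.
Qed.

(** An antidiagonal s is walked row by row and left downwards, to s - 1, at b = 2; the
antidiagonal 0 is walked by steps of two, first the odd rows and then the even rows, and
leads back to M - 1. *)
Lemma F0_reach s b : s < M -> b < M -> fconnect F (q s b) (q M.-1 2).
Proof.
have oneF x y : F x = y -> fconnect F x y by move=> <-; apply: fconnect1.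
have Mp : M.-1 < M by rewrite prednK // ltnW.
have R1 b' : b' < M -> fconnect F (q M.-1 b') (q M.-1 2).
  have R3 c : 2 < c -> c < M -> fconnect F (q M.-1 c) (q M.-1 2).
    move=> c2 cM; apply: (connect_trans (y := q M.-1 (c + (M - c) * 1))).
      apply: F0_run => // i iM; rewrite F0_q //; last by move: iM; clear; lia.
      have -> : (M.-1 == 0) = false by move: M4; clear; lia.
      have -> : (c + i * 1 <= 1) = false by move: c2; clear; lia.
      have -> : (c + i * 1 == 2) = false by move: c2; clear; lia.
      by rewrite eqxx; congr (q _ _); clear; lia.
    have -> : c + (M - c) * 1 = 0 + M by move: cM; clear; lia.
    rewrite q_mod; apply: oneF; rewrite F0_q ?(ltnW M1) // eqxx.
    by have -> : (M.-1 == 0) = false by move: M4; clear; lia.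
  have Mn : (M.-1 == 0) = false by move: M4; clear; lia.
  case: b' => [|[|[|b']]] bM.
  - by apply: oneF; rewrite F0_q // Mn eqxx.
  - by apply: (connect_from (R3 3 _ _)) => //; apply: oneF; rewrite F0_q // Mn eqxx.
  - exact: connect0.
  exact: R3.
have R0 b' : b' < M -> fconnect F (q 0 b') (q M.-1 2).
  have up2 c e : 1 < c -> c + e.*2 <= M.+1 -> fconnect F (q 0 c) (q 0 (c + e.*2)).
    move=> c1 ceM; rewrite -muln2; apply: F0_run; first exact: ltnW.
    move=> i ie; rewrite F0_q ?(ltnW M1) //; last by move: ie ceM; clear; lia.
    have -> : 1 < c + i * 2 by move: c1; clear; lia.
    by rewrite eqxx; congr (q _ _); clear; lia.
  have fin : fconnect F (q 0 0) (q M.-1 2).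
    by apply: (connect_from (R1 1 M1)); apply: oneF; rewrite F0_q // ltnW.
  have ev c : 1 < c -> c < M -> ~~ odd c -> fconnect F (q 0 c) (q M.-1 2).
    move=> c1 cM co; apply: (connect_from fin); rewrite -(q_mod 0 0) add0n.
    have E : M = c + ((M - c)./2).*2.
      by rewrite halfK oddB ?(ltnW cM) // (negPf evenM) (negPf co) subn0 subnKC // ltnW.
    by have := up2 c (M - c)./2 c1; rewrite -E; apply.
  have R2 : fconnect F (q 0 1) (q M.-1 2).
    apply: (connect_from (ev 2 isT (ltnW M4) isT)).
    by apply: oneF; rewrite F0_q // ltnW.
  case: b' => [|[|b']] bM //.
  case: (boolP (odd b'.+2)) => o; last exact: ev.
  apply: (connect_from R2); rewrite -(q_mod 0 1).
  have E : 1 + M = b'.+2 + ((1 + M - b'.+2)./2).*2.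
    rewrite halfK oddB ?oddD ?o ?(negPf evenM) /= ?subn0 ?subnKC //; move: bM; clear; lia.
  by have := up2 b'.+2 (1 + M - b'.+2)./2 isT; rewrite -E; apply.
elim: s b => [|s IH] b sM bM; first exact: R0.
have [sE|sE] := eqVneq s.+1 M.-1; first by rewrite sE; apply: R1.
apply: (connect_from (IH 3 (ltnW sM) _)) => //.
have climb c e : c + e <= M -> (2 < c) || (c + e <= 2) -> fconnect F (q s.+1 c) (q s.+1 (c + e)).
  move=> ceM ce; rewrite -[e]muln1; apply: F0_run => // i ie.
  rewrite F0_q //; last by move: ie ceM; clear; lia.
  rewrite (negPf sE) /=; have -> : (c + i * 1 == 2) = false by move: ie ce; clear; lia.
  by congr (q _ _); clear; lia.
have last2 : fconnect F (q s.+1 2) (q s 3).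
  by apply: oneF; rewrite F0_q ?(negPf sE) // ltnW.
apply: (connect_from last2).
have low c : c <= 2 -> fconnect F (q s.+1 c) (q s.+1 2).
  move=> c2; have := @climb c (2 - c); rewrite subnKC // => -> //.
  by rewrite leqnn orbT.
have [b2|b2] := leqP b 2; first exact: low.
apply: (connect_from (low 0 isT)); rewrite -(q_mod _ 0) add0n.
by have := @climb b (M - b); rewrite subnKC ?(ltnW bM) // => -> //; rewrite b2.
Qed.

Lemma ham_even0 : ham (layered (M := M) (plan even0)).
Proof.
apply: ham_layered => //; first by move=> t _; apply: even0_inj.
apply: (inj_ham (x0 := q M.-1 2)); first by apply: descend_inj; apply: even0_inj.
move=> z; have E : z = q (val (z.1 + z.2)%R) (val z.2).
  by rewrite /q !natr_Zp addrK -surjective_pairing.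
by rewrite {1}E; apply: F0_reach; apply: ltn_Zp.
Qed.
End Colour0.

Lemma val_natM : val (M%:R : 'Z_M)%R = 0.
Proof. by apply: etrans (val_Zp_nat M1 M) _; rewrite modnn. Qed.

Lemma pt_top c d : d = M -> pt c d = pt c 0.
Proof. by move=> E; rewrite /pt E; congr (_, _); apply/eqP; rewrite natZp_eq0. Qed.

Lemma plan_row d t c b : b <= M -> (forall a a' b, d t a b = d t a' b) ->
  d t 0 M = d t 0 0 ->
  plan d t (pt c b) = match d t 0 b with
    | SP => pt c.+1 b | SR => pt c b.+1 | SU => pt c b end.
Proof.
move=> bM H HM; rewrite /plan (H _ 0).
have -> : d t 0 (val (pt c b).2) = d t 0 b.
  move: bM; rewrite leq_eqVlt => /orP[/eqP ->|bM]; last by congr (d _ _ _); apply: val_natZ.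
  by rewrite HM; congr (d _ _ _); apply: val_natM.
by case: (d t 0 b); rewrite //= /moveP /moveR /pt /= -natr1.
Qed.

Lemma plan_col d t a c : a <= M -> (forall a b b', d t a b = d t a b') ->
  d t M 0 = d t 0 0 ->
  plan d t (pt a c) = match d t a 0 with
    | SP => pt a.+1 c | SR => pt a c.+1 | SU => pt a c end.
Proof.
move=> aM H HM; rewrite /plan (H _ _ 0).
have -> : d t (val (pt a c).1) 0 = d t a 0.
  move: aM; rewrite leq_eqVlt => /orP[/eqP ->|aM]; last by congr (d _ _ _); apply: val_natZ.
  by rewrite HM; congr (d _ _ _); apply: val_natM.
by case: (d t a 0); rewrite //= /moveP /moveR /pt /= -natr1.
Qed.

Section Colour2.
Let F := descend (plan even2) M.

Lemma F2_pt a b : a < M -> b < M ->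
  F (pt a b) =
    if a == 0 then if b == 0 then pt 2 0 else if b == 1 then pt 1 1 else pt 1 b.+1
    else if a == 1 then if b == 0 then pt 2 1 else if b == 1 then pt 1 2 else pt 2 b
    else pt a.+1 (b + (a == M.-2)).
Proof.
move=> aM bM; rewrite /F (descend_plan (r := SU)); last by case=> [|[|[]]].
rewrite iter_SU [plan even2 0 _]plan_pt //.
have S1 c d : d <= M -> plan even2 1 (pt c d) = if d == 2 then pt c d else pt c.+1 d.
  move=> dM; rewrite plan_row //=; first by case: (d == 2).
  by have -> : (M == 2) = false by move: M4; clear; lia.
have S2 c d : c <= M -> plan even2 2 (pt c d) = if c == M.-1 then pt c d.+1 else pt c d.
  move=> cM; rewrite plan_col //=; first by case: (c == M.-1).
  have -> : (M == M.-1) = false by move: M4; clear; lia.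
  by have -> : (0 == M.-1) = false by move: M4; clear; lia.
have m1 : (1 == M.-1) = false by move: M4; clear; lia.
have m2 : (2 == M.-1) = false by move: M4; clear; lia.
have am : a != 0 -> a.+1 == M.-1 = (a == M.-2) by move: M4; clear; lia.
rewrite [even2 0 a b]/= /gad2.
case: b bM => [|[|[|b]]] bM /=.
- case: a aM am => [|[|a]] aM am /=; rewrite S1 ?(ltnW M1) //= S2 ?m1 ?m2 ?am //.
  by case: eqP.
- case: a aM am => [|[|a]] aM am /=.
  + by rewrite S1 ?(ltnW M1) //= S2 ?m1 // ltnW.
  + by rewrite S1 // S2 ?m1 // ltnW.
  by rewrite S1 ?(ltnW M1) //= S2 // am //; case: eqP.
- case: a aM am => [|[|a]] aM am /=.
  + by rewrite S1 ?(ltnW M4) //= S2 ?m1 // ltnW.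
  + by rewrite S1 // S2 ?m2.
  by rewrite S1 //= S2 // am //; case: eqP.
case: a aM am => [|[|a]] aM am /=.
- by rewrite S1 //= S2 ?m1 // ltnW.
- by rewrite S1 ?(ltnW bM) //= S2 ?m2.
by rewrite S1 ?(ltnW bM) //= S2 // am //; case: eqP => _; rewrite ?addn1 ?addn0.
Qed.

(** Rows are walked to the right; passing the last column raises the row by one, so that
all rows are met in turn. The columns 0 and 1 and the first rows need extra care. *)
Lemma F2_reach a b : a < M -> b < M -> fconnect F (pt a b) (pt 0 0).
Proof.
have oneF x y : F x = y -> fconnect F x y by move=> <-; apply: fconnect1.
(* a walk along row b ends in column 0, one row further *)
have row c d : 1 < c -> c < M.-1 -> d < M -> fconnect F (pt c d) (pt 0 d.+1).
  move=> c1 cM dM; have := @fconnect_run _ F (fun i => pt (c + i) d) (M.-2 - c).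
  rewrite addn0 subnKC => [H|]; last by move: cM; clear; lia.
  have {}H : fconnect F (pt c d) (pt M.-2 d).
    apply: H => j jM; rewrite F2_pt //; last by move: jM cM; clear; lia.
    have -> : (c + j == 0) = false by move: c1; clear; lia.
    have -> : (c + j == 1) = false by move: c1; clear; lia.
    have -> : (c + j == M.-2) = false by move: jM; clear; lia.
    by rewrite addn0 addnS.
  apply: connect_trans H _; apply: (connect_trans (y := pt M.-1 d.+1)).
    apply: oneF; rewrite F2_pt //; last by move: M4; clear; lia.
    have -> : (M.-2 == 0) = false by move: M4; clear; lia.
    have -> : (M.-2 == 1) = false by move: M4; clear; lia.
    by rewrite eqxx addn1; congr pt; move: M4; clear; lia.
  have wrap e : e < M -> fconnect F (pt M.-1 e) (pt 0 e).
    move=> eM; apply: oneF; rewrite F2_pt //; last by move: M4; clear; lia.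
    have -> : (M.-1 == 0) = false by move: M4; clear; lia.
    have -> : (M.-1 == 1) = false by move: M4; clear; lia.
    have -> : (M.-1 == M.-2) = false by move: M4; clear; lia.
    by rewrite addn0 prednK ?(ltnW M1) // -(pt_addl 0).
  case: (d.+1 =P M) => [E|/eqP E]; last by apply: wrap; rewrite ltn_neqAle E.
  by rewrite !(pt_top _ E); apply: wrap; apply: ltnW.
have r2 d : d < M -> fconnect F (pt 2 d) (pt 0 d.+1).
  by move=> dM; apply: row => //; move: M4; clear; lia.
have r1 d : 1 < d -> d < M -> fconnect F (pt 1 d) (pt 0 d.+1).
  by move=> d1 dM; apply: connect_trans (r2 d dM); apply: oneF; rewrite F2_pt //;
    case: d d1 dM => [|[|d]].
have s2 d : 1 < d -> d.+1 < M -> fconnect F (pt 0 d) (pt 0 d.+2).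
  move=> d1 dM; apply: connect_trans (r1 d.+1 _ dM); last exact: ltnW.
  by apply: oneF; rewrite F2_pt ?(ltnW M1) ?(ltnW dM) //; case: d d1 dM => [|[|d]].
have ups c e : 1 < c -> c + e.*2 <= M -> fconnect F (pt 0 c) (pt 0 (c + e.*2)).
  move=> c1; elim: e => [|e IH] ceM; first by rewrite addn0; apply: connect0.
  apply: connect_trans (IH _) _; first by move: ceM; clear; lia.
  by rewrite doubleS !addnS; apply: s2; move: c1 ceM; clear; lia.
have ev d : 1 < d -> d < M -> ~~ odd d -> fconnect F (pt 0 d) (pt 0 0).
  move=> d1 dM dev; rewrite -(pt_addr 0 0) add0n.
  have E : M = d + ((M - d)./2).*2.
    by rewrite halfK oddB ?(ltnW dM) // (negPf evenM) (negPf dev) subn0 subnKC // ltnW.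
  by have := ups d (M - d)./2 d1; rewrite -E; apply.
have od d : 2 < d -> d < M -> odd d -> fconnect F (pt 0 d) (pt 0 0).
  move=> d2 dM dodd; apply: (connect_from (ev 2 isT (ltnW M4) isT)).
  have E : M.-1 = d + ((M.-1 - d)./2).*2.
    have oM : odd M.-1 by move: evenM; rewrite -[X in ~~ odd X](prednK (ltnW M1)) /= negbK.
    have dM' : d <= M.-1 by move: dM; clear; lia.
    by rewrite halfK oddB // oM dodd subn0 subnKC.
  apply: (connect_trans (y := pt 0 M.-1)).
    have := ups d (M.-1 - d)./2 (ltnW d2); rewrite -E; apply.
    by move: M4; clear; lia.
  apply: (connect_from (r2 1 M1)); apply: (connect_trans (y := pt 1 0)).
    apply: oneF; rewrite F2_pt ?(ltnW M1) //; last by move: M4; clear; lia.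
    have -> : (M.-1 == 0) = false by move: M4; clear; lia.
    have -> : (M.-1 == 1) = false by move: M4; clear; lia.
    by rewrite pt_top // prednK // ltnW.
  by apply: oneF; rewrite F2_pt ?(ltnW M1).
have R1 : fconnect F (pt 1 1) (pt 0 0).
  apply: (connect_from (od 3 isT M4 isT)); apply: (connect_from (r2 2 (ltnW M4))).
  apply: (connect_trans (y := pt 1 2)); first by apply: oneF; rewrite F2_pt.
  by apply: oneF; rewrite F2_pt // ltnW.
have R0 d : d < M -> fconnect F (pt 0 d) (pt 0 0).
  case: d => [|[|[|d]]] dM; first exact: connect0.
  - by apply: (connect_from R1); apply: oneF; rewrite F2_pt // ltnW.
  - exact: ev.
  by case: (boolP (odd d.+3)) => o; [apply: od|apply: ev].
have R0' d : d < M -> fconnect F (pt 0 d.+1) (pt 0 0).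
  move=> dM; case: (d.+1 =P M) => [E|/eqP E]; last by apply: R0; rewrite ltn_neqAle E.
  by rewrite (pt_top _ E); apply: connect0.
move=> aM bM; case: a aM => [|[|a]] aM; first exact: R0.
  case: b bM => [|[|b]] bM; last by apply: connect_trans (r1 _ _ bM) (R0' _ bM).
    apply: (connect_from (R0 2 (ltnW M4))); apply: (connect_from (r2 1 M1)).
    by apply: oneF; rewrite F2_pt // ltnW.
  exact: R1.
have [aE|aE] := eqVneq a.+2 M.-1.
  apply: (connect_from (R0 b bM)); apply: oneF; rewrite F2_pt //=.
  have -> : (a.+2 == M.-2) = false by move: aE M4; clear; lia.
  rewrite addn0 -(pt_addl 0); congr pt; move: aE M4; clear; lia.
apply: (connect_from (R0' b bM)); apply: row => //; move: aE aM; clear; lia.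
Qed.

Lemma ham_even2 : ham (layered (M := M) (plan even2)).
Proof.
apply: ham_layered => //; first by move=> t _; apply: even2_inj.
apply: (inj_ham (x0 := pt 0 0)); first by apply: descend_inj; apply: even2_inj.
by move=> z; rewrite {1}(pt_val z); apply: F2_reach; apply: ltn_Zp.
Qed.
End Colour2.

Section Colour1.
Let F := descend (plan even1) M.

Lemma F1_pt a b : a < M -> b < M ->
  F (pt a b) =
    if 2 < b then
      if a + b == M then pt a.+1 (b - 2)
      else if (a == 0) || (a == M.-1) then pt a (b - 2) else pt a b.-1
    else if b == 2 then
      if a == 0 then pt 2 0 else if a == M.-2 then pt M.-1 M.-1
      else if a == M.-1 then pt a 0 else pt a 1
    else if b == 1 then
      if a == 1 then pt 1 M.-1 else if a == M.-2 then pt M.-1 M.-2 else pt a.+1 0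
    else if a == 1 then pt 1 M.-2 else if a == M.-1 then pt 0 M.-2 else pt a M.-1.
Proof.
move=> aM bM; rewrite /F (descend_plan (r := SR)); last by case=> [|[|[]]].
rewrite [plan even1 0 _]plan_pt //.
have S1 c d : d <= M -> plan even1 1 (pt c d) = if d == 2 then pt c.+1 d else pt c d.
  move=> dM; rewrite plan_row //=; first by case: (d == 2).
  by have -> : (M == 2) = false by move: M4; clear; lia.
have S2 c d : c <= M -> iter (M - 3) (take_step SR) (plan even1 2 (pt c d)) =
    pt c (d + (M - 2) - (c == M.-1)).
  move=> cM; rewrite plan_col //=; last first.
    have -> : (M == M.-1) = false by move: M4; clear; lia.
    by have -> : (0 == M.-1) = false by move: M4; clear; lia.
  by case: (c == M.-1); rewrite iter_SR; congr pt; move: M4; clear; lia.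
have down c d e : d = e + M -> pt c d = pt c e by move=> ->; rewrite pt_addr.
rewrite [even1 0 a b]/= /gad1.
have am : a + 2 == M = (a == M.-2) by move: M4; clear; lia.
have am1 : a + 1 == M.-1 = (a == M.-2) by move: M4; clear; lia.
case: b bM => [|[|[|b]]] bM /=.
- rewrite addn0; case: (a =P 1) => [->|a1].
    rewrite S1 //= S2 ?(ltnW M1) // add0n; congr pt; move: M4; clear; lia.
  case: (a =P M.-1) => [aE|a2].
    rewrite S1 //= S2 // aE prednK ?(ltnW M1) // -(pt_addl 0); congr pt; move: M4; clear; lia.
  rewrite S1 //= S2 ?(ltnW aM) // (negPf (introN eqP a2)); congr pt; move: M4; clear; lia.
- rewrite am1; case: (a =P 1) => [->|a1].
    rewrite S1 ?(ltnW M1) //= S2 ?(ltnW M1) //.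
    have -> : (1 == M.-1) = false by move: M4; clear; lia.
    congr pt; move: M4; clear; lia.
  case: (a =P M.-2) => [->|a2].
    rewrite S1 ?(ltnW M1) //= S2; last by move: M4; clear; lia.
    have -> : M.-1 = M.-2.+1 by move: M4; clear; lia.
    rewrite eqxx; congr pt; move: M4; clear; lia.
  rewrite S1 //= S2 //.
  have -> : (a.+1 == M.-1) = false by move: a2 M4; clear; lia.
  by apply: down; move: M4; clear; lia.
- rewrite am; case: (a =P 0) => [->|a0].
    rewrite S1 ?(ltnW M4) //= S2 ?(ltnW (ltnW M4)) //.
    have -> : (2 == M.-1) = false by move: M4; clear; lia.
    by apply: down; move: M4; clear; lia.
  case: (a =P M.-2) => [->|a2].
    rewrite S1 ?(ltnW M4) //= S2; last by move: M4; clear; lia.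
    have -> : M.-1 = M.-2.+1 by move: M4; clear; lia.
    rewrite eqxx; congr pt; move: M4; clear; lia.
  rewrite S1 ?M4 //= S2 ?(ltnW aM) //; case: eqP => aE; apply: down; move: M4; clear; lia.
case: (a =P 0) => [->|a0].
  rewrite add0n (ltn_eqF bM) S1 ?(ltnW bM) //= S2 //.
  have -> : (0 == M.-1) = false by move: M4; clear; lia.
  by apply: down; move: M4; clear; lia.
rewrite /=; case: (_ =P M) => abM.
  rewrite S1 ?(ltnW bM) //= S2 //.
  have -> : (a.+1 == M.-1) = false by move: abM M4; clear; lia.
  by apply: down; move: M4; clear; lia.
rewrite S1 //= S2 ?(ltnW aM) //; case: (a =P M.-1) => aE; apply: down; move: M4; clear; lia.
Qed.

(** Columns are walked downwards, the inner ones by steps of one and the two border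
columns by steps of two; the antidiagonal a + b = M and the row b = 1 lead from one column
to the next. *)
Lemma F1_reach a b : a < M -> b < M -> fconnect F (pt a b) (pt 0 0).
Proof.
have oneF x y : F x = y -> fconnect F x y by move=> <-; apply: fconnect1.
have lt1 : M.-1 < M by rewrite prednK // ltnW.
have lt2 : M.-2 < M by move: M4; clear; lia.
(* walk down a column by steps of one *)
have down c d e : 0 < c -> c < M.-1 -> 0 < d -> d + e < M ->
    (forall j, d < j -> j <= d + e -> c + j != M) ->
    fconnect F (pt c (d + e)) (pt c d).
  move=> c0 cM d0; elim: e => [|e IH] deM H; first by rewrite addn0; apply: connect0.
  apply: (connect_trans (y := pt c (d + e))); last first.
    apply: IH; first by move: deM; clear; lia.
    by move=> j dj je; apply: H; move: dj je; clear; lia.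
  have /negPf Hc := H (d + e.+1) ltac:(move: d0; clear; lia) (leqnn _).
  apply: oneF; rewrite F1_pt //; last by move: cM; clear; lia.
  rewrite Hc; have -> : (c == 0) = false by move: c0; clear; lia.
  have -> : (c == M.-1) = false by move: cM; clear; lia.
  case: ltnP => b2 /=; first by congr pt; clear; lia.
  have E : d + e.+1 = 2 by move: b2 d0; clear; lia.
  rewrite E eqxx; have -> : (c == M.-2) = false by move: Hc; rewrite E; move: M4; clear; lia.
  by congr pt; move: E d0; clear; lia.
(* the two border columns are walked down by steps of two *)
have down2 c d e : (c == 0) || (c == M.-1) -> 0 < d -> d + e.*2 < M ->
    fconnect F (pt c (d + e.*2)) (pt c d).
  move=> cE d0; elim: e => [|e IH] deM; first by rewrite addn0; apply: connect0.
  apply: (connect_trans (y := pt c (d + e.*2))); last first.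
    by apply: IH; move: deM; clear; rewrite doubleS; lia.
  apply: oneF; rewrite F1_pt //; last by case/orP: cE => /eqP -> //; apply: ltnW.
  rewrite cE.
  have -> : 2 < d + e.+1.*2 by rewrite doubleS; move: d0; clear; lia.
  have -> : (c + (d + e.+1.*2) == M) = false.
    by case/orP: cE => /eqP ->; move: deM d0 M4; clear; rewrite doubleS; lia.
  by congr pt; clear; rewrite doubleS; lia.
have ev0 d : 0 < d -> d < M -> ~~ odd d -> fconnect F (pt 0 d) (pt 2 0).
  move=> d0 dM od; have E : d = 2 + (d./2.-1).*2.
    by rewrite -[LHS]odd_double_half (negPf od) -[in LHS](@prednK d./2) //;
       case: d d0 od {dM} => [|[]].
  apply: (connect_trans (y := pt 0 2)); first by rewrite E; apply: down2; rewrite -?E.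
  by apply: oneF; rewrite F1_pt ?(ltnW M1) ?(ltnW M4).
have od0 d : d < M -> odd d -> fconnect F (pt 0 d) (pt 1 0).
  move=> dM od; have E : d = 1 + d./2.*2 by rewrite -[LHS]odd_double_half od.
  apply: (connect_trans (y := pt 0 1)); first by rewrite E; apply: down2; rewrite -?E.
  apply: oneF; rewrite F1_pt ?(ltnW M1) //=.
  by have -> : (0 == M.-2) = false by move: M4; clear; lia.
have od1 d : d < M -> odd d -> fconnect F (pt M.-1 d) (pt 0 0).
  move=> dM od; have E : d = 1 + d./2.*2 by rewrite -[LHS]odd_double_half od.
  apply: (connect_trans (y := pt M.-1 1)).
    by rewrite E; apply: down2; rewrite ?eqxx ?orbT -?E.
  apply: oneF; rewrite F1_pt //=.
  have -> : (M.-1 == 1) = false by move: M4; clear; lia.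
  have -> : (M.-1 == M.-2) = false by move: M4; clear; lia.
  by rewrite prednK ?(ltnW M1) // -(pt_addl 0).
have evM : ~~ odd M.-2 by move: evenM; rewrite -{1}(@prednK M) ?(ltnW M1) // -{1}(@prednK M.-1) /= ?negbK //; move: M4; clear; lia.
have oddM : odd M.-1 by move: evenM; rewrite -{1}(@prednK M) ?(ltnW M1) //= negbK.
have A1 : fconnect F (pt M.-1 0) (pt 2 0).
  apply: (connect_from (ev0 M.-2 _ lt2 evM)); first by move: M4; clear; lia.
  apply: oneF; rewrite F1_pt ?(ltnW M1) //= eqxx.
  by have -> : (M.-1 == 1) = false by move: M4; clear; lia.
have ev1 d : 0 < d -> d < M -> ~~ odd d -> fconnect F (pt M.-1 d) (pt M.-1 0).
  move=> d0 dM od; have E : d = 2 + (d./2.-1).*2.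
    by rewrite -[LHS]odd_double_half (negPf od) -[in LHS](@prednK d./2) //;
       case: d d0 od {dM} => [|[]].
  apply: (connect_trans (y := pt M.-1 2)).
    by rewrite E; apply: down2; rewrite ?eqxx ?orbT -?E.
  apply: oneF; rewrite F1_pt ?(ltnW M4) //= eqxx.
  have -> : (M.-1 == 0) = false by move: M4; clear; lia.
  by have -> : (M.-1 == M.-2) = false by move: M4; clear; lia.
(* column M - 2 *)
have L1 : fconnect F (pt M.-2 1) (pt M.-1 0).
  apply: (connect_from (ev1 M.-2 _ lt2 evM)); first by move: M4; clear; lia.
  apply: oneF; rewrite F1_pt ?(ltnW M1) //= eqxx.
  by have -> : (M.-2 == 1) = false by move: M4; clear; lia.
have L2 d : 1 < d -> d < M -> fconnect F (pt M.-2 d) (pt 0 0).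
  move=> d1 dM; apply: (connect_from (od1 M.-1 lt1 oddM)).
  apply: (connect_trans (y := pt M.-2 2)).
    have := down M.-2 2 (d - 2); rewrite subnKC //; apply => //; try (by move: M4; clear; lia).
  apply: oneF; rewrite F1_pt ?(ltnW M4) //= eqxx.
  by have -> : (M.-2 == 0) = false by move: M4; clear; lia.
have L0 : fconnect F (pt M.-2 0) (pt 0 0).
  apply: (connect_from (L2 M.-1 _ lt1)); first by move: M4; clear; lia.
  apply: oneF; rewrite F1_pt ?(ltnW M1) //=.
  have -> : (M.-2 == 1) = false by move: M4; clear; lia.
  by have -> : (M.-2 == M.-1) = false by move: M4; clear; lia.
(* columns 1 .. M - 3 *)
have X c : 0 < c -> c < M.-2 -> fconnect F (pt c (M - c)) (pt c.+2 0).
  move=> c0 cM; apply: (connect_trans (y := pt c.+1 (M - c - 2))).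
    apply: oneF; rewrite F1_pt //; try (by move: c0 cM; clear; lia).
    have -> : 2 < M - c by move: cM; clear; lia.
    by have -> : c + (M - c) == M by move: cM; clear; lia.
  apply: (connect_trans (y := pt c.+1 1)).
    have := down c.+1 1 (M - c - 3).
    have -> : 1 + (M - c - 3) = M - c - 2 by move: cM; clear; lia.
    apply => //; try (by move: c0 cM; clear; lia).
  have [cE|cE] := eqVneq c.+1 M.-2.
    by have -> : c.+2 = M.-1; [move: cE M4; clear; lia|rewrite cE; apply: L1].
  apply: oneF; rewrite F1_pt ?(ltnW M1) //=; last by move: cM; clear; lia.
  rewrite (negPf cE); have -> // : (c.+1 == 1) = false by move: c0; clear; lia.
have Y c : 0 < c -> c < M.-2 -> fconnect F (pt c 0) (pt c.+2 0).
  move=> c0 cM; apply: (connect_from (X c c0 cM)).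
  have cM' : c < M by move: cM; clear; lia.
  have dn d : M - c <= d -> d < M -> fconnect F (pt c d) (pt c (M - c)).
    move=> cd dM; have := down c (M - c) (d - (M - c)); rewrite subnKC //.
    apply => //; try (by move: cM cM' c0; clear; lia).
  have [c1|c1] := eqVneq c 1; last first.
    apply: (connect_trans (y := pt c M.-1)); last first.
      by apply: dn => //; move: c0 c1 M4; clear; lia.
    apply: oneF; rewrite F1_pt ?(ltnW M1) //= (negPf c1).
    by have -> : (c == M.-1) = false by move: cM; clear; lia.
  rewrite c1 subn1; apply: (connect_trans (y := pt 1 M.-2)).
    by apply: oneF; rewrite F1_pt ?(ltnW M1).
  apply: (connect_trans (y := pt 1 1)).
    have := down 1 1 (M.-2 - 1); rewrite subnKC; last by move: M4; clear; lia.
    apply => //; try (by move: M4; clear; lia).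
  by apply: oneF; rewrite F1_pt ?(ltnW M1).
have A2 c : ~~ odd c -> 1 < c -> c < M -> fconnect F (pt c 0) (pt 0 0).
  have [k] := ubnP (M - c); elim: k c => // k IH c ck oc c1 cM.
  have [->|cE] := eqVneq c M.-2; first exact: L0.
  have c3 : c < M.-2.
    have cE1 : c != M.-1 by apply: contraNneq oc => ->.
    by move: cE cE1 cM; clear; lia.
  apply: connect_trans (Y c (ltnW c1) c3) _; apply: IH; rewrite /= ?negbK //.
    by move: ck c3; clear; lia.
  by move: c3; clear; lia.
have AM := connect_trans A1 (A2 2 isT isT (ltnW M4)).
have A c : c < M -> fconnect F (pt c 0) (pt 0 0).
  have [k] := ubnP (M - c); elim: k c => // k IH c ck cM.
  case: (posnP c) => [->|c0]; first exact: connect0.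
  have [->|cE] := eqVneq c M.-1; first exact: AM.
  have [->|cE2] := eqVneq c M.-2; first exact: L0.
  have c3 : c < M.-2 by move: cE cE2 cM; clear; lia.
  apply: connect_trans (Y c c0 c3) _; apply: IH; move: c3 ck; clear; lia.
move=> aM bM; case: (posnP b) => [->|b0]; first exact: A.
case: (posnP a) => [->|a0].
  case: (boolP (odd b)) => o; first by apply: connect_trans (od0 b bM o) (A 1 M1).
  by apply: connect_trans (ev0 b b0 bM o) (A 2 (ltnW M4)).
have [->|aE] := eqVneq a M.-1.
  case: (boolP (odd b)) => o; first exact: od1.
  exact: connect_trans (ev1 b b0 bM o) AM.
have [->|aE2] := eqVneq a M.-2.
  case: b b0 bM => [|[|b]] // _ bM; first exact: connect_trans L1 AM.
  exact: L2.
have a3 : a < M.-2 by move: aE aE2 aM; clear; lia.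
have a4 : a.+2 < M by move: a3; clear; lia.
have XA := connect_trans (X a a0 a3) (A _ a4).
have [ba|ba] := leqP (M - a) b.
  apply: (connect_from XA); have := down a (M - a) (b - (M - a)); rewrite subnKC //.
  apply => //; try (by move: a0 aM a3; clear; lia).
apply: (connect_trans (y := pt a 1)).
  have := down a 1 (b - 1); rewrite subnKC //.
  apply => //; try (by move: a0 aM a3; clear; lia).
  by move=> j j1 jM; move: j1 jM ba a0 aM; clear; lia.
have [a1|a1] := eqVneq a 1.
  apply: (connect_from XA); rewrite a1 subn1; apply: oneF.
  by rewrite F1_pt ?(ltnW M1).
apply: connect_trans (A a.+1 (ltnW a4)); apply: oneF.
by rewrite F1_pt ?(ltnW M1) //= (negPf a1) (negPf aE2).
Qed.

Lemma ham_even1 : ham (layered (M := M) (plan even1)).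
Proof.
apply: ham_layered => //; first by move=> t _; apply: even1_inj.
apply: (inj_ham (x0 := pt 0 0)); first by apply: descend_inj; apply: even1_inj.
by move=> z; rewrite {1}(pt_val z); apply: F1_reach; apply: ltn_Zp.
Qed.
End Colour1.
End EvenDesign.

Theorem even_box M (K : finType) (f g h : K -> K) :
  3 < M -> ~~ odd M -> #|K| = M -> ham f -> ham g -> ham h ->
  decomp [:: @lift1 K (K * K)%type f; lift2 (lift1 g); lift2 (lift2 h)].
Proof.
move=> M4 eM cK Hf Hg Hh; have M1 : 1 < M by apply: leq_trans M4.
apply: (decomp_layered (s0 := plan (M := M) (even0 M)) (s1 := plan (even1 M))
  (s2 := plan (even2 M)) M1 M1 (dvdnn M)) Hf Hg Hh => //.
  by move=> t z _; apply: even_perm.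
by rewrite /= ham_even0 // ham_even1 // ham_even2.
Qed.

(** * Colours that leave a box *)

Section Exit.
Variables (V W : finType) (M r : nat).
Hypotheses (r0 : 0 < r) (rM : r + r <= M).
Variables (E A : V -> V) (phi : V -> 'Z_M).
Hypotheses (EM : forall x, iter M E x = x) (HA : ham A).
Hypotheses (phiE : forall x, phi (E x) = (phi x + 1)%R)
           (phiA : forall x, phi (A x) = (phi x + 1)%R).
Variables (h : bool -> W -> W) (i : bool -> W -> 'Z_M).
Hypotheses (Hh : forall k, ham (h k)).
Hypotheses (ih : forall k w, i k (h k w) = (i k w + 1)%R).
Variables (kk : V -> bool) (rho : V -> nat).
Hypotheses (kkE : forall x, kk (E x) = kk x) (rhoE : forall x, rho (E x) = rho x).
Hypothesis rho_r : forall x, rho x < r.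
Variables (w0 w1 : W).
Hypotheses (i0 : forall k, i k w0 = 0%R).
Hypotheses (i1l : forall k, r <= val (i k w1)) (i1u : forall k, val (i k w1) <= M - r).

Let M1 : 1 < M. Proof. by apply: leq_trans rM; rewrite addnn -muln2 leq_pmull. Qed.

(** The phase of (x, w) is phi x + i w; a step of A or E raises it by 1, and so does a
step of h. *)
Definition leaves (z : V * W) := (phi z.1 + i (kk z.1) z.2 == (rho z.1)%:R)%R.
Definition boxed (z : V * W) :=
  (z.2 == w0) && (r <= val (phi z.1)) || (z.2 == w1) && (val (phi z.1) < r).

(** A step along E, replaced by a step of A in the two boxes and by a step in W when the
phase reaches rho. Over a point of W other than w0 and w1 the colour goes along the
whole E-line of x before it leaves, and it comes back with the same x. The Hamilton cycle
A is therefore traversed level by level, partly over w0 and partly over w1; two points of W are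
needed because on the levels where some colour leaves over w0 the box must be elsewhere. *)
Definition excursion (z : V * W) : V * W :=
  if leaves z then (z.1, h (kk z.1) z.2)
  else if boxed z then (A z.1, z.2) else (E z.1, z.2).

Lemma w01 : w0 != w1.
Proof. by apply/eqP => e; have := i1l true; rewrite -e i0 leqNgt r0. Qed.

Lemma iterE_phi m x : phi (iter m E x) = (phi x + m%:R)%R.
Proof. exact: iterZ. Qed.
Lemma iterA_phi m x : phi (iter m A x) = (phi x + m%:R)%R.
Proof. exact: iterZ. Qed.
Lemma iterE_kk m x : kk (iter m E x) = kk x.
Proof. by elim: m => //= m <-. Qed.
Lemma iterE_rho m x : rho (iter m E x) = rho x.
Proof. by elim: m => //= m <-. Qed.

Lemma leaves_iterE m x w :
  leaves (iter m E x, w) = (phi x + m%:R + i (kk x) w == (rho x)%:R)%R.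
Proof. by rewrite /leaves /= iterE_kk iterE_rho iterE_phi. Qed.

Lemma val_phiD x m (y : V) : val (phi x) + m < M -> phi y = (phi x + m%:R)%R ->
  val (phi y) = val (phi x) + m.
Proof.
by move=> lt ->; rewrite -[in LHS](natr_Zp (phi x)) -natrD; apply: val_natZ.
Qed.

Lemma leaves0 x : leaves (x, w0) = (val (phi x) == rho x).
Proof.
have lr : rho x < M by apply: leq_trans (rho_r x) _; apply: leq_trans rM; apply: leq_addr.
rewrite /leaves /= i0 addr0 -{1}(natr_Zp (phi x)); apply/eqP/eqP => [/(natZp_eq M1)|-> //].
by rewrite !modn_small ?ltn_Zp.
Qed.

Definition level1 x := rho x + M - val (i (kk x) w1).

Lemma level1_bounds x : r <= level1 x < M.
Proof.
have := rho_r x; have := i1l (kk x); have := i1u (kk x); rewrite /level1; move: rM r0.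
by clear; lia.
Qed.

Lemma leaves1 x : leaves (x, w1) = (val (phi x) == level1 x).
Proof.
have /andP[_ lM] := level1_bounds x.
have lE : (((level1 x)%:R : 'Z_M) = (rho x)%:R - i (kk x) w1)%R.
  have Mz : (M%:R = 0 :> 'Z_M)%R by apply/eqP; rewrite natZp_eq0.
  rewrite /level1 natrB ?natrD ?Mz ?addr0 ?natr_Zp //.
  by apply: leq_trans (ltnW (ltn_Zp _ M1)) _; apply: leq_addl.
rewrite /leaves /= eq_sym -subr_eq -lE -{1}(natr_Zp (phi x)) eq_sym.
apply/eqP/eqP => [/(natZp_eq M1)|-> //].
by rewrite !modn_small ?ltn_Zp.
Qed.

Lemma boxed0 x : boxed (x, w0) = (r <= val (phi x)).
Proof. by rewrite /boxed /= eqxx (negPf w01) orbF. Qed.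
Lemma boxed1 x : boxed (x, w1) = (val (phi x) < r).
Proof. by rewrite /boxed /= eqxx [w1 == w0]eq_sym (negPf w01). Qed.

Lemma excursion_inj : injective excursion.
Proof.
have Einj : injective E.
  move=> x y /(congr1 (iter M.-1 E)); rewrite -!iterSr prednK ?(ltnW M1) //.
  by rewrite !EM.
have Ainj := ham_inj HA.
have EE x x' w w' : leaves (x', w') = false -> (x, h (kk x) w) = (E x', w') ->
    leaves (x, w) -> False.
  move=> + [ex ew]; rewrite /leaves /= -ew ex kkE rhoE phiE ih => N L.
  by move: N; rewrite addrA addrAC L.
have EA x x' w w' : leaves (x, w) -> boxed (x', w') -> (x, h (kk x) w) = (A x', w') -> False.
  move=> L B [ex ew].
  have Ll : (phi x' + i (kk x) w' = (rho x)%:R)%R.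
    by move/eqP: L => /= <-; rewrite -ew ih ex phiA; ring.
  move: B; rewrite /boxed /= => /orP[/andP[/eqP w0E lr]|/andP[/eqP w1E lr]].
    have lM : rho x < M by apply: leq_trans (rho_r x) _; apply: leq_trans rM; apply: leq_addr.
    move: Ll; rewrite w0E i0 addr0 => e; move: lr; rewrite e leqNgt => /negP; apply.
    by have -> : val ((rho x)%:R : 'Z_M)%R = rho x by apply: val_natZ.
  have Mz : (M%:R = 0 :> 'Z_M)%R by apply/eqP; rewrite natZp_eq0.
  have /andP[l1 l2] := level1_bounds x.
  have e : (phi x' = (level1 x)%:R)%R.
    rewrite /level1 natrB ?natrD ?Mz ?addr0 ?natr_Zp.
      by rewrite -Ll w1E addrK.
    by apply: leq_trans (ltnW (ltn_Zp _ M1)) _; apply: leq_addl.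
  move: lr; rewrite e; have -> : val ((level1 x)%:R : 'Z_M)%R = level1 x by apply: val_natZ.
  by rewrite ltnNge l1.
have BB x x' w : phi x = phi x' -> boxed (x, w) = boxed (x', w) by rewrite /boxed /= => ->.
move=> [x w] [x' w']; rewrite /excursion /=.
case L : (leaves (x, w)); case L' : (leaves (x', w')).
- by case=> <- /(ham_inj (Hh _)) ->.
- case: ifP => B' e; first by case: (EA _ _ _ _ L B' e).
  by case: (EE _ _ _ _ L' e L).
- case: ifP => B /esym e; first by case: (EA _ _ _ _ L' B e).
  by case: (EE _ _ _ _ L e L').
case: ifP => B; case: ifP => B' [] e ew.
- by rewrite (Ainj _ _ e) ew.
- move: B B'; rewrite ew (BB x x') ?B' //; last first.
    by apply: (addIr 1%R); rewrite -phiA -phiE e.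
  by move=> ->.
- move: B B'; rewrite ew (BB x x') ?B' //; last first.
    by apply: (addIr 1%R); rewrite -phiE -phiA e.
  by move=> ->.
by rewrite (Einj _ _ e) ew.
Qed.

Lemma run_E m x w :
  (forall j, j < m -> leaves (iter j E x, w) = false /\ boxed (iter j E x, w) = false) ->
  fconnect excursion (x, w) (iter m E x, w).
Proof.
move=> H; apply: (fconnect_run (x := fun j => (iter j E x, w))) => j jm.
by have [L B] := H j jm; rewrite /excursion L B.
Qed.

Lemma run_A m x w :
  (forall j, j < m -> leaves (iter j A x, w) = false /\ boxed (iter j A x, w)) ->
  fconnect excursion (x, w) (iter m A x, w).
Proof.
move=> H; apply: (fconnect_run (x := fun j => (iter j A x, w))) => j jm.
by have [L B] := H j jm; rewrite /excursion L B.
Qed.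

Lemma leave x w : leaves (x, w) -> fconnect excursion (x, w) (x, h (kk x) w).
Proof. by move=> L; apply: connect1; rewrite /= /excursion L. Qed.

Lemma val_iterE x m : val (phi x) + m < M -> val (phi (iter m E x)) = val (phi x) + m.
Proof. by move=> lt; apply: val_phiD; rewrite // iterE_phi. Qed.
Lemma val_iterA x m : val (phi x) + m < M -> val (phi (iter m A x)) = val (phi x) + m.
Proof. by move=> lt; apply: val_phiD; rewrite // iterA_phi. Qed.

Lemma cross0 x : val (phi x) = r -> fconnect excursion (x, w0) (iter (M - r) A x, w0).
Proof.
move=> xr; apply: run_A => j jr; rewrite leaves0 /boxed /= eqxx.
have v : val (phi (iter j A x)) = r + j by rewrite val_iterA xr //; move: jr; clear; lia.
rewrite v leq_addr; split => //.
by apply/eqP => e; have := rho_r (iter j A x); rewrite -e ltnNge leq_addr.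
Qed.

Lemma cross1 x : val (phi x) = 0 -> fconnect excursion (x, w1) (iter r A x, w1).
Proof.
move=> x0; apply: run_A => j jr; rewrite leaves1 /boxed /= eqxx.
have v : val (phi (iter j A x)) = j.
  by rewrite val_iterA x0 // add0n; apply: leq_trans jr _; apply: leq_trans rM; apply: leq_addr.
rewrite v jr orbT; split => //.
have /andP[l _] := level1_bounds (iter j A x).
by apply/eqP => e; move: jr; rewrite e ltnNge l.
Qed.

(** Between two visits of the boxes the point of V moves along its E-line only. *)
Lemma travel x w J : (phi x + i (kk x) w = (rho x).+1%:R)%R ->
  (forall j, j < J -> iter j (h (kk x)) w != w0 /\ iter j (h (kk x)) w != w1) ->
  exists m, let x' := iter m E x in let w' := iter J (h (kk x)) w in
    fconnect excursion (x, w) (x', w') /\ (phi x' + i (kk x) w' = (rho x).+1%:R)%R.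
Proof.
elim: J => [|J IH] e H; first by exists 0; split=> //; apply: connect0.
have [|m [C e']] := IH e; first by move=> j jJ; apply: H; apply: ltnW.
have [n0 n1] := H J (ltnSn J).
exists (M.-1 + m); rewrite /= iterD.
set x1 := iter m E x in C e' *; set w' := iter J _ w in C e' n0 n1 *.
have kx : kk x1 = kk x by apply: iterE_kk.
have rx : rho x1 = rho x by apply: iterE_rho.
split.
  apply: connect_trans C _; apply: (connect_trans (y := (iter M.-1 E x1, w'))).
    apply: run_E => j jM; split; last by rewrite /boxed /= (negPf n0) (negPf n1).
    rewrite /leaves /= iterE_kk kx iterE_rho rx iterE_phi addrAC e'.
    rewrite -natrD -subr_eq0 -natrB; last by rewrite addSn leqW // leq_addr.
    by rewrite addSnnS addKn natZp_eq0 // gtnNdvd //; move: jM; clear; lia.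
  have := @leave (iter M.-1 E x1) w'; rewrite iterE_kk kx; apply.
  rewrite /leaves /= iterE_kk kx iterE_rho rx iterE_phi addrAC e' -natrD.
  have -> : (rho x).+1 + M.-1 = rho x + M by move: M1; clear; lia.
  by rewrite natrD (_ : M%:R = 0)%R ?addr0 //; apply/eqP; rewrite natZp_eq0.
rewrite iterE_phi ih -[RHS]e'.
have -> : (M.-1%:R = -1 :> 'Z_M)%R; last by ring.
by apply/eqP; rewrite -subr_eq0 opprK natr1 prednK ?(ltnW M1) // natZp_eq0.
Qed.

Lemma route k (a b : W) : a != b ->
  exists2 J, iter J (h k) (h k a) = b &
    forall j, j < J -> iter j (h k) (h k a) != a /\ iter j (h k) (h k a) != b.
Proof.
move=> ab; have ex : exists J, iter J (h k) (h k a) == b.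
  exists (findex (h k) (h k a) b); apply/eqP; apply: iter_findex.
  by move/hamP: (Hh k); apply.
case: (ex_minnP ex) => J /eqP EJ Jmin; exists J => // j jJ; split; last first.
  by apply/eqP => /eqP /Jmin; rewrite leqNgt jJ.
apply/eqP => e; have := Jmin (J - j.+1).
have -> : iter (J - j.+1) (h k) (h k a) = b.
  by rewrite -EJ -[in RHS](subnK jJ) iterD iterS e.
by rewrite eqxx => /(_ isT); move: jJ; clear; lia.
Qed.

Let connectC := fconnect_sym excursion_inj.

Lemma iterE_level x m p : val (phi x) = p -> p + m < M -> val (phi (iter m E x)) = p + m.
Proof. by move=> <- ?; rewrite val_iterE. Qed.

Lemma iterE_back x m : phi (iter m E x) = phi x -> iter m E x = x.
Proof.
move=> e; have : M %| m.
  rewrite -natZp_eq0 //; apply/eqP; apply: (addrI (phi x)).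
  by rewrite -iterE_phi e addr0.
case/dvdnP => c ->; elim: c => //= c IH; by rewrite mulSn iterD IH EM.
Qed.

(** The phase on leaving w0 is the level rho x; after the journey x has moved along its
E-line only, and its level is 0 again when the box over w1 is entered. *)
Lemma move01 x : val (phi x) = 0 -> fconnect excursion (x, w0) (x, w1).
Proof.
move=> x0; have rM' := leq_trans (rho_r x) (leq_trans (leq_addr _ _) rM).
have C1 : fconnect excursion (x, w0) (iter (rho x) E x, w0).
  apply: run_E => j jr; rewrite leaves0 iterE_rho /boxed /= eqxx (negPf w01) /=.
  have -> : val (phi (iter j E x)) = j by rewrite (iterE_level x0) ?add0n // (ltn_trans jr).
  by rewrite (ltn_eqF jr) orbF; split=> //; apply/negbTE; rewrite -ltnNge (ltn_trans jr).
set y := iter (rho x) E x in C1.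
have yr : val (phi y) = rho x by rewrite (iterE_level x0) ?add0n.
have ky : kk y = kk x by apply: iterE_kk.
have ry : rho y = rho x by apply: iterE_rho.
have C2 : fconnect excursion (y, w0) (y, h (kk y) w0) by apply: leave; rewrite leaves0 yr ry.
have [J EJ HJ] := route (kk y) w01.
have [|m [C3 e3]] := @travel y (h (kk y) w0) J _ HJ.
  by rewrite ih i0 add0r -[phi y]natr_Zp yr ry natr1.
rewrite EJ in C3 e3; set z := iter m E y in C3 e3.
have kz : kk z = kk x by rewrite iterE_kk.
have rz : rho z = rho x by rewrite iterE_rho.
have /andP[l1 l2] := level1_bounds z.
have lz : val (phi z) = (level1 z).+1 %% M.
  have e : (phi z = (level1 z).+1%:R)%R.
    have Mz : (M%:R = 0 :> 'Z_M)%R by apply/eqP; rewrite natZp_eq0.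
    rewrite -natr1 /level1 natrB ?natrD ?Mz ?addr0 ?natr_Zp.
      by rewrite rz kz -ky; move: e3; rewrite -natr1 ry => /eqP; rewrite -subr_eq => /eqP <-; ring.
    by apply: leq_trans (ltnW (ltn_Zp _ M1)) _; apply: leq_addl.
  by rewrite e; apply: val_Zp_nat.
have fin u : fconnect excursion (z, w1) (iter u E z, w1) -> phi (iter u E z) = 0%R ->
    fconnect excursion (x, w0) (x, w1).
  move=> C4 e4; apply: connect_trans C1 _; apply: connect_trans C2 _.
  apply: connect_trans C3 _; apply: connect_trans C4 _.
  have E0 : iter u E z = iter (u + (m + rho x)) E x by rewrite !iterD.
  rewrite E0 iterE_back ?connect0 // -E0 e4; apply: val_inj; rewrite /= x0.
  by [].
move: l2; rewrite leq_eqVlt => /orP[/eqP lM|lM].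
  apply: (fin 0); first exact: connect0.
  by apply: val_inj; rewrite /= lz lM modnn.
rewrite modn_small // in lz.
apply: (fin (M - (level1 z).+1)); last first.
  rewrite iterE_phi -[phi z]natr_Zp lz -natrD subnKC; last exact: ltnW.
  by apply/eqP; rewrite natZp_eq0.
apply: run_E => j jM.
have v : val (phi (iter j E z)) = (level1 z).+1 + j.
  by rewrite (iterE_level lz) //; move: jM; clear; lia.
have lE : level1 (iter j E z) = level1 z by rewrite /level1 iterE_rho iterE_kk.
rewrite leaves1 lE /boxed /= v eqxx [w1 == w0]eq_sym (negPf w01) /=.
by split; [|apply/negbTE]; move: l1; clear; lia.
Qed.

(** On the way back the levels from r on belong to E over w1, and those below r over w0. *)
Lemma move10 x : val (phi x) = r -> fconnect excursion (x, w1) (x, w0).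
Proof.
move=> xr; have /andP[l1 l2] := level1_bounds x.
have C1 : fconnect excursion (x, w1) (iter (level1 x - r) E x, w1).
  apply: run_E => j jr.
  have v : val (phi (iter j E x)) = r + j.
    by rewrite (iterE_level xr) //; move: jr l1 l2; clear; lia.
  have lE : level1 (iter j E x) = level1 x by rewrite /level1 iterE_rho iterE_kk.
  rewrite leaves1 lE /boxed /= v eqxx [w1 == w0]eq_sym (negPf w01) /=.
  by split; [|apply/negbTE]; move: jr l1; clear; lia.
set y := iter (level1 x - r) E x in C1.
have ky : kk y = kk x by apply: iterE_kk.
have ry : rho y = rho x by apply: iterE_rho.
have lE : level1 y = level1 x by rewrite /level1 ky ry.
have yr : val (phi y) = level1 y.
  by rewrite lE (iterE_level xr) subnKC.
have L : leaves (y, w1) by rewrite leaves1 yr.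
have C2 := leave L.
have w10 : w1 != w0 by rewrite eq_sym w01.
have [J EJ HJ] := route (kk y) w10.
have HJ' j : j < J -> iter j (h (kk y)) (h (kk y) w1) != w0 /\ iter j (h (kk y)) (h (kk y) w1) != w1.
  by move=> jJ; have [? ?] := HJ j jJ.
have [|m [C3 e3]] := @travel y (h (kk y) w1) J _ HJ'.
  by rewrite ih addrA (eqP L) natr1.
rewrite EJ i0 addr0 in C3 e3; set z := iter m E y in C3 e3.
have rz : rho z = rho x by rewrite iterE_rho.
have rMr : r < M by move: rM r0; clear; lia.
have zl : val (phi z) = (rho x).+1.
  rewrite e3 ry; apply: val_natZ => //; apply: leq_ltn_trans rMr; exact: rho_r.
have C4 : fconnect excursion (z, w0) (iter (r - (rho x).+1) E z, w0).
  apply: run_E => j jr.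
  have v : val (phi (iter j E z)) = (rho x).+1 + j.
    by rewrite (iterE_level zl) //; move: jr rMr; clear; lia.
  rewrite leaves0 /boxed /= v eqxx (negPf w01) iterE_rho rz /= orbF.
  by split; apply/negbTE; move: jr; clear; lia.
apply: connect_trans C1 _; apply: connect_trans C2 _; apply: connect_trans C3 _.
apply: connect_trans C4 _.
have E0 : iter (r - (rho x).+1) E z = iter (r - (rho x).+1 + (m + (level1 x - r))) E x.
  by rewrite !iterD.
rewrite E0 iterE_back ?connect0 // -E0; apply: val_inj => /=.
by rewrite (iterE_level zl) ?xr subnKC // rho_r.
Qed.

(** One turn through all the levels over w0 and w1 amounts to M steps of A. *)
Lemma cycle0 x : val (phi x) = 0 -> fconnect excursion (x, w0) (iter M A x, w0).
Proof.
move=> x0; have rMr : r < M by move: rM r0; clear; lia.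
have yr : val (phi (iter r A x)) = r by rewrite val_iterA x0 add0n.
apply: connect_trans (move01 x0) _; apply: connect_trans (cross1 x0) _.
apply: connect_trans (move10 yr) _.
by have := cross0 yr; rewrite -iterD subnK // ltnW.
Qed.

Lemma zeros_connected x y : phi x = 0%R -> phi y = 0%R ->
  fconnect excursion (x, w0) (y, w0).
Proof.
move=> px py; have /hamP/(_ x y)/iter_findex Ek := HA.
have : M %| findex A x y.
  rewrite -natZp_eq0 //; apply/eqP; have := iterA_phi (findex A x y) x.
  by rewrite Ek px py add0r.
case/dvdnP => c Ec; rewrite -Ek Ec; elim: c {Ek Ec} => [|c IH]; first exact: connect0.
apply: connect_trans IH _; rewrite mulSn iterD; apply: cycle0.
by rewrite iterA_phi px add0r natrM (_ : M%:R = 0)%R ?mulr0 //; apply/eqP; rewrite natZp_eq0.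
Qed.

Lemma reach0 x : exists2 y, phi y = 0%R & fconnect excursion (x, w0) (y, w0).
Proof.
have rMr : r < M by move: rM r0; clear; lia.
have fromr z : val (phi z) = r -> exists2 y, phi y = 0%R & fconnect excursion (z, w0) (y, w0).
  move=> zr; exists (iter (M - r) A z); last exact: cross0.
  rewrite iterA_phi -[phi z]natr_Zp zr -natrD subnKC; last exact: ltnW.
  by apply/eqP; rewrite natZp_eq0.
have vM := ltn_Zp (phi x) M1.
have [lo|hi] := leqP r (val (phi x)).
  exists (iter (M - val (phi x)) A x).
    rewrite iterA_phi -[X in (X + _)%R]natr_Zp -natrD subnKC ?(ltnW vM) //.
    by apply/eqP; rewrite natZp_eq0.
  apply: run_A => j jM; rewrite leaves0 /boxed /= eqxx.
  have v : val (phi (iter j A x)) = val (phi x) + j.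
    by rewrite val_iterA //; move: jM; clear; lia.
  rewrite v (leq_trans lo (leq_addr _ _)); split=> //.
  by apply/eqP => e; have := rho_r (iter j A x); rewrite -e ltnNge (leq_trans lo (leq_addr _ _)).
have [le|gt] := leqP (val (phi x)) (rho x).
  (* before the exit: go back to phase 0 *)
  have [y Ey Py] : exists2 y, iter (val (phi x)) E y = x & phi y = 0%R.
    exists (iter (M - val (phi x)) E x); first by rewrite -iterD subnKC ?EM // ltnW.
    rewrite iterE_phi -[X in (X + _)%R]natr_Zp -natrD subnKC ?(ltnW vM) //.
    by apply/eqP; rewrite natZp_eq0.
  exists y => //; rewrite connectC -Ey; apply: run_E => j jr.
  have v : val (phi (iter j E y)) = j.
    by rewrite (iterE_level (p := 0)) ?Py ?add0n // (ltn_trans jr).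
  have ry : rho (iter j E y) = rho x by rewrite -Ey !iterE_rho.
  rewrite leaves0 /boxed /= v eqxx (negPf w01) ry /= orbF.
  by split; apply/negbTE; move: jr le hi; clear; lia.
have C : fconnect excursion (x, w0) (iter (r - val (phi x)) E x, w0).
  apply: run_E => j jr.
  have v : val (phi (iter j E x)) = val (phi x) + j.
    by rewrite val_iterE //; move: jr rMr; clear; lia.
  rewrite leaves0 boxed0 v iterE_rho.
  by split; apply/negbTE; move: jr gt; clear; lia.
have [|y Py Cy] := fromr (iter (r - val (phi x)) E x).
  by rewrite val_iterE subnKC // ltnW.
by exists y => //; apply: connect_trans C Cy.
Qed.

Lemma reach1 x : exists2 y, phi y = 0%R & fconnect excursion (x, w1) (y, w0).
Proof.
have rMr : r < M by move: rM r0; clear; lia.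
have fromr z : val (phi z) = r -> exists2 y, phi y = 0%R & fconnect excursion (z, w1) (y, w0).
  move=> zr; have [y Py C] := reach0 z; exists y => //.
  exact: connect_trans (move10 zr) C.
have vM := ltn_Zp (phi x) M1; have /andP[l1 l2] := level1_bounds x.
have [le|lt] := leqP r (val (phi x)); last first.
  have [|y Py Cy] := fromr (iter (r - val (phi x)) A x).
    by rewrite val_iterA subnKC // ltnW.
  exists y => //; apply: connect_trans Cy; apply: run_A => j jr.
  have v : val (phi (iter j A x)) = val (phi x) + j.
    by rewrite val_iterA //; move: jr rMr; clear; lia.
  have /andP[m1 _] := level1_bounds (iter j A x).
  by rewrite leaves1 boxed1 v; split; [apply/negbTE|]; move: jr m1; clear; lia.
have lE j : level1 (iter j E x) = level1 x by rewrite /level1 iterE_rho iterE_kk.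
have [lt|ge] := ltnP (level1 x) (val (phi x)).
  (* past the exit: go on to phase 0 *)
  pose m := M - val (phi x).
  have Py : phi (iter m E x) = 0%R.
    rewrite iterE_phi -[X in (X + _)%R]natr_Zp -natrD subnKC ?(ltnW vM) //.
    by apply/eqP; rewrite natZp_eq0.
  exists (iter m E x) => //; apply: (connect_trans (y := (iter m E x, w1))).
    apply: run_E => j jm.
    have v : val (phi (iter j E x)) = val (phi x) + j.
      by rewrite val_iterE //; move: jm; rewrite /m; clear; lia.
    by rewrite leaves1 boxed1 v lE; split; apply/negbTE; move: le lt; clear; lia.
  by rewrite connectC; apply: move01; rewrite Py.
have [y Ey Py] : exists2 y, iter (val (phi x) - r) E y = x & val (phi y) = r.
  exists (iter (M - (val (phi x) - r)) E x).
    by rewrite -iterD subnKC ?EM //; move: vM; clear; lia.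
  rewrite iterE_phi -[X in (X + _)%R]natr_Zp -natrD.
  have -> : val (phi x) + (M - (val (phi x) - r)) = r + M by move: vM le; clear; lia.
  rewrite natrD (_ : M%:R = 0)%R ?addr0; first exact: val_natZ.
  by apply/eqP; rewrite natZp_eq0.
have [u Pu Cu] := fromr y Py; exists u => //; apply: connect_trans Cu.
rewrite connectC -Ey; apply: run_E => j jr.
have v : val (phi (iter j E y)) = r + j.
  by rewrite (iterE_level Py) //; move: jr vM; clear; lia.
have lj : level1 (iter j E y) = level1 x by rewrite -Ey /level1 !iterE_rho !iterE_kk.
by rewrite leaves1 boxed1 v lj; split; apply/negbTE; move: jr ge; clear; lia.
Qed.

Lemma reach x w : exists2 y, phi y = 0%R & fconnect excursion (x, w) (y, w0).
Proof.
have [J EJ] : exists J, iter J (h (kk x)) w == w0.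
  by exists (findex (h (kk x)) w w0); apply/eqP/iter_findex; move/hamP: (Hh (kk x)); apply.
elim: J x w EJ => [|J IH] x w /=; first by move/eqP ->; apply: reach0.
have [->|n0] := eqVneq w w0; first by move=> _; apply: reach0.
have [->|n1] := eqVneq w w1; first by move=> _; apply: reach1.
rewrite -iterS iterSr => EJ.
have : exists m, leaves (iter m E x, w).
  exists (val ((rho x)%:R - (phi x + i (kk x) w))%R).
  by rewrite leaves_iterE natr_Zp; apply/eqP; ring.
move=> ex; case: (ex_minnP ex) => m L mmin.
have kx : kk (iter m E x) = kk x by apply: iterE_kk.
have [|y Py Cy] := IH (iter m E x) (h (kk x) w); first by rewrite kx.
exists y => //; apply: connect_trans Cy; apply: (connect_trans (y := (iter m E x, w))).
  apply: run_E => j jm; split; last by rewrite /boxed /= (negPf n0) (negPf n1).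
  by apply/negP => /mmin; rewrite leqNgt jm.
by rewrite -kx; apply: leave.
Qed.

Theorem ham_excursion : ham excursion.
Proof.
apply/hamP => -[x w] [x' w']; have [y Py Cy] := reach x w; have [z Pz Cz] := reach x' w'.
apply: connect_trans Cy _; apply: connect_trans (zeros_connected Py Pz) _.
by rewrite connectC.
Qed.
End Exit.

(** * Colours that visit a box *)

Section Visit.
Variables (V W : finType) (M : nat) (phi : V -> 'Z_M) (h : W -> W) (i : W -> 'Z_M).
Variables (cond : nat -> V -> bool) (D : nat -> V -> V).
Hypotheses (M1 : 1 < M) (Hh : ham h) (ih : forall w, i (h w) = (i w + 1)%R).
Hypotheses (phiD : forall p x, phi (D p x) = (phi x + 1)%R)
           (Dinj : forall p, injective (D p))
           (condD : forall p x, cond p (D p x) = cond p x).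

(** The counterpart of the excursions: the map steps along h and, at the phases selected
by cond, takes over the step D of V that the colours leaving V give up. *)
Definition visit (z : V * W) :=
  let p := val (phi z.1 + i z.2)%R in
  if cond p z.1 then (D p z.1, z.2) else (z.1, h z.2).

Lemma visitE x w : visit (x, w) = let p := val (phi x + i w)%R in
  if cond p x then (D p x, w) else (x, h w).
Proof. by []. Qed.

Lemma visit_phase z : (phi (visit z).1 + i (visit z).2 = phi z.1 + i z.2 + 1)%R.
Proof. by rewrite /visit; case: ifP => _ /=; rewrite ?phiD ?ih; ring. Qed.

Lemma visit_phases k z : (phi (iter k visit z).1 + i (iter k visit z).2 =
  phi z.1 + i z.2 + k%:R)%R.
Proof. by elim: k => [|k IH] /=; rewrite ?addr0 // visit_phase IH -natr1 addrA. Qed.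

Lemma visit_inj : injective visit.
Proof.
have aux x w x' w' : let p := val (phi x + i w)%R in let p' := val (phi x' + i w')%R in
    cond p x -> cond p' x' = false -> (D p x, w) = (x', h w') -> False.
  move=> p p' cp cp' [ex ew]; move: cp'.
  have -> : p' = p by congr val; rewrite -ex ew phiD ih; ring.
  by rewrite -ex condD cp.
move=> [x w] [x' w']; rewrite /visit /=; case: ifP => c; case: ifP => c'.
- case=> + ew => ex; have px : phi x = phi x'.
    by apply: (addIr 1%R); rewrite -!(phiD 0); move: ex => /(congr1 phi); rewrite !phiD.
  by move: ex; rewrite px ew => /Dinj ->.
- by move/(aux _ _ _ _ c c').
- by move/esym/(aux _ _ _ _ c' c).
by case=> -> /(ham_inj Hh) ->.
Qed.

(** The movement in V during the first k phases of a turn, and the number of steps along h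
made meanwhile. *)
Fixpoint tour k x := if k is k'.+1 then
  let y := tour k' x in if cond k' y then D k' y else y else x.

Fixpoint stays k x := if k is k'.+1 then stays k' x + ~~ cond k' (tour k' x) else 0.

Lemma tour_stays k x w : k <= M -> (phi x + i w = 0)%R ->
  iter k visit (x, w) = (tour k x, iter (stays k x) h w).
Proof.
move=> kM e; elim: k kM => [|k IH] //= kM; rewrite (IH (ltnW kM)).
have P : (phi (tour k x) + i (iter (stays k x) h w) = k%:R)%R.
  by have := visit_phases k (x, w); rewrite (IH (ltnW kM)) e add0r.
rewrite visitE P; have -> : val (k%:R : 'Z_M)%R = k by apply: val_natZ.
cbv zeta; by case: ifP => _ /=; rewrite ?addn0 ?addn1.
Qed.

Lemma index_reach u w w' : coprime u #|W| -> i w = i w' -> exists m, iter (m * (M * u)) h w = w'.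
Proof.
move=> cp e; have W0 : 0 < #|W| by apply/card_gt0P; exists w.
have /hamP/(_ w w')/iter_findex Ek := Hh.
have : M %| findex h w w'.
  rewrite -natZp_eq0 //; apply/eqP; apply: (addrI (i w)).
  by rewrite -(iterZ _ _ ih) Ek addr0.
case/dvdnP => q Eq; have [m Em] := mul_mod_surj q W0 cp; exists m.
by rewrite mulnCA mulnC -(ham_iter_mod _ _ Hh) -modnMml Em modnMml (ham_iter_mod _ _ Hh) -Eq.
Qed.

Variables (C : Type) (cl : V -> C) (S : finType) (e : C -> S -> V) (st : V -> S).
Variables (b : C -> S -> S) (u : C -> nat).
Hypotheses (stK : forall x, e (cl x) (st x) = x) (clD : forall p x, cond p x -> cl (D p x) = cl x).
Hypotheses (tourE : forall c s, tour M (e c s) = e c (b c s)) (Hb : forall c, ham (b c)).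
Hypotheses (total : forall c, \sum_s stays M (e c s) = M * u c)
           (cpu : forall c, coprime (u c) #|W|).

Lemma visit_cl z : cl (visit z).1 = cl z.1.
Proof. by rewrite /visit; case: ifP => //= /clD. Qed.

(** If the tours of V through M phases form a single cycle on a class, the whole map does:
once that cycle has closed, W has moved by M * u steps, and u is prime to its length. *)
Lemma visit_connected x w x' w' : cl x = cl x' -> fconnect visit (x, w) (x', w').
Proof.
move=> ec.
have Z y v : exists s v', [/\ fconnect visit (y, v) (e (cl y) s, v')
    & (phi (e (cl y) s) + i v' = 0)%R].
  pose k := val (- (phi y + i v))%R.
  have P : (phi (iter k visit (y, v)).1 + i (iter k visit (y, v)).2 = 0)%R.
    by rewrite visit_phases natr_Zp subrr.
  have Ck : cl (iter k visit (y, v)).1 = cl y.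
    by elim: (k) => //= j IHj; rewrite visit_cl.
  exists (st (iter k visit (y, v)).1), (iter k visit (y, v)).2.
  by rewrite -Ck stK -surjective_pairing; split=> //; apply: fconnect_iter.
have [s [v [C1 P1]]] := Z x w; have [s' [v' [C2 P2]]] := Z x' w'.
apply: connect_trans C1 _; rewrite (fconnect_sym visit_inj).
apply: connect_trans C2 _; rewrite (fconnect_sym visit_inj) -ec.
rewrite -ec in P2; set c := cl x in P1 P2 *.
pose F := skew (b c) h (fun s => stays M (e c s)).
have round n t y : (phi (e c t) + i y = 0)%R ->
    let z := iter n F (t, y) in
    fconnect visit (e c t, y) (e c z.1, z.2) /\ (phi (e c z.1) + i z.2 = 0)%R.
  move=> P; elim: n => [|n [IH IP]] /=; first by split; first exact: connect0.
  have := tour_stays (leqnn M) IP; rewrite tourE => E.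
  split; first by apply: connect_trans IH _; rewrite -E; apply: fconnect_iter.
  have := visit_phases M (e c (iter n F (t, y)).1, (iter n F (t, y)).2).
  have Mz : (M%:R = 0 :> 'Z_M)%R by apply/eqP; rewrite natZp_eq0.
  by rewrite E IP Mz addr0.
have [n En] : exists n, iter n (b c) s = s'.
  by exists (findex (b c) s s'); apply: iter_findex; move/hamP: (Hb c); apply.
have := round n _ _ P1; rewrite iter_skew En /=; set y := iter _ h v => -[C3 P3].
apply: connect_trans C3 _.
have [m Em] : exists m, iter (m * (M * u c)) h y = v'.
  by apply: index_reach => //; apply: (addrI (phi (e c s'))); rewrite P3 P2.
have := round (m * #|S|) _ _ P3.
have -> : iter (m * #|S|) F (s', y) = (s', v').
  rewrite -Em -total; elim: m {Em} => //= m IH; rewrite mulSn iterD IH iter_skew.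
  by rewrite ham_iter_card // (ham_sum (fun s => stays M (e c s)) s' (Hb c)) -iterD mulSn.
by case.
Qed.
End Visit.

(** Classes that are single cycles are merged by rotating the images of one point of
each class. *)
Section Merge.
Variables (T : finType) (M : nat) (f : T -> T) (cl : T -> 'Z_M) (pt : 'Z_M -> T).
Hypothesis (M1 : 1 < M).
Hypotheses (fI : injective f) (clf : forall z, cl (f z) = cl z).
Hypothesis conn : forall z z', cl z = cl z' -> fconnect f z z'.
Hypothesis clpt : forall a, cl (pt a) = a.

Definition merged (z : T) := if z == pt (cl z) then f (pt (cl z + 1)%R) else f z.

Lemma ham_merged : ham merged.
Proof.
have inj : injective merged.
  move=> z z'; rewrite /merged; case: eqP => E; case: eqP => E' /fI e.
  - have := congr1 cl e; rewrite !clpt => /addIr ec; by rewrite E E' ec.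
  - by case: E'; rewrite -{1}e -[in RHS]e clpt.
  - by case: E; rewrite {1}e [in RHS]e clpt.
  by [].
apply: (inj_ham (x0 := pt 0%R) inj) => z.
have toP y : fconnect merged y (pt (cl y)).
  have ex : exists k, iter k f y == pt (cl y).
    have C : fconnect f y (pt (cl y)) by apply: conn; rewrite clpt.
    by exists (findex f y (pt (cl y))); apply/eqP/iter_findex.
  case: (ex_minnP ex) => k /eqP Ek kmin; rewrite -Ek.
  apply: (fconnect_run (x := fun j => iter j f y)) => j jk.
  have cj : cl (iter j f y) = cl y by elim: (j) => //= j' <-.
  rewrite /merged cj; case: eqP => // E.
  by have := kmin j; rewrite E eqxx leqNgt jk => /(_ isT).
apply: connect_trans (toP z) _.
have nxt a : fconnect merged (pt a) (pt (a + 1)%R).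
  apply: (connect_trans (y := merged (pt a))); first exact: fconnect1.
  have -> : merged (pt a) = f (pt (a + 1)%R) by rewrite /merged clpt eqxx.
  by have := toP (f (pt (a + 1)%R)); rewrite clf clpt.
have K k a : fconnect merged (pt a) (pt (a + k%:R)%R).
  elim: k => [|k IH]; first by rewrite addr0; apply: connect0.
  by apply: connect_trans IH _; rewrite -natr1 addrA; apply: nxt.
by have := K (val (- cl z)%R) (cl z); rewrite natr_Zp subrr.
Qed.
End Merge.

(** * Three axes and two further cycles *)

Local Open Scope ring_scope.

(** No colour leaves inside the boxes, so the axes can be redistributed there. *)
Lemma boxed_stays (V W : finType) M r (phi : V -> 'Z_M)
  (i : bool -> W -> 'Z_M) kk rho (w0 w1 : W) z :
  (0 < r)%N -> (r + r <= M)%N -> (forall x, (rho x < r)%N) -> (forall k, i k w0 = 0%R) ->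
  (forall k, (r <= val (i k w1))%N) -> (forall k, (val (i k w1) <= M - r)%N) ->
  boxed r phi w0 w1 z -> leaves phi i kk rho z = false.
Proof.
move=> r0 rM rr i0 i1l i1u; case: z => x w; rewrite /boxed /=.
case/orP => /andP[/eqP -> lev]; apply/negbTE.
  rewrite (@leaves0 _ _ M r) //; apply/eqP => e; move: lev; rewrite leqNgt e.
  by rewrite rr.
rewrite (@leaves1 _ _ M r) //; apply/eqP => e; move: lev; rewrite e ltnNge.
by case/andP: (@level1_bounds _ _ M r r0 rM i kk rho rr w1 i1l i1u x) => ->.
Qed.

Lemma tour_late (V : finType) cond D r k (x : V) :
  (forall p y, (r <= p)%N -> cond p y = false) ->
  tour cond D (k + r) x = tour cond D r x /\
  stays cond D (k + r) x = (stays cond D r x + k)%N.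
Proof.
move=> H; elim: k => [|k [IH1 IH2]] /=; first by rewrite addn0.
by rewrite H ?leq_addl // IH1 IH2 addnS addn1.
Qed.

Lemma perm_line (T : eqType) (a b c d e : T) :
  perm_eq [:: a; b; c; d; e] [:: d; e; c; b; a].
Proof. by apply/permP => P /=; clear; lia. Qed.

Lemma val_Zp_eq M k (a : 'Z_M) : (1 < M)%N -> (k < M)%N -> (val a == k) = (a == k%:R).
Proof.
move=> M1 kM; apply/eqP/eqP => [<-|->]; [by rewrite natr_Zp|exact: val_natZ].
Qed.

Section Five.
Variables (M : nat) (W : finType) (h : bool -> W -> W) (i : bool -> W -> 'Z_M).
Variables (w0 w1 : W).
Hypotheses (M4 : (3 < M)%N) (Hh : forall k, ham (h k)).
Hypotheses (ih : forall k w, i k (h k w) = i k w + 1).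
Hypotheses (i0 : forall k, i k w0 = 0).
Hypotheses (i1l : forall k, (2 <= val (i k w1))%N) (i1u : forall k, (val (i k w1) <= M - 2)%N).
Hypotheses (cp1 : coprime (M * (M - 2) + 1) #|W|) (cp2 : coprime (M * (M - 2) + (M - 1)) #|W|).
Local Notation Z := 'Z_M.
Local Notation V := (Z * (Z * Z))%type.
Let M1 : (1 < M)%N. Proof. exact: leq_trans M4. Qed.
Let r0 : (0 < 2)%N. Proof. by []. Qed.
Let rM : (2 + 2 <= M)%N. Proof. by []. Qed.

Definition succ (x : Z) := x + 1.
Definition E1 : V -> V := lift1 succ.
Definition E2 : V -> V := lift2 (lift1 succ).
Definition E3 : V -> V := lift2 (lift2 succ).
Definition phi3 (x : V) := x.1 + x.2.1 + x.2.2.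

Variables A1 A2 A3 : V -> V.
Hypotheses (HA1 : ham A1) (HA2 : ham A2) (HA3 : ham A3).
Hypothesis box : recolour [:: E1; E2; E3] [:: A1; A2; A3].

Lemma phi3E x y : y \in [:: E1 x; E2 x; E3 x] -> phi3 y = phi3 x + 1.
Proof.
case: x => [a [b c]]; rewrite !inE /phi3 => /or3P[] /eqP -> /=; rewrite /succ; ring.
Qed.

Lemma phi3A (A : V -> V) x : (A x) \in [:: A1 x; A2 x; A3 x] -> phi3 (A x) = phi3 x + 1.
Proof. by move=> m; apply: phi3E; have /perm_mem -> := box x. Qed.

Lemma iter_succ m (a : Z) : iter m succ a = a + m%:R.
Proof. by elim: m => [|m IH]; rewrite ?addr0 //= IH /succ -natr1 addrA. Qed.

Lemma iter_M (a : Z) : iter M succ a = a.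
Proof. by rewrite iter_succ (_ : M%:R = 0) ?addr0 //; apply/eqP; rewrite natZp_eq0. Qed.

Lemma E_order x : [/\ iter M E1 x = x, iter M E2 x = x & iter M E3 x = x].
Proof.
by split; move: x; do ?[apply: iter_lift2]; do ?[apply: iter_lift1]; apply: iter_M.
Qed.

(** Colours 1 and 2 leave the cube at phase 0, colour 3 at phase 1, and the steps along E1,
E2, E3 that they give up are taken by colours 4 and 5. The plane x1 = x2 decides
which of these receives E3: in the class x2 = c colour 4 runs through all x1, and takes E3
for all of them but one, a number prime to M; in the class x1 = c colour 5 takes E3 for
exactly one x2. *)
Definition side (x : V) := x.1 != x.2.1.

Definition col1 := excursion 2 E1 A1 phi3 h i (fun=> true) (fun=> 0%N) w0 w1.
Definition col2 := excursion 2 E2 A2 phi3 h i (fun=> false) (fun=> 0%N) w0 w1.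
Definition col3 := excursion 2 E3 A3 phi3 h i side (fun=> 1%N) w0 w1.

Lemma ham_col1 : ham col1.
Proof.
apply: (ham_excursion r0 rM (phi := phi3)) => //.
- by move=> x; have [] := E_order x.
- by move=> x; apply: phi3E; rewrite !inE eqxx.
- by move=> x; apply: phi3A; rewrite !inE eqxx.
Qed.
Lemma ham_col2 : ham col2.
Proof.
apply: (ham_excursion r0 rM (phi := phi3)) => //.
- by move=> x; have [] := E_order x.
- by move=> x; apply: phi3E; rewrite !inE eqxx !orbT.
- by move=> x; apply: phi3A; rewrite !inE eqxx !orbT.
Qed.
Lemma ham_col3 : ham col3.
Proof.
apply: (ham_excursion r0 rM (phi := phi3)) => //.
- by move=> x; have [] := E_order x.
- by move=> x; apply: phi3E; rewrite !inE eqxx !orbT.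
- by move=> x; apply: phi3A; rewrite !inE eqxx !orbT.
Qed.

Definition cond4 p x := match p with 0%N => true | 1%N => side x | _ => false end.
Definition cond5 p x := match p with 0%N => true | 1%N => ~~ side x | _ => false end.
Definition D4 p := if p is 0%N then E1 else E3.
Definition D5 p := if p is 0%N then E2 else E3.

(** Colours 4 and 5 fall into M classes each. Along the line x1 + x2 = x3 = 0 over w0 the
first has the step E1 and the second E2; exchanging these merges the classes of both. *)
Definition vis4 := visit phi3 (h true) (i true) cond4 D4.
Definition vis5 := visit phi3 (h false) (i false) cond5 D5.
Definition pt4 (a : Z) : V * W := ((- a, (a, 0)), w0).
Definition pt5 (a : Z) : V * W := ((a, (- a, 0)), w0).
Definition col4 := merged vis4 (fun z => z.1.2.1) pt4.
Definition col5 := merged vis5 (fun z => z.1.1) pt5.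

Lemma E_inj : [/\ injective E1, injective E2 & injective E3].
Proof.
have S : injective succ by move=> a b /addIr.
by split; do ?[apply: lift2_inj]; do ?[apply: lift1_inj].
Qed.

Lemma sum_indicator (a : Z) : (\sum_(x : Z) (succ x == a) = 1)%N.
Proof.
rewrite (bigD1 (a - 1)) //= /succ subrK eqxx big1 // => x xa.
by rewrite eq_sym -subr_eq eq_sym (negPf xa).
Qed.

Lemma card_Z : #|Z| = M.
Proof. by rewrite card_ord Zp_cast. Qed.

Lemma sum_non_indicator (a : Z) : (\sum_(x : Z) (succ x != a) = M - 1)%N.
Proof.
have : (\sum_(x : Z) ((succ x == a) + (succ x != a)) = #|Z|)%N.
  by rewrite -sum1_card; apply: eq_bigr => x _; case: eqP.
rewrite big_split /= sum_indicator card_Z => H.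
by apply: (@addnI 1%N); rewrite H subnKC // ltnW.
Qed.

Lemma ham_col4 : ham col4.
Proof.
have [i1 i2 i3] := E_inj.
have phiD p x : phi3 (D4 p x) = phi3 x + 1.
  by case: p => [|p]; apply: phi3E; rewrite !inE eqxx ?orbT.
have Dinj p : injective (D4 p) by case: p.
have condD p x : cond4 p (D4 p x) = cond4 p x by case: p => [|[|p]].
have late p y : (2 <= p)%N -> cond4 p y = false by case: p => [|[|p]].
apply: (ham_merged (M := M)) => //.
- exact: (visit_inj (Hh true) (ih true) phiD Dinj condD).
- move=> z; apply: (@visit_cl _ _ _ phi3 (h true) (i true) cond4 D4 _ (fun x : V => x.2.1)).
  by case=> [|[|p]] [a [b c]].
pose e (c : Z) (s : Z * Z) : V := (s.1, (c, s.2)).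
pose b (c : Z) := skew succ succ (fun a : Z => (succ a != c) : nat).
move=> [x w] [x' w'].
apply: (visit_connected M1 (Hh true) (ih true) phiD Dinj condD
  (cl := fun x : V => x.2.1) (e := e) (st := fun x => (x.1, x.2.2)) (b := b)
  (u := fun=> (M * (M - 2) + 1)%N)) => //.
- by move=> [? [? ?]].
- by case=> [|p] x0.
- move=> c [a d]; have := @tour_late _ cond4 D4 2 (M - 2) (e c (a, d)) late.
  rewrite subnK ?(ltnW (ltnW M4)) // => -[-> _]; rewrite /= /side /= /b /skew /e /=.
  by case: (_ == c).
- move=> c; apply: ham_skew; [exact: ham_succ|exact: ham_succ|].
  rewrite sum_non_indicator.
  by rewrite card_Z subn1 -{2}(prednK (ltnW M1)) coprimenS.
move=> c.
rewrite (eq_bigr (fun s : Z * Z => (M - 2) + (succ s.1 == c))%N); last first.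
  move=> [a d] _; have := @tour_late _ cond4 D4 2 (M - 2) (e c (a, d)) late.
  rewrite subnK ?(ltnW (ltnW M4)) // => -[_ ->]; rewrite /= /side /= negbK addnC.
  by [].
rewrite big_split /= sum_nat_const card_prod card_Z.
rewrite -(pair_bigA _ (fun a d : Z => (succ a == c) : nat)) /=.
rewrite (eq_bigr (fun a : Z => M * (succ a == c))%N); last first.
  by move=> a _; rewrite sum_nat_const card_Z.
by rewrite -big_distrr /= sum_indicator; clear; lia.
Qed.

Lemma ham_col5 : ham col5.
Proof.
have [i1 i2 i3] := E_inj.
have phiD p x : phi3 (D5 p x) = phi3 x + 1.
  by case: p => [|p]; apply: phi3E; rewrite !inE eqxx ?orbT.
have Dinj p : injective (D5 p) by case: p.
have condD p x : cond5 p (D5 p x) = cond5 p x by case: p => [|[|p]].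
have late p y : (2 <= p)%N -> cond5 p y = false by case: p => [|[|p]].
apply: (ham_merged (M := M)) => //.
- exact: (visit_inj (Hh false) (ih false) phiD Dinj condD).
- move=> z; apply: (@visit_cl _ _ _ phi3 (h false) (i false) cond5 D5 _ (fun x : V => x.1)).
  by case=> [|[|p]] [a [b c]].
pose e (c : Z) (s : Z * Z) : V := (c, s).
pose b (c : Z) := skew succ succ (fun a : Z => (succ a == c) : nat).
move=> [x w] [x' w'].
apply: (visit_connected M1 (Hh false) (ih false) phiD Dinj condD
  (cl := fun x : V => x.1) (e := e) (st := fun x => x.2) (b := b)
  (u := fun=> (M * (M - 2) + (M - 1))%N)) => //.
- by move=> [? ?].
- by case=> [|p] x0.
- move=> c [a d]; have := @tour_late _ cond5 D5 2 (M - 2) (e c (a, d)) late.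
  rewrite subnK ?(ltnW (ltnW M4)) // => -[-> _].
  by rewrite /= /side /= negbK /b /skew /e /= eq_sym; case: (_ == c).
- move=> c; apply: ham_skew; [exact: ham_succ|exact: ham_succ|].
  by rewrite sum_indicator coprime1n.
move=> c.
rewrite (eq_bigr (fun s : Z * Z => (M - 2) + (succ s.1 != c))%N); last first.
  move=> [a d] _; have := @tour_late _ cond5 D5 2 (M - 2) (e c (a, d)) late.
  rewrite subnK ?(ltnW (ltnW M4)) // => -[_ ->].
  by rewrite /= /side /= negbK eq_sym addnC.
rewrite big_split /= sum_nat_const card_prod card_Z.
rewrite -(pair_bigA _ (fun a d : Z => (succ a != c) : nat)) /=.
rewrite (eq_bigr (fun a : Z => M * (succ a != c))%N); last first.
  by move=> a _; rewrite sum_nat_const card_Z.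
by rewrite -big_distrr /= sum_non_indicator; clear; lia.
Qed.

Lemma five_recolour :
  recolour [:: lift1 E1; lift1 E2; lift1 E3; lift2 (h true); lift2 (h false)]
       [:: col1; col2; col3; col4; col5].
Proof.
move=> [x w].
have [/eqP on|off] := boolP ((x, w) == pt4 x.2.1).
  move: x on => [a [b c]] [] /= -> -> ->.
  have w01n : w0 == w1 = false.
    by apply/negbTE; apply: (@w01 _ M 2 _ i) => //.
  have pp k : phi3 (- b, (b, 0)) + i k w0 = 0 by rewrite i0 /phi3 /=; ring.
  have c1 : col1 (- b, (b, 0), w0) = ((- b, (b, 0)), h true w0).
    by rewrite /col1 /excursion /leaves /= pp eqxx.
  have c2 : col2 (- b, (b, 0), w0) = ((- b, (b, 0)), h false w0).
    by rewrite /col2 /excursion /leaves /= pp eqxx.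
  have c3 : col3 (- b, (b, 0), w0) = (E3 (- b, (b, 0)), w0).
    have p0 : phi3 (- b, (b, 0)) = 0 by rewrite /phi3 /=; ring.
    have L : leaves phi3 i side (fun=> 1%N) ((- b, (b, 0)), w0) = false.
      by rewrite (leaves0 r0 rM phi3 side _ i0) // p0.
    have B : boxed 2 phi3 w0 w1 ((- b, (b, 0)), w0) = false.
      by rewrite (boxed0 r0 phi3 i0 i1l) p0.
    by rewrite /col3 /excursion L B.
  have c4 : col4 (- b, (b, 0), w0) = (E2 (- b, (b, 0)), w0).
    have -> : col4 ((- b, (b, 0)), w0) = vis4 (pt4 (b + 1)) by rewrite /col4 /merged /= eqxx.
    rewrite /vis4 visitE (_ : phi3 _ + _ = 0); last by rewrite i0 /phi3 /=; ring.
    by congr ((_,_),_); rewrite opprD /= /succ addrNK.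
  have c5 : col5 (- b, (b, 0), w0) = (E1 (- b, (b, 0)), w0).
    have -> : col5 ((- b, (b, 0)), w0) = vis5 (pt5 (- b + 1)).
      by rewrite /col5 /merged /= /pt5 opprK eqxx.
    rewrite /vis5 visitE (_ : phi3 _ + _ = 0); last by rewrite i0 /phi3 /=; ring.
    by congr ((_, (_, _)), _); rewrite opprD opprK /= /succ addrNK.
  by rewrite /= c1 c2 c3 c4 c5; apply: perm_line.
have c4 : col4 (x, w) = vis4 (x, w) by rewrite /col4 /merged /= (negPf off).
have c5 : col5 (x, w) = vis5 (x, w).
  rewrite /col5 /merged /=; case: eqP => // on; case/eqP: off.
  by clear c4; move: x on => [a [b c]] [] /= -> -> ->; rewrite /pt4 /= opprK.
rewrite /= c4 c5 /col1 /col2 /col3 /excursion.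
set B1 := boxed _ _ _ _ _; have EB : B1 = boxed 2 phi3 w0 w1 (x, w) by [].
set L1 := leaves _ _ _ _ _; set L2 := leaves _ _ _ _ _; set L3 := leaves _ _ _ _ _.
have EL1 : L1 = (val (phi3 x + i true w) == 0%N) by rewrite val_Zp_eq // ltnW.
have EL2 : L2 = (val (phi3 x + i false w) == 0%N) by rewrite val_Zp_eq // ltnW.
have EL3 : L3 = (val (phi3 x + i (side x) w) == 1%N) by rewrite val_Zp_eq.
rewrite /vis4 /vis5 /visit ![(x, w).1]/= ![(x, w).2]/=.
have [B|NB] := boolP B1.
  have l1 : L1 = false by apply: (boxed_stays _ r0 rM _ i0 i1l i1u B).
  have l2 : L2 = false by apply: (boxed_stays _ r0 rM _ i0 i1l i1u B).
  have l3 : L3 = false by apply: (boxed_stays _ r0 rM _ i0 i1l i1u B).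
  rewrite l1 l2 l3 /=.
  have -> : cond4 (val (phi3 x + i true w)) x = false.
    move: EL1 EL3; rewrite l1 l3 /cond4; case: (side x); move: (val (phi3 x + i true w)).
      by case=> [|[|p]].
    by case=> [|[|p]].
  have -> : cond5 (val (phi3 x + i false w)) x = false.
    move: EL2 EL3; rewrite l2 l3 /cond5; case: (side x); move: (val (phi3 x + i false w)).
      by case=> [|[|p]].
    by case=> [|[|p]].
  have := perm_cat (perm_map (fun y => (y, w)) (box x))
    (perm_refl [:: (x, h true w); (x, h false w)]).
  by apply.
apply/permP => P.
move: EL1 EL2 EL3; rewrite /cond4 /cond5; case: (side x).
  move: (val (phi3 x + i true w)) (val (phi3 x + i false w)) => p q -> -> ->.
  by case: p => [|[|p]]; case: q => [|[|q]]; rewrite /= ?(negPf NB) /= /lift1 /lift2 /=; clear; lia.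
move: (val (phi3 x + i true w)) (val (phi3 x + i false w)) => p q -> -> ->.
by case: p => [|[|p]]; case: q => [|[|q]]; rewrite /= ?(negPf NB) /= /lift1 /lift2 /=; clear; lia.
Qed.

Lemma decomp_three_two : decomp [:: lift1 E1; lift1 E2; lift1 E3; lift2 (h true); lift2 (h false)].
Proof.
exists [:: col1; col2; col3; col4; col5]; first exact: five_recolour.
by rewrite /= ham_col1 ham_col2 ham_col3 ham_col4 ham_col5.
Qed.
End Five.

Local Close Scope ring_scope.

(** * Five axes and two further cycles *)

Local Open Scope ring_scope.

Lemma coprime_pred_mul k M : (0 < k)%N -> (0 < M)%N -> coprime (k * M).-1 M.
Proof.
move=> k0 M0; apply: (coprime_dvdr (dvdn_mull k (dvdnn M))).
by rewrite coprimePn // muln_gt0 k0.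
Qed.

Lemma perm_line7 (T : eqType) (a b c d e f g : T) :
  perm_eq [:: a; b; c; d; e; f; g] [:: f; g; c; d; e; b; a].
Proof. by apply/permP => P /=; clear; lia. Qed.

Section Seven.
Variables (M : nat) (W : finType) (h : bool -> W -> W) (i : bool -> W -> 'Z_M).
Variables (w0 w1 : W).
Hypotheses (M6 : (5 < M)%N) (Hh : forall k, ham (h k)).
Hypotheses (ih : forall k w, i k (h k w) = i k w + 1).
Hypotheses (i0 : forall k, i k w0 = 0).
Hypotheses (i1l : forall k, (3 <= val (i k w1))%N) (i1u : forall k, (val (i k w1) <= M - 3)%N).
Hypotheses (cp1 : coprime (M ^ 3 * (M - 3) + M ^ 2 + (M - 1) * (M ^ 2 - 1)) #|W|).
Hypotheses (cp2 : coprime (M ^ 3 * (M - 3) + (M - 1)) #|W|).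
Local Notation Z := 'Z_M.
Local Notation V := (tor M 5).
Let M4 : (3 < M)%N. Proof. exact: leq_trans M6. Qed.
Let M1 : (1 < M)%N. Proof. exact: leq_trans M6. Qed.
Let r0 : (0 < 3)%N. Proof. by []. Qed.
Let rM : (3 + 3 <= M)%N. Proof. by []. Qed.
Local Notation succ := (@succ M).

Definition F1 : V -> V := lift1 succ.
Definition F2 : V -> V := lift2 (lift1 succ).
Definition F3 : V -> V := lift2 (lift2 (lift1 succ)).
Definition F4 : V -> V := lift2 (lift2 (lift2 (lift1 succ))).
Definition F5 : V -> V := lift2 (lift2 (lift2 (lift2 (lift1 succ)))).
Definition phi5 (x : V) : Z := x.1 + x.2.1 + x.2.2.1 + x.2.2.2.1 + x.2.2.2.2.1.

Variables B1 B2 B3 B4 B5 : V -> V.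
Hypotheses (HB : all (@ham V) [:: B1; B2; B3; B4; B5]).
Hypothesis box : recolour [:: F1; F2; F3; F4; F5] [:: B1; B2; B3; B4; B5].

Lemma phi5F x y : y \in [:: F1 x; F2 x; F3 x; F4 x; F5 x] -> phi5 y = phi5 x + 1.
Proof.
case: x => [a [b [c [d [e []]]]]]; rewrite !inE /phi5.
by case/or4P => [||| /orP[]] /eqP -> /=; rewrite /succ; ring.
Qed.

Lemma phi5B x y : y \in [:: B1 x; B2 x; B3 x; B4 x; B5 x] -> phi5 y = phi5 x + 1.
Proof. by move=> m; apply: phi5F; have /perm_mem -> := box x. Qed.

Lemma F_order x : [/\ iter M F1 x = x, iter M F2 x = x, iter M F3 x = x,
  iter M F4 x = x & iter M F5 x = x].
Proof.
by split; move: x; do ?[apply: iter_lift2]; apply: iter_lift1 => x; apply: iter_M.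
Qed.

Definition apart (x : V) := x.1 != x.2.1.
Definition zero3 (x : V) := x.2.2.1 == 0.
Definition zero4 (x : V) := x.2.2.2.1 == 0.

(** As for three axes, colours 1 and 2 leave at phase 0 and colour 3 at phase 1. Colours 4
and 5 leave at phase 1 or 2. The cases are chosen such that at every point each phase of
h true and of h false is used by at most one colour, and that the steps received by
colours 6 and 7 form iterated skew products with totals prime to M. *)
Definition kk4 x := ~~ apart x && zero3 x.
Definition rho4 x := if apart x then 1%N else 2.
Definition kk5 x := if apart x then zero3 x && zero4 x else ~~ zero3 x.

Definition out1 := excursion 3 F1 B1 phi5 h i (fun=> true) (fun=> 0%N) w0 w1.
Definition out2 := excursion 3 F2 B2 phi5 h i (fun=> false) (fun=> 0%N) w0 w1.
Definition out3 := excursion 3 F3 B3 phi5 h i apart (fun=> 1%N) w0 w1.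
Definition out4 := excursion 3 F4 B4 phi5 h i kk4 rho4 w0 w1.
Definition out5 := excursion 3 F5 B5 phi5 h i kk5 (fun=> 2%N) w0 w1.

Lemma ham_out : all (@ham (V * W)%type) [:: out1; out2; out3; out4; out5].
Proof.
have /and5P[h1 h2 h3 h4 /andP[h5 _]] := HB.
apply/and5P; split; last (apply/andP; split => //);
  apply: (ham_excursion r0 rM (phi := phi5)) => //;
  try (by move=> x; have [] := F_order x);
  try (by move=> x; apply: phi5F; rewrite !inE eqxx ?orbT);
  try (by move=> x; apply: phi5B; rewrite !inE eqxx ?orbT).
by move=> x; rewrite /rho4; case: ifP.
Qed.

Definition condA p x := match p with
  0%N => true | 1%N => apart x | 2 => ~~ apart x || zero3 x && zero4 x | _ => false end.
Definition condB p x := match p with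
  0%N | 1%N => true | 2 => ~~ apart x || ~~ (zero3 x && zero4 x) | _ => false end.
Definition stepA p x := match p with
  0%N => F1 x | 1%N => F3 x | _ => if ~~ apart x && zero3 x then F4 x else F5 x end.
Definition stepB p x := match p with
  0%N => F2 x | 1%N => if apart x then F4 x else F3 x
  | _ => if ~~ apart x && ~~ zero3 x then F4 x else F5 x end.

Lemma F_inj : [/\ injective F1, injective F2, injective F3, injective F4 & injective F5].
Proof.
have S : injective succ by move=> a b /addIr.
by split; do ?[apply: lift2_inj]; apply: lift1_inj.
Qed.

Lemma glue_inj (T : Type) (c : pred T) (f g : T -> T) :
  injective f -> injective g -> (forall x, c (f x) = c x) -> (forall x, c (g x) = c x) ->
  injective (fun x => if c x then f x else g x).
Proof.
move=> fI gI cf cg x y; case: ifP => cx; case: ifP => cy E.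
- exact: fI.
- by have := cf x; rewrite E cg cx cy.
- by have := cg x; rewrite E cf cx cy.
exact: gI.
Qed.

(** The classes of colours 6 and 7 are merged by an exchange of F1 and F2 along a line
over w0. *)
Definition visA := visit phi5 (h true) (i true) condA stepA.
Definition visB := visit phi5 (h false) (i false) condB stepB.
Definition ptA (a : Z) : V * W := ((- a, (a, (0, (0, (0, tt))))), w0).
Definition ptB (a : Z) : V * W := ((a, (- a, (0, (0, (0, tt))))), w0).
Definition out6 := merged visA (fun z => z.1.2.1) ptA.
Definition out7 := merged visB (fun z => z.1.1) ptB.

Lemma stepA_phi p x : phi5 (stepA p x) = phi5 x + 1.
Proof.
by case: p => [|[|p]] /=; last case: ifP => _; apply: phi5F; rewrite !inE eqxx ?orbT.
Qed.
Lemma stepB_phi p x : phi5 (stepB p x) = phi5 x + 1.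
Proof.
by case: p => [|[|p]] /=; last (case: ifP => _); first (by apply: phi5F; rewrite !inE eqxx ?orbT);
  try (case: ifP => _); apply: phi5F; rewrite !inE eqxx ?orbT.
Qed.
Lemma stepA_inj p : injective (stepA p).
Proof.
have [f1 f2 f3 f4 f5] := F_inj.
by case: p => [|[|p]] //=; apply: (glue_inj (c := fun x => ~~ apart x && zero3 x)).
Qed.
Lemma stepB_inj p : injective (stepB p).
Proof.
have [f1 f2 f3 f4 f5] := F_inj; case: p => [|[|p]] //=; first exact: glue_inj.
exact: (glue_inj (c := fun x => ~~ apart x && ~~ zero3 x)).
Qed.
Lemma stepA_cond p x : condA p (stepA p x) = condA p x.
Proof.
case: p => [|[|[|p]]] //=; case: x => [a [b [c [d [e []]]]]].
by rewrite /apart /zero3 /zero4 /=; case ab: (a == b); case c0: (c == 0); rewrite /= ?ab ?c0 //=.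
Qed.
Lemma stepB_cond p x : condB p (stepB p x) = condB p x.
Proof.
case: p => [|[|[|p]]] //=; case: x => [a [b [c [d [e []]]]]].
by rewrite /apart /zero3 /zero4 /=; case ab: (a == b); case c0: (c == 0); rewrite /= ?ab ?c0 //=.
Qed.

Lemma sum_zero (a : Z) : (\sum_(x : Z) (x == a) = 1)%N.
Proof. by rewrite (bigD1 a) //= eqxx big1 // => x /negPf ->. Qed.
Lemma sum_nonzero (a : Z) : (\sum_(x : Z) (x != a) = M - 1)%N.
Proof.
have sI : injective succ by move=> x y /addIr.
by rewrite -(sum_non_indicator M4 a); apply: (reindex_inj sI).
Qed.
Lemma sum_pair (T U : finType) (F : T -> nat) (G : U -> nat) :
  (\sum_(z : T * U) F z.1 * G z.2 = (\sum_x F x) * (\sum_y G y))%N.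
Proof. by rewrite big_distrlr -(pair_bigA _ (fun x y => F x * G y)%N). Qed.
Lemma sum_fst (T : finType) (F : T -> nat) : (\sum_(z : T * Z) F z.1 = (\sum_x F x) * M)%N.
Proof.
rewrite -[X in (_ * X)%N](card_Z M4) -sum1_card -(sum_pair F (fun=> 1%N)).
by apply: eq_bigr => z _; rewrite muln1.
Qed.

Local Notation T2 := (Z * Z)%type.
Local Notation T3 := (Z * Z * Z)%type.
Local Notation T4 := (Z * Z * Z * Z)%type.

(** The movement of x3, x4, x5 during a tour of colour 6 in the class x2 = c. *)
Definition gA3 (c : Z) (a : Z) : nat := succ a != c.
Definition gA4 (c : Z) (s : T2) : nat := (succ s.1 == c) * (s.2 == 0%R).
Definition gA5 (c : Z) (s : T3) : nat :=
  (succ s.1.1 != c) * (succ s.1.2 == 0%R) * (s.2 == 0%R) + (succ s.1.1 == c) * (s.1.2 != 0%R).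
Definition loopA (c : Z) : T4 -> T4 := skew (skew (skew succ succ (gA3 c)) succ (gA4 c)) succ (gA5 c).

Lemma ham_loopA c : ham (loopA c).
Proof.
have S := ham_succ M1.
have cM k : coprime k M -> coprime k #|Z| by rewrite card_Z.
have H3 : ham (skew succ succ (gA3 c)).
  by apply: ham_skew => //; apply: cM; rewrite (sum_non_indicator M4) subn1 coprimePn // ltnW.
have H4 : ham (skew (skew succ succ (gA3 c)) succ (gA4 c)).
  apply: ham_skew => //; apply: cM.
  rewrite (sum_pair (fun a : Z => (succ a == c) : nat) (fun b : Z => (b == 0) : nat)).
  by rewrite sum_indicator sum_zero mul1n coprime1n.
apply: ham_skew => //; apply: cM.
rewrite big_split /=.
rewrite (sum_pair (fun s : T2 => (succ s.1 != c) * (succ s.2 == 0%R))%N (fun b : Z => (b == 0) : nat)).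
rewrite (sum_pair (fun a : Z => (succ a != c) : nat) (fun a : Z => (succ a == 0) : nat)).
rewrite (sum_fst (fun s : T2 => (succ s.1 == c) * (s.2 != 0%R))%N).
rewrite (sum_pair (fun a : Z => (succ a == c) : nat) (fun a : Z => (a != 0) : nat)).
rewrite !sum_indicator !(sum_non_indicator M4) sum_nonzero sum_zero.
have -> : ((M - 1) * 1 * 1 + 1 * (M - 1) * M = (M * M).-1)%N by move: M1; clear; nia.
by apply: coprime_pred_mul; rewrite // ltnW.
Qed.

Definition at_A (c : Z) (s : T4) : V := (s.1.1.1, (c, (s.1.1.2, (s.1.2, (s.2, tt))))).
Definition of_A (x : V) : T4 := (((x.1, x.2.2.1), x.2.2.2.1), x.2.2.2.2.1).
Definition at_B (c : Z) (s : T4) : V := (c, (s.1.1.1, (s.1.1.2, (s.1.2, (s.2, tt))))).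
Definition of_B (x : V) : T4 := (((x.2.1, x.2.2.1), x.2.2.2.1), x.2.2.2.2.1).

Lemma tour_A c s : tour condA stepA M (at_A c s) = at_A c (loopA c s) /\
 stays condA stepA M (at_A c s) = ((M - 3) + (succ s.1.1.1 == c)
   + (succ s.1.1.1 != c) * ((succ s.1.1.2 == 0%R) * (s.1.2 != 0%R) + (succ s.1.1.2 != 0%R)))%N.
Proof.
case: s => [[[a x] y] z].
have late p u : (3 <= p)%N -> condA p u = false by case: p => [|[|[|p]]].
have := @tour_late _ condA stepA 3 (M - 3) (at_A c (((a, x), y), z)) late.
rewrite subnK ?(ltnW M4) // => -[-> ->].
rewrite /= /apart /zero3 /zero4 /loopA /gA3 /gA4 /gA5 /skew /at_A /=.
case ac: (succ a == c); rewrite /= ?ac /=.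
  case x0: (x == 0); rewrite /= !(mul1n, mul0n) /=; split=> //; clear; lia.
case x0: (succ x == 0); case y0: (y == 0); rewrite /= !(mul1n, mul0n) /= ?addn0 /=; split=> //; clear; lia.
Qed.

Lemma M_sub : exists k, [/\ M = k.+3, M - 3 = k, M - 1 = k.+2 & M ^ 2 - 1 = k.+2 * k.+4]%N.
Proof.
exists (M - 3)%N; split; try (by move: M6; clear; lia).
Qed.

Lemma total_A c : (\sum_s stays condA stepA M (at_A c s) =
  M * (M ^ 3 * (M - 3) + M ^ 2 + (M - 1) * (M ^ 2 - 1)))%N.
Proof.
rewrite (eq_bigr (fun s : T4 => (M - 3) + (succ s.1.1.1 == c)
   + ((succ s.1.1.1 != c) * (succ s.1.1.2 == 0%R) * (s.1.2 != 0%R)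
   + (succ s.1.1.1 != c) * (succ s.1.1.2 != 0%R)))%N); last first.
  by move=> s _; rewrite (tour_A c s).2 mulnDr mulnA.
rewrite !big_split /= sum_nat_const !card_prod !(card_Z M4).
rewrite (sum_fst (fun s : T3 => (succ s.1.1 == c) : nat)) (sum_fst (fun s : T2 => (succ s.1 == c) : nat)).
rewrite (sum_fst (fun a : Z => (succ a == c) : nat)).
rewrite (sum_fst (fun s : T3 => (succ s.1.1 != c) * (succ s.1.2 == 0%R) * (s.2 != 0%R))%N).
rewrite (sum_pair (fun s : T2 => (succ s.1 != c) * (succ s.2 == 0%R))%N (fun b : Z => (b != 0) : nat)).
rewrite (sum_pair (fun a : Z => (succ a != c) : nat) (fun a : Z => (succ a == 0) : nat)).
rewrite (sum_fst (fun s : T3 => (succ s.1.1 != c) * (succ s.1.2 != 0%R))%N).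
rewrite (sum_fst (fun s : T2 => (succ s.1 != c) * (succ s.2 != 0%R))%N).
rewrite (sum_pair (fun a : Z => (succ a != c) : nat) (fun a : Z => (succ a != 0) : nat)).
rewrite !sum_indicator !(sum_non_indicator M4) sum_nonzero.
by have [k [M_k e3 e1 e2]] := M_sub; rewrite ?e2 ?e3 ?e1 M_k; clear; ring.
Qed.

(** The movement of x3, x4, x5 during a tour of colour 7 in the class x1 = c. *)
Definition gB3 (c : Z) (b : Z) : nat := succ b == c.
Definition gB4 (c : Z) (s : T2) : nat := (succ s.1 != c) + (succ s.1 == c) * (succ s.2 != 0%R).
Definition gB5 (c : Z) (s : T3) : nat :=
  (succ s.1.1 != c) * (s.1.2 == 0%R) * (succ s.2 != 0%R) + (succ s.1.1 != c) * (s.1.2 != 0%R)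
  + (succ s.1.1 == c) * (succ s.1.2 == 0%R).
Definition loopB (c : Z) : T4 -> T4 := skew (skew (skew succ succ (gB3 c)) succ (gB4 c)) succ (gB5 c).

Lemma ham_loopB c : ham (loopB c).
Proof.
have S := ham_succ M1.
have cM k : coprime k M -> coprime k #|Z| by rewrite card_Z.
have H3 : ham (skew succ succ (gB3 c)).
  by apply: ham_skew => //; apply: cM; rewrite sum_indicator coprime1n.
have H4 : ham (skew (skew succ succ (gB3 c)) succ (gB4 c)).
  apply: ham_skew => //; apply: cM; rewrite big_split /=.
  rewrite (sum_fst (fun a : Z => (succ a != c) : nat)).
  rewrite (sum_pair (fun a : Z => (succ a == c) : nat) (fun b : Z => (succ b != 0) : nat)).
  rewrite sum_indicator !(sum_non_indicator M4).
  have -> : ((M - 1) * M + 1 * (M - 1) = (M * M).-1)%N by move: M1; clear; nia.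
  by apply: coprime_pred_mul; rewrite // ltnW.
apply: ham_skew => //; apply: cM; rewrite !big_split /=.
rewrite (sum_pair (fun s : T2 => (succ s.1 != c) * (s.2 == 0%R))%N (fun b : Z => (succ b != 0) : nat)).
rewrite (sum_pair (fun a : Z => (succ a != c) : nat) (fun a : Z => (a == 0) : nat)).
rewrite (sum_fst (fun s : T2 => (succ s.1 != c) * (s.2 != 0%R))%N).
rewrite (sum_pair (fun a : Z => (succ a != c) : nat) (fun a : Z => (a != 0) : nat)).
rewrite (sum_fst (fun s : T2 => (succ s.1 == c) * (succ s.2 == 0%R))%N).
rewrite (sum_pair (fun a : Z => (succ a == c) : nat) (fun a : Z => (succ a == 0) : nat)).
rewrite !sum_indicator !(sum_non_indicator M4) sum_nonzero sum_zero.
have -> : ((M - 1) * 1 * (M - 1) + (M - 1) * (M - 1) * M + 1 * 1 * M = (M * (M - 1)) * M + 1)%N.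
  by have [k [M_k e3 e1 e2]] := M_sub; rewrite ?e2 ?e3 ?e1 M_k; clear; ring.
by rewrite coprime_sym /coprime gcdnMDl gcdn1.
Qed.

Lemma tour_B c s : tour condB stepB M (at_B c s) = at_B c (loopB c s) /\
 stays condB stepB M (at_B c s) =
   ((M - 3) + (succ s.1.1.1 != c) * (s.1.1.2 == 0%R) * (succ s.1.2 == 0%R))%N.
Proof.
case: s => [[[a x] y] z].
have late p u : (3 <= p)%N -> condB p u = false by case: p => [|[|[|p]]].
have := @tour_late _ condB stepB 3 (M - 3) (at_B c (((a, x), y), z)) late.
rewrite subnK ?(ltnW M4) // => -[-> ->].
rewrite /= /apart /zero3 /zero4 /loopB /gB3 /gB4 /gB5 /skew /at_B /= ![c == _]eq_sym.
case ac: (succ a == c); rewrite /= ?[c == _]eq_sym ?ac /=.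
  case x0: (succ x == 0); rewrite /= !(mul1n, mul0n) /=; split=> //; clear; lia.
case x0: (x == 0); case y0: (succ y == 0); rewrite /= !(mul1n, mul0n) /= ?addn0 /=; split=> //; clear; lia.
Qed.

Lemma total_B c : (\sum_s stays condB stepB M (at_B c s) =
  M * (M ^ 3 * (M - 3) + (M - 1)))%N.
Proof.
rewrite (eq_bigr (fun s : T4 => (M - 3) +
   (succ s.1.1.1 != c) * (s.1.1.2 == 0%R) * (succ s.1.2 == 0%R))%N); last first.
  by move=> s _; rewrite (tour_B c s).2.
rewrite !big_split /= sum_nat_const !card_prod !(card_Z M4).
rewrite (sum_fst (fun s : T3 => (succ s.1.1 != c) * (s.1.2 == 0%R) * (succ s.2 == 0%R))%N).
rewrite (sum_pair (fun s : T2 => (succ s.1 != c) * (s.2 == 0%R))%N (fun b : Z => (succ b == 0) : nat)).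
rewrite (sum_pair (fun a : Z => (succ a != c) : nat) (fun a : Z => (a == 0) : nat)).
rewrite !sum_indicator !(sum_non_indicator M4) sum_zero.
by have [k [M_k e3 e1 e2]] := M_sub; rewrite ?e2 ?e3 ?e1 M_k; clear; ring.
Qed.

Lemma ham_out6 : ham out6.
Proof.
have clA p x : condA p x -> (stepA p x).2.1 = x.2.1.
  by case: p => [|[|p]] //= _; case: ifP.
apply: (ham_merged (M := M)) => //.
- exact: (visit_inj (Hh true) (ih true) stepA_phi stepA_inj stepA_cond).
- by move=> z; apply: (@visit_cl _ _ _ phi5 (h true) (i true) condA stepA _ (fun x : V => x.2.1)).
move=> [x w] [x' w'].
apply: (visit_connected M1 (Hh true) (ih true) stepA_phi stepA_inj stepA_cond
  (cl := fun x : V => x.2.1) (e := at_A) (st := of_A) (b := loopA)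
  (u := fun=> (M ^ 3 * (M - 3) + M ^ 2 + (M - 1) * (M ^ 2 - 1))%N)) => //.
- by move=> [a [b [y [z [t []]]]]].
- by move=> c s; case: (tour_A c s).
- exact: ham_loopA.
exact: total_A.
Qed.

Lemma ham_out7 : ham out7.
Proof.
have clB p x : condB p x -> (stepB p x).1 = x.1.
  by case: p => [|[|p]] //= _; case: ifP.
apply: (ham_merged (M := M)) => //.
- exact: (visit_inj (Hh false) (ih false) stepB_phi stepB_inj stepB_cond).
- by move=> z; apply: (@visit_cl _ _ _ phi5 (h false) (i false) condB stepB _ (fun x : V => x.1)).
move=> [x w] [x' w'].
apply: (visit_connected M1 (Hh false) (ih false) stepB_phi stepB_inj stepB_cond
  (cl := fun x : V => x.1) (e := at_B) (st := of_B) (b := loopB)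
  (u := fun=> (M ^ 3 * (M - 3) + (M - 1))%N)) => //.
- by move=> [a [b [y [z [t []]]]]].
- by move=> c s; case: (tour_B c s).
- exact: ham_loopB.
exact: total_B.
Qed.

Lemma out_line b (z := ((- b, (b, (0, (0, (0, tt)))), w0) : V * W)) :
  [/\ out1 z = (z.1, h true w0), out2 z = (z.1, h false w0), out3 z = (F3 z.1, w0),
      out4 z = (F4 z.1, w0) & out5 z = (F5 z.1, w0)] /\
  out6 z = (F2 z.1, w0) /\ out7 z = (F1 z.1, w0).
Proof.
have p0 : phi5 z.1 = 0 by rewrite /phi5 /=; ring.
have NB : boxed 3 phi5 w0 w1 z = false.
  by rewrite /z (boxed0 r0 phi5 i0 i1l) -/(z.1) p0.
have L kk rho : (forall x, (rho x < 3)%N) -> leaves phi5 i kk rho z = (0%N == rho z.1).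
  by move=> H; rewrite /z (leaves0 r0 rM phi5 kk H i0) -/(z.1) p0.
have r2 x : (rho4 x < 3)%N by rewrite /rho4; case: ifP.
have N4 : (0%N == rho4 z.1) = false by rewrite /rho4; case: ifP.
split.
  by split; rewrite /out1 /out2 /out3 /out4 /out5 /excursion ?L // ?N4 NB.
split.
  have -> : out6 z = visA (ptA (b + 1)) by rewrite /out6 /merged /= eqxx.
  rewrite /visA visitE (_ : phi5 _ + _ = 0); last by rewrite i0 /phi5 /=; ring.
  by congr ((_, _), _); rewrite opprD /= /succ addrNK.
have -> : out7 z = visB (ptB (- b + 1)) by rewrite /out7 /merged /= /ptB opprK eqxx.
rewrite /visB visitE (_ : phi5 _ + _ = 0); last by rewrite i0 /phi5 /=; ring.
by congr ((_, (_, _)), _); rewrite opprD opprK /= /succ addrNK.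
Qed.

Lemma seven_recolour :
  recolour [:: lift1 F1; lift1 F2; lift1 F3; lift1 F4; lift1 F5; lift2 (h true); lift2 (h false)]
       [:: out1; out2; out3; out4; out5; out6; out7].
Proof.
move=> [x w].
have [/eqP on|off] := boolP ((x, w) == ptA x.2.1).
  move: x on => [a [b [c [d [e []]]]]] [] /= -> -> -> -> ->.
  have [[e1 e2 e3 e4 e5] [e6 e7]] := out_line b.
  by rewrite /= e1 e2 e3 e4 e5 e6 e7; apply: perm_line7.
have e6 : out6 (x, w) = visA (x, w) by rewrite /out6 /merged /= (negPf off).
have e7 : out7 (x, w) = visB (x, w).
  rewrite /out7 /merged /=; case: eqP => // on; case/eqP: off; clear e6.
  by move: x on => [a [b [c [d [e []]]]]] [] /= -> -> -> -> ->; rewrite /ptA /= opprK.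
rewrite /= e6 e7 /out1 /out2 /out3 /out4 /out5 /excursion.
set B := boxed _ _ _ _ _.
set L1 := leaves _ _ _ _ _; set L2 := leaves _ _ _ _ _; set L3 := leaves _ _ _ _ _.
set L4 := leaves _ _ _ _ _; set L5 := leaves _ _ _ _ _.
pose p := val (phi5 x + i true w); pose q := val (phi5 x + i false w).
have EL kk rho : (forall y, (rho y < M)%N) ->
    leaves phi5 i kk rho (x, w) = ((if kk x then p else q) == rho x).
  move=> H; rewrite /leaves [(x, w).1]/= [(x, w).2]/= -val_Zp_eq //.
  by case: (kk x).
have M3 : (2 < M)%N by apply: ltnW.
have EL1 : L1 = (p == 0%N) by apply: EL => ?; apply: ltnW.
have EL2 : L2 = (q == 0%N) by apply: EL => ?; apply: ltnW.
have EL3 : L3 = ((if apart x then p else q) == 1%N) by apply: EL.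
have EL4 : L4 = ((if kk4 x then p else q) == rho4 x).
  by apply: EL => y; rewrite /rho4; case: ifP.
have EL5 : L5 = ((if kk5 x then p else q) == 2) by apply: EL.
have r2 y : (rho4 y < 3)%N by rewrite /rho4; case: ifP.
have -> : visA (x, w) = if condA p x then (stepA p x, w) else (x, h true w) by [].
have -> : visB (x, w) = if condB q x then (stepB q x, w) else (x, h false w) by [].
rewrite ![(x, w).1]/= ![(x, w).2]/=.
have [inB|NB] := boolP B.
  have l1 : L1 = false by apply: (boxed_stays _ r0 rM _ i0 i1l i1u inB).
  have l2 : L2 = false by apply: (boxed_stays _ r0 rM _ i0 i1l i1u inB).
  have l3 : L3 = false by apply: (boxed_stays _ r0 rM _ i0 i1l i1u inB).
  have l4 : L4 = false by apply: (boxed_stays _ r0 rM _ i0 i1l i1u inB).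
  have l5 : L5 = false by apply: (boxed_stays _ r0 rM _ i0 i1l i1u inB).
  move: EL1 EL2 EL3 EL4 EL5; rewrite l1 l2 l3 l4 l5 => EL1 EL2 EL3 EL4 EL5.
  have [-> ->] : condA p x = false /\ condB q x = false.
    move: EL1 EL2 EL3 EL4 EL5; rewrite /condA /condB /kk4 /rho4 /kk5; clear.
    case: (apart x); case: (zero3 x); case: (zero4 x); case: p => [|[|[|p]]] //=;
      by case: q => [|[|[|q]]].
  have := perm_cat (perm_map (fun y => (y, w)) (box x))
    (perm_refl [:: (x, h true w); (x, h false w)]).
  by apply.
rewrite EL1 EL2 EL3 EL4 EL5 /condA /condB /stepA /stepB /kk4 /rho4 /kk5.
rewrite /lift1 /lift2 ![(x, w).1]/= ![(x, w).2]/=.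
apply/permP => P; clear.
move: (F1 x) (F2 x) (F3 x) (F4 x) (F5 x) => y1 y2 y3 y4 y5.
by case: (apart x); case: (zero3 x); case: (zero4 x); case: p => [|[|[|p]]];
  case: q => [|[|[|q]]] /=; ring.
Qed.

Lemma decomp_five_two :
  decomp [:: lift1 F1; lift1 F2; lift1 F3; lift1 F4; lift1 F5; lift2 (h true); lift2 (h false)].
Proof.
exists [:: out1; out2; out3; out4; out5; out6; out7]; first exact: seven_recolour.
by move: ham_out; rewrite /= ham_out6 ham_out7 => /and5P[-> -> -> -> /andP[-> _]].
Qed.
End Seven.

Local Close Scope ring_scope.

(** * Three equal cycles, and dimension five *)

Lemma coprime_odd_pred2 M : 1 < M -> odd M -> coprime M.-2 M.
Proof.
case: M => [|[|k]] //= _; rewrite negbK => ok.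
by rewrite -addn2 /coprime gcdnDl -/(coprime k 2) coprimen2.
Qed.

Lemma triple_decomp_all n : 2 < n -> triple_decomp n.
Proof.
move=> n2 K f g h m m0 cK Hf Hg Hh; set M := n ^ m in cK.
have M2 : 2 < M by rewrite (leq_trans n2) // -{1}(expn1 n) leq_exp2l // ltnW.
have [oM|eM] := boolP (odd M); last first.
  apply: (even_box (M := M)) => //.
  by move: M2 eM; rewrite leq_eqVlt => /orP[/eqP <-|].
apply: (odd_box (M := M)) => //.
  by rewrite coprime_sym coprimenP ?(ltn_trans _ M2).
by apply: coprime_odd_pred2; rewrite // ltnW.
Qed.

Lemma card_fiber (T : finType) (f : T -> T) M (i : T -> 'Z_M) a :
  1 < M -> injective f -> (forall x, i (f x) = (i x + 1)%R) ->
  #|[set x | i x == a]| * M = #|T|.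
Proof.
move=> M1 fI ih.
have st b : #|[set x | i x == (b + 1)%R]| = #|[set x | i x == b]|.
  rewrite -(card_preimset _ fI); apply: eq_card => x.
  by rewrite !inE ih (inj_eq (addIr _)).
have all0 (b : 'Z_M) : #|[set x | i x == b]| = #|[set x | i x == 0%R]|.
  rewrite -(natr_Zp b); elim: (val b) => [|k IH]; first by [].
  by rewrite -natr1 st.
rewrite -[RHS]sum1_card (partition_big i predT) //=.
rewrite (eq_bigr (fun=> #|[set x | i x == a]|)); last first.
  by move=> b _; rewrite all0 -(all0 b) -sum1_card; apply: eq_bigl => x; rewrite inE.
have cZ : #|'Z_M| = M by rewrite card_ord Zp_cast.
by rewrite sum_nat_const cZ mulnC.
Qed.

(** The points w0 and w1 are prescribed by their positions on both cycles of W. *)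
Section Quintuple.
Variables (M : nat) (K W : finType) (f : K -> K) (u v : W -> W) (i j : W -> 'Z_M).
Variables w0 w1 : W.
Hypotheses (M4 : 3 < M) (cK : #|K| = M) (Hf : ham f) (Hu : ham u) (Hv : ham v).
Hypotheses (iu : forall w, i (u w) = (i w + 1)%R) (jv : forall w, j (v w) = (j w + 1)%R).
Hypotheses (i0 : i w0 = 0%R) (j0 : j w0 = 0%R).
Hypotheses (i1 : 2 <= val (i w1) <= M - 2) (j1 : 2 <= val (j w1) <= M - 2).
Hypotheses (cp1 : coprime (M * (M - 2) + 1) #|W|) (cp2 : coprime (M * (M - 2) + (M - 1)) #|W|).
Hypothesis box : decomp [:: @lift1 K (K * K)%type f; lift2 (lift1 f); lift2 (lift2 f)].

Lemma decomp_quintuple :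
  decomp [:: @axis1 K W f; @axis2 K W f; @axis3 K W f; @axisW K W u; @axisW K W v].
Proof.
have M1 : 1 < M by apply: leq_trans M4.
have [p [q [pq qp pf]]] := ham_coord M1 cK Hf.
have fq a : f (q a) = q (a + 1)%R by rewrite -{2}(qp a) -pf pq.
have box' : decomp [:: @E1 M; @E2 M; @E3 M].
  apply: (decomp_conj (p := fun x => (p x.1, (p x.2.1, p x.2.2)))
                    (q := fun y => (q y.1, (q y.2.1, q y.2.2)))) box.
  - by move=> [? [? ?]] /=; rewrite !pq.
  - by move=> [? [? ?]] /=; rewrite !qp.
  move=> [a [b c]]; apply: eqP_perm.
  by rewrite /= /E1 /E2 /E3 /lift1 /lift2 /= /succ !pf !qp.
have [|l R [S H]] := decomp_size box'.
  by apply/card_gt0P; exists (0%R, (0%R, 0%R)).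
case: l R S H => [|A1 [|A2 [|A3 [|]]]] //= R _ /and4P[H1 H2 H3 _].
have G := @decomp_three_two M W (fun k => if k then u else v) (fun k => if k then i else j) w0 w1
  M4 _ _ _ _ _ cp1 cp2 A1 A2 A3 H1 H2 H3 R.
have {}G : decomp [:: lift1 (@E1 M); lift1 (@E2 M); lift1 (@E3 M); lift2 u; lift2 v].
  by apply: G; case => //; [case/andP: i1|case/andP: j1|case/andP: i1|case/andP: j1].
apply: (decomp_conj (p := fun z => ((q z.1.1, (q z.1.2.1, q z.1.2.2)), z.2))
                  (q := fun z => ((p z.1.1, (p z.1.2.1, p z.1.2.2)), z.2))) G.
- by move=> [[? [? ?]] ?] /=; rewrite !qp.
- by move=> [[? [? ?]] ?] /=; rewrite !pq.
move=> [[a [b c]] w]; apply: eqP_perm.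
by rewrite /= /axis1 /axis2 /axis3 /axisW /E1 /E2 /E3 /lift1 /lift2 /= /succ -!fq !pq.
Qed.
End Quintuple.

Lemma quintuple_coprime n s w (M := n ^ s) : 2 < n -> 0 < s ->
  coprime (M * (M - 2) + 1) (n ^ w) /\ coprime (M * (M - 2) + (M - 1)) (n ^ w).
Proof.
move=> n2 s0; have nM : n %| M by apply: dvdn_exp.
have M0 : 0 < M by rewrite expn_gt0 (ltn_trans _ n2).
split; apply: coprimeXr.
  rewrite coprime_sym; have /dvdnP[k ->] : n %| M * (M - 2) by apply: dvdn_mulr.
  by rewrite /coprime gcdnMDl gcdn1.
have -> : M * (M - 2) + (M - 1) = (M * (M - 2) + M).-1 by rewrite subn1 -!subn1 addnBA.
have /dvdnP[k E] : n %| M * (M - 2) + M by rewrite dvdn_add // dvdn_mulr.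
have k0 : 0 < M * (M - 2) + M by rewrite addn_gt0 M0 orbT.
rewrite E in k0 *; apply: coprime_dvdr (dvdn_mull k (dvdnn n)) _.
by rewrite coprime_sym coprimenP.
Qed.

(** The positions 0, 1 and -1 exclude at most 6 |W| / M < |W| points, so that a point w1
remains. *)
Lemma quintuple_decomp_all n s w : 2 < n -> 1 < s -> s < w -> quintuple_decomp n s w.
Proof.
move=> n2 s1 sw K W f u v cK cW Hf Hu Hv; set M := n ^ s in cK.
have n1 : 1 < n by exact: ltnW.
have M9 : 8 < M by apply: (leq_trans (_ : 9 <= n ^ 2)); [rewrite (leq_sqr 3)|rewrite leq_exp2l].
have M1 : 1 < M by apply: leq_trans M9.
have MW : M %| #|W| by rewrite cW dvdn_exp2l // ltnW.
have W0 : 0 < #|W| by rewrite cW expn_gt0 ltnW.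
have /card_gt0P[w0 _] := W0.
have [i i0 ih] := ham_index w0 Hu M1 MW; have [j j0 jh] := ham_index w0 Hv M1 MW.
have [cp1 cp2] := quintuple_coprime w n2 (ltnW s1); rewrite -cW in cp1 cp2.
have [w1 /andP[i1 j1]] : exists w1, (2 <= val (i w1) <= M - 2) && (2 <= val (j w1) <= M - 2).
  apply/existsP; rewrite -[X in is_true X]negbK; apply/negP => /existsPn bad.
  pose F (k : W -> 'Z_M) a := [set x | k x == a].
  pose U k := F k 0%R :|: F k 1%R :|: F k (-1)%R.
  have sub : [set: W] \subset U i :|: U j.
    apply/subsetP => x _; have := bad x; rewrite !inE negb_and.
    have crit (a : 'Z_M) : ~~ (2 <= val a <= M - 2) -> [|| a == 0%R, a == 1%R | a == (-1)%R].
      have aM := ltn_Zp a M1; rewrite -!(inj_eq val_inj).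
      have -> : val (1%R : 'Z_M) = 1 by apply: (val_natZ (k := 1)).
      have -> : val ((-1)%R : 'Z_M) = M - 1.
        have -> : (-1 = (M - 1)%:R :> 'Z_M)%R.
          apply/eqP; rewrite eq_sym -subr_eq0 opprK natr1 natZp_eq0 //.
          by rewrite subn1 prednK // ltnW.
        by apply: val_natZ => //; move: M1; clear; lia.
      have -> : val (0%R : 'Z_M) = 0 by [].
      by move: (val a) aM => k; move: M1; clear; lia.
    by case/orP => /crit; rewrite -!orbA => /or3P[] ->; rewrite ?orbT.
  have cU k h : (forall x, k (h x) = (k x + 1)%R) -> injective h -> #|U k| * M <= 3 * #|W|.
    move=> kh hI; have C a : #|F k a| * M = #|W| by apply: card_fiber hI kh.
    apply: leq_trans (leq_mul (leq_card_setU _ _) (leqnn M)) _; rewrite mulnDl C.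
    have := leq_mul (leq_card_setU (F k 0%R) (F k 1%R)) (leqnn M); rewrite mulnDl !C.
    by clear; lia.
  have := leq_trans (subset_leq_card sub) (leq_card_setU _ _); rewrite cardsT => L.
  have := cU i u ih (ham_inj Hu); have := cU j v jh (ham_inj Hv).
  by move: L M9 W0; clear; nia.
apply: (decomp_quintuple (M := M) (i := i) (j := j) (w0 := w0) (w1 := w1)) => //.
- by apply: leq_trans M9.
by apply: (triple_decomp_all n2 (ltnW s1) cK).
Qed.

(** Here M = n may be as small as 4, too small for counting; but W = Z_n^2, and both
positions can be taken to be the sum of the coordinates. *)
Lemma torus_decomp5 n : 3 < n -> torus_decomp n 5.
Proof.
move=> n3; have n1 : 1 < n by apply: leq_trans n3.
have n2 : 2 < n by apply: leq_trans n3.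
have G2 : torus_decomp n 2 by apply: (@torus_double n 1) => //; apply: torus_decomp1.
have [l R [S H]] := torus_hams n1 G2.
case: l R S H => [|u [|v [|]]] //= R _ /and3P[Hu Hv _].
have [l1 R1 [S1 H1]] := torus_hams n1 (torus_decomp1 n1).
case: l1 R1 S1 H1 => [|f [|]] //= R1 _ /andP[Hf _].
apply: (@torus_cube_split n 1 2).
pose i (w : tor n 2) := (w.1 + w.2.1)%R.
have ih x : i (u x) = (i x + 1)%R /\ i (v x) = (i x + 1)%R.
  have D y : y \in [seq g x | g <- dirs n 2] -> i y = (i x + 1)%R.
    case: x => [a [b []]]; rewrite /= !inE => /orP[] /eqP ->; rewrite /i /=; ring.
  by split; apply: D; rewrite (perm_mem (R x)) !inE eqxx ?orbT.
pose w0 : tor n 2 := (0%R, (0%R, tt)); pose w1 : tor n 2 := (1%R, (1%R, tt)).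
have v1 : val (i w1) = 2 by apply: (val_natZ (k := 2)).
have [cp1 cp2] := quintuple_coprime 2 n2 (ltn0Sn 0); rewrite expn1 -(card_tor 2 n1) in cp1 cp2.
have cK : #|tor n 1| = n ^ 1 by apply: card_tor.
have i0 : i w0 = 0%R by apply: addr0.
have G := @decomp_quintuple n (tor n 1) (tor n 2) f u v i i w0 w1 n3
  (etrans cK (expn1 n)) Hf Hu Hv (fun x => (ih x).1) (fun x => (ih x).2) i0 i0 _ _ cp1 cp2
  (triple_decomp_all n2 (ltn0Sn 0) cK Hf Hf Hf).
have {}G := G _ _; rewrite v1 in G.
have R3 := recolour_cat (@recolour_lift1 _ (tor n 2) _ _ (@recolour_cube_dirs n 1 _ R1))
  (@recolour_lift2 (tor n 1 * (tor n 1 * tor n 1))%type _ _ _ R).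
apply: decomp_recolour R3 _; apply: G; move: n3; clear; lia.
Qed.

(** * Dimension seven for large n *)

Lemma torus_decomp7_large n : 5 < n -> torus_decomp n 7.
Proof.
move=> n5; have n1 : 1 < n by apply: leq_trans n5.
have n3 : 3 < n by apply: leq_trans n5.
have G2 : torus_decomp n 2 by apply: (@torus_double n 1) => //; apply: torus_decomp1.
have [l R [S H]] := torus_hams n1 G2.
case: l R S H => [|u [|v [|]]] //= R _ /and3P[Hu Hv _].
have [l5 R5 [S5 H5]] := torus_hams n1 (torus_decomp5 n3).
case: l5 R5 S5 H5 => [|b1 [|b2 [|b3 [|b4 [|b5 [|]]]]]] // R5 _ H5.
apply: (@torus_split n 5 2).
pose i (w : tor n 2) := (w.1 + w.2.1)%R.
have ih x : i (u x) = (i x + 1)%R /\ i (v x) = (i x + 1)%R.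
  have D y : y \in [seq g x | g <- dirs n 2] -> i y = (i x + 1)%R.
    case: x => [a [b []]]; rewrite /= !inE => /orP[] /eqP ->; rewrite /i /=; ring.
  by split; apply: D; rewrite (perm_mem (R x)) !inE eqxx ?orbT.
pose w0 : tor n 2 := (0%R, (0%R, tt)); pose w1 : tor n 2 := (1%R, (2%:R, tt))%R.
have v1 : val (i w1) = 3.
  by rewrite (_ : i w1 = 3%:R)%R; [apply: val_natZ => //; apply: ltnW|rewrite -[3]/(1 + 2) natrD].
have i0 : i w0 = 0%R by apply: addr0.
have nn k : 0 < k -> n %| n ^ k by move=> ?; apply: dvdn_exp.
have cp1 : coprime (n ^ 3 * (n - 3) + n ^ 2 + (n - 1) * (n ^ 2 - 1)) #|tor n 2|.
  rewrite card_tor //; apply: coprimeXr; rewrite coprime_sym.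
  have [k [nk e3 e1 e2]] := M_sub n5.
  have -> : n ^ 3 * (n - 3) + n ^ 2 + (n - 1) * (n ^ 2 - 1) =
    (n ^ 2 * (n - 3) + k.+2 * k.+4) * n + 1.
    by rewrite e2 e3 e1 nk; clear; ring.
  by rewrite /coprime gcdnMDl gcdn1.
have cp2 : coprime (n ^ 3 * (n - 3) + (n - 1)) #|tor n 2|.
  rewrite card_tor //; apply: coprimeXr.
  have -> : n ^ 3 * (n - 3) + (n - 1) = ((n ^ 2 * (n - 3) + 1) * n).-1.
    rewrite mulnDl mul1n -subn1 addnBA ?(ltnW n1) // mulnAC -expnSr.
    by [].
  by apply: coprime_pred_mul; rewrite ?addn1 // ltnW.
have G := @decomp_five_two n (tor n 2) (fun k => if k then u else v) (fun=> i) w0 w1 n5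
  _ _ (fun=> i0) _ _ cp1 cp2 b1 b2 b3 b4 b5 H5 R5.
have RR := recolour_cat (@recolour_refl _ [seq @lift1 (tor n 5) (tor n 2) f | f <- dirs n 5])
  (@recolour_lift2 (tor n 5) _ _ _ R).
apply: (decomp_recolour RR).
have {}G : decomp [:: lift1 (@F1 n); lift1 (@F2 n); lift1 (@F3 n); lift1 (@F4 n); lift1 (@F5 n);
    @lift2 (tor n 5) (tor n 2) u; lift2 v].
  have l1 : (3 <= val (i w1)) && (val (i w1) <= n - 3).
    by rewrite v1; move: n5; clear; lia.
  case/andP: l1 => l1 u1.
  have Hk : forall k : bool, ham (if k then u else v) by case; [exact: Hu|exact: Hv].
  have ik : forall (k : bool) w, i ((if k then u else v) w) = (i w + 1)%R.
    by case=> w; [exact: (ih w).1|exact: (ih w).2].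
  have {}G := G Hk ik (fun=> l1) (fun=> u1).
  exact: G.
have -> : [seq @lift1 (tor n 5) (tor n 2) f | f <- dirs n 5] =
  [:: lift1 (@F1 n); lift1 (@F2 n); lift1 (@F3 n); lift1 (@F4 n); lift1 (@F5 n)].
  by rewrite [dirs n 5]/= /F1 /F2 /F3 /F4 /F5.
exact: G.
Qed.

(** * Dimension seven from a triple *)

Lemma perm_middle (T : eqType) (a b c d e f g : T) :
  perm_eq [:: a; b; c; d; e; f; g] [:: a; b; c; d; f; e; g].
Proof. by apply/permP => P /=; clear; lia. Qed.

(** The torus is Z_n^3 times twice Z_n^2, with cycles p1, p2, p3 on the first factor
and u, v on each of the others. The two copies of u yield two cycles of Z_n^4, to be paired
with p1 and p2; p3 and the two copies of v form the triple. *)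
Lemma torus_decomp7_of_triple n : 2 < n ->
  (forall (K1 K2 : finType) (f : K1 -> K1) (g h : K2 -> K2),
     #|K1| = n ^ 3 -> #|K2| = n ^ 2 -> ham f -> ham g -> ham h ->
     decomp [:: @lift1 K1 (K2 * K2)%type f; lift2 (lift1 g); lift2 (lift2 h)]) ->
  torus_decomp n 7.
Proof.
move=> n2 T; have n1 : 1 < n by apply: ltnW.
have G2 : torus_decomp n 2 by apply: (@torus_double n 1) => //; apply: torus_decomp1.
have G4 : torus_decomp n 4 by apply: (@torus_double n 2).
have G3 : torus_decomp n 3.
  apply: (@torus_triple n 1) => //; last exact: torus_decomp1.
  by move=> K f g h cK; apply: (triple_decomp_all n2) cK.
have [l R [S H]] := torus_hams n1 G2; have [k Rk [Sk Hk]] := torus_hams n1 G3.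
case: l R S H => [|u [|v [|]]] // R _ /and3P[Hu Hv _].
case: k Rk Sk Hk => [|p1 [|p2 [|p3 [|]]]] // Rk _ /and4P[H1 H2 H3 _].
have c2 := card_tor 2 n1; have c3 := card_tor 3 n1.
set X := tor n 2 in u v Hu Hv R c2 *; set K := tor n 3 in p1 p2 p3 H1 H2 H3 Rk c3 *.
have c4 : #|{: X * X}| = n ^ 4 by rewrite card_prod c2 -expnD.
have [|q Rq [Sq Hq]] := decomp_size (decomp_pair n1 (ltn0Sn 1) (ltn0Sn 1) c2 c2 Hu Hu).
  by rewrite c4 expn_gt0 ltnW.
case: q Rq Sq Hq => [|q1 [|q2 [|]]] // Rq _ /and3P[Hq1 Hq2 _].
have P1 := decomp_pair n1 (ltn0Sn 2) (ltn0Sn 3) c3 c4 H1 Hq1.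
have P2 := decomp_pair n1 (ltn0Sn 2) (ltn0Sn 3) c3 c4 H2 Hq2.
have P3 := T K X p3 v v c3 c2 H3 Hv Hv.
have G : decomp [:: lift1 p1; lift1 p2; lift1 p3; lift2 (lift1 u); lift2 (lift2 u);
    lift2 (lift1 v); @lift2 K _ (@lift2 X X v)].
  apply: decomp_recolour (decomp_cat (decomp_cat P1 P2) P3) => x.
  have := perm_map (fun y => (x.1, y)) (Rq x.2) => /permP E.
  by apply/permP => P; have /= := E P; rewrite /lift2 /lift1 /=; clear; lia.
have {}G : decomp ([seq @lift1 K (X * X)%type f | f <- dirs n 3] ++
    [seq lift2 (lift1 f) | f <- dirs n 2] ++ [seq lift2 (lift2 f) | f <- dirs n 2]).
  have R1 := @recolour_lift1 K (X * X)%type _ _ Rk.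
  have R2 := @recolour_lift2 K (X * X)%type _ _ (@recolour_lift1 X X _ _ R).
  have R3 := @recolour_lift2 K (X * X)%type _ _ (@recolour_lift2 X X _ _ R).
  rewrite -!map_comp in R2 R3.
  apply: (decomp_recolour (recolour_cat R1 (recolour_cat R2 R3))); apply: decomp_recolour G => x.
  exact: perm_middle.
apply: (@torus_split n 3 4).
apply: (decomp_conj (p := fun z => (z.1, tjoin z.2)) (q := fun z => (z.1, @tsplit n 2 2 z.2))) G.
- by move=> [x y]; congr (_, _); apply: tjoinK.
- by move=> [x y]; congr (_, _); apply: tsplitK.
move=> [x y]; apply: eqP_perm; rewrite !map_cat -!map_comp; congr (_ ++ _).
  by apply: eq_map => f; congr (_, _); rewrite [RHS](@tsplitK n 2 2).
have := congr1 (map (fun t => (x, t))) (dirs_join (@tsplit n 2 2 y)).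
by rewrite tsplitK map_cat -!map_comp.
Qed.

(** * Designs checked by evaluation *)

Fixpoint first_return (T : eqType) (f : T -> T) (x0 z : T) k :=
  if k is k'.+1 then (z != x0) && first_return f x0 (f z) k' else z == x0.

(** The points visited before the first return to x0 are distinct, so the length of the
return decides whether all points are visited. *)
Lemma ham_first_return (T : finType) (f : T -> T) x0 k :
  #|T| = k.+1 -> first_return f x0 (f x0) k -> ham f.
Proof.
move=> cT fr.
have [ret new] : iter k.+1 f x0 = x0 /\ forall j, j < k -> iter j.+1 f x0 != x0.
  have gen m z : first_return f x0 z m -> iter m f z = x0 /\ forall j, j < m -> iter j f z != x0.
    elim: m z => [|m IH] z /=; first by move/eqP.
    case/andP => zx /IH[E H]; split; first by rewrite -iterSr in E.
    by case=> [|j] //; rewrite iterSr; apply: H.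
  have [E H] := gen _ _ fr; split; first by rewrite iterSr.
  by move=> j jk; rewrite iterSr; apply: H.
have inj : injective (fun j : 'I_k.+1 => iter j f x0).
  have lt (i j : 'I_k.+1) : i < j -> iter i f x0 = iter j f x0 -> False.
    move=> ij E; have jk := ltn_ord j.
    have : iter (k.+1 - j + i) f x0 = x0.
      by rewrite iterD E -iterD subnK // ltnW.
    have := new (k.+1 - j + i).-1; rewrite prednK; last by move: jk; clear; lia.
    by move=> N E'; move: N; rewrite E' eqxx => /(_ _)/negP[] //; move: ij jk; clear; lia.
  move=> i j /= E; apply/val_inj; case: (ltngtP i j) => // ij.
    by case: (lt _ _ ij E).
  by case: (lt _ _ ij (esym E)).
have onto y : exists2 j, j < k.+1 & iter j f x0 = y.
  have le : #|T| <= #|'I_k.+1| by rewrite card_ord cT.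
  by have /codomP[j ->] := inj_card_onto inj le y; exists j.
apply/hamP => x y; have [i ik <-] := onto x; have [j _ <-] := onto y.
apply: (@connect_trans _ _ x0); last exact: fconnect_iter.
by rewrite -{2}ret -(subnK (ltnW ik)) iterD fconnect_iter.
Qed.

Section Three.
Local Notation V := (tor 3 5).
(** The pairs of axes 1, 2 and 3, 4 are first decomposed into two cycles of length 9 each;
move3 numbers these four cycles and the last axis. The deal of the five moves, found by a
computer search, depends on the sum of the coordinates and is modified on one
line in each layer. *)
Definition third (a b : 'Z_3) := (val (a + b)%R == 2).
Definition move3 (d : nat) (x : V) : V :=
  let: (a, (b, (c, (e, (g, _))))) := x in
  match d with
  | 0 => if third a b then (a, (b + 1, (c, (e, (g, tt)))))%R else (a + 1, (b, (c, (e, (g, tt)))))%R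
  | 1 => if third a b then (a + 1, (b, (c, (e, (g, tt)))))%R else (a, (b + 1, (c, (e, (g, tt)))))%R
  | 2 => if third c e then (a, (b, (c, (e + 1, (g, tt)))))%R else (a, (b, (c + 1, (e, (g, tt)))))%R
  | 3 => if third c e then (a, (b, (c + 1, (e, (g, tt)))))%R else (a, (b, (c, (e + 1, (g, tt)))))%R
  | _ => (a, (b, (c, (e, (g + 1, tt)))))%R
  end.
Definition deal3 (x : V) : seq nat :=
  let: (a, (b, (c, (e, (g, _))))) := x in
  match val (a + b + c + e + g)%R with
  | 0 => if (val a == 2) && (val b == 1) then [:: 0; 1; 2; 3; 4] else [:: 0; 1; 4; 3; 2]
  | 1 => if (val a == 0) && (val b == 0) then [:: 3; 4; 2; 0; 1] else [:: 3; 2; 4; 0; 1]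
  | _ => if (val a == 2) && (val b == 1) then [:: 4; 1; 0; 3; 2] else [:: 3; 1; 0; 4; 2]
  end.
Definition colour3 c (x : V) := move3 (nth 0 (deal3 x) c) x.

Definition origin3 : V := (0, (0, (0, (0, (0, tt)))))%R.

Lemma ham_colour3 : all (@ham V) [seq colour3 c | c <- iota 0 5].
Proof.
have R c : first_return (colour3 c) origin3 (colour3 c origin3) 242 -> ham (colour3 c).
  by apply: ham_first_return; rewrite card_tor.
by rewrite /= !R //; vm_compute.
Qed.

Lemma torus_decomp5_three : torus_decomp 3 5.
Proof.
exists [seq colour3 c | c <- iota 0 5]; last exact: ham_colour3.
move=> x; apply: (@perm_trans _ [seq move3 d x | d <- iota 0 5]).
  case: x => a [b [c [d [e []]]]]; rewrite /= /lift1 /lift2 /=.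
  by case: (third a b); case: (third c d); apply/permP => P /=; clear; lia.
have {1}-> : iota 0 5 = [:: 0; 1; 2; 3; 4] by [].
have P : perm_eq [:: 0; 1; 2; 3; 4] (deal3 x).
  case: x => a [b [c [d [e []]]]]; rewrite /deal3.
  by case: (val _) => [|[|k]]; case: ifP.
have S := perm_size P.
have := perm_map (fun d => move3 d x) P; congr perm_eq.
rewrite -map_comp; case E: (deal3 x) S => [|d0 [|d1 [|d2 [|d3 [|d4 [|]]]]]] //= _.
by rewrite /colour3 E.
Qed.
End Three.

Section Four.
Local Notation L := ('Z_64 * 'Z_16)%type.
(** The moves 0, 1, 2 are moveP, moveR and the identity. As for three even cycles of equal
length, layer 0 carries the exceptional sign, and all the other layers are constant up to an
exchange along a row. The design was found by a computer search. *)
Definition four0 t a b := match t with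
  | 0 => if b == 0 then if a == 0 then 1 else if a == 1 then 2 else if a %% 3 == 1 then 1 else 0
         else if b == 1 then if a == 0 then 0 else if a %% 3 == 1 then 1 else 2
         else if a == 0 then if b %% 3 == 2 then 2 else 0
         else if (a + b) %% 3 == 2 then 1 else 0
  | 1 | 2 => 1 | 3 => 2 | _ => 0 end.
Definition four1 t a b := match t with
  | 0 => if b == 0 then if a == 0 then 2 else if a %% 3 == 1 then 0 else 1
         else if b == 1 then if a == 0 then 2 else if a %% 3 == 1 then 2 else 1
         else if a == 0 then if b %% 3 == 2 then 0 else 2
         else if (a + b) %% 3 == 2 then 0 else 1
  | 1 => if b == 1 then 2 else 0 | 2 => if b == 0 then 2 else 0 | _ => 1 end.
Definition four2 t a b := match t with
  | 0 => if b == 0 then if a == 0 then 0 else if a == 1 then 1 else 2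
         else if b == 1 then if a == 0 then 1 else 0
         else if a == 0 then 1 else 2
  | 1 => if b == 1 then 0 else 2 | 2 => if b == 0 then 0 else 2 | 3 => 0 | _ => 2 end.
Definition move4 d (z : L) : L := match d with 0 => moveP z | 1 => moveR z | _ => z end.
Definition design4 (four : nat -> nat -> nat -> nat) t (z : L) :=
  move4 (four t (val z.1) (val z.2)) z.

Lemma ham_four (four : nat -> nat -> nat -> nat) :
  first_return (layered (M := 16) (design4 four)) (0, (0, 0))%R
    (layered (M := 16) (design4 four) (0, (0, 0)))%R (16 * (64 * 16)).-1 ->
  ham (layered (M := 16) (design4 four)).
Proof. by apply: ham_first_return; rewrite !card_prod !card_ord. Qed.

Lemma ham_four0 : ham (layered (M := 16) (design4 four0)).
Proof. by apply: ham_four; vm_compute. Qed.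
Lemma ham_four1 : ham (layered (M := 16) (design4 four1)).
Proof. by apply: ham_four; vm_compute. Qed.
Lemma ham_four2 : ham (layered (M := 16) (design4 four2)).
Proof. by apply: ham_four; vm_compute. Qed.

Lemma four_perm t a b : perm_eq [:: 0; 1; 2] [:: four0 t a b; four1 t a b; four2 t a b].
Proof.
case: t => [|[|[|[|t]]]] //=; try by case: ifP.
rewrite /four0 /four1 /four2; case: (b == 0).
  by case: (a =P 0) => // _; case: (a =P 1) => [->|_] //; case: ifP.
case: (b == 1); first by case: (a =P 0) => // _; case: ifP.
by case: (a =P 0) => _; case: ifP.
Qed.

Lemma triple_four (K1 K2 : finType) (f : K1 -> K1) (g h : K2 -> K2) :
  #|K1| = 4 ^ 3 -> #|K2| = 4 ^ 2 -> ham f -> ham g -> ham h ->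
  decomp [:: @lift1 K1 (K2 * K2)%type f; lift2 (lift1 g); lift2 (lift2 h)].
Proof.
apply: (@decomp_layered 64 16 (design4 four0) (design4 four1) (design4 four2)) => //; last first.
  by rewrite /= ham_four0 ham_four1 ham_four2.
move=> t z _; rewrite perm_sym.
exact: (perm_map (fun d => move4 d z) (four_perm t (val z.1) (val z.2))).
Qed.
End Four.

(** * All dimensions *)

Lemma torus_decomp7_odd n : 2 < n -> odd n -> torus_decomp n 7.
Proof.
move=> n2 on; have n1 : 1 < n by apply: ltnW.
apply: torus_decomp7_of_triple => // K1 K2 f g h c1 c2.
have n9 : 3 ^ 2 <= n ^ 2 by rewrite leq_exp2r.
apply: (odd_box _ (dvdn_exp2l n _) _ _ c1 c2) => //.
- by apply: leq_trans n9.
- exact: coprime_pred_exp.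
apply: coprimeXr; rewrite -(@coprime_pexpr 2) //.
by apply: coprime_odd_pred2; [apply: leq_trans n9|rewrite ssrnat.oddX on orbT].
Qed.

(** Only the dimensions 5 and 7 escape the grouping of cycles. *)
Theorem torus_decomposition n : 2 < n -> forall D, torus_decomp n D.
Proof.
move=> n2; apply: torus_decomp_all => //.
- exact: triple_decomp_all.
- by move=> s w s1 sw; apply: quintuple_decomp_all.
- move: n2; rewrite leq_eqVlt => /orP[/eqP <-|n3]; [exact: torus_decomp5_three|exact: torus_decomp5].
have [on|en] := boolP (odd n); first exact: torus_decomp7_odd.
have [n5|n5] := ltnP 5 n; first exact: torus_decomp7_large.
have -> : n = 4 by move: n2 n5 en; case: n => [|[|[|[|[|[|]]]]]].
exact: (torus_decomp7_of_triple _ triple_four).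
Qed.

(** * Hamilton decompositions as choices of arcs *)

Fixpoint tget n D : tor n D -> nat -> 'Z_n :=
  match D return tor n D -> nat -> 'Z_n with
  | 0 => fun _ _ => 0%R
  | D'.+1 => fun z k => if k is k'.+1 then tget z.2 k' else z.1
  end.
Fixpoint tmake n D (u : nat -> 'Z_n) : tor n D :=
  match D return tor n D with 0 => tt | D'.+1 => (u 0, tmake D' (fun k => u k.+1)) end.

Lemma tgetK n D (z : tor n D) : tmake D (tget z) = z.
Proof. by elim: D z => [[]|D IH] //= [a z] /=; rewrite IH. Qed.

Lemma tmakeK n D (u : nat -> 'Z_n) k : k < D -> tget (tmake D u) k = u k.
Proof. by elim: D u k => [|D IH] u [|k] //= kD; rewrite IH. Qed.

Lemma eq_tmake n D (u v : nat -> 'Z_n) : (forall k, k < D -> u k = v k) -> tmake D u = tmake D v.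
Proof.
elim: D u v => [|D IH] u v //= E; congr (_, _); first exact: E.
by apply: IH => k kD; apply: E.
Qed.

Lemma tget_dir n D i k (z : tor n D) : i < D ->
  tget (nth id (dirs n D) i z) k = if i == k then (tget z k + 1)%R else tget z k.
Proof.
elim: D i k z => [|D IH] i k z //; case: z => a z; case: i => [|i] iD; first by case: k.
rewrite [dirs n D.+1]/= [nth _ _ _]/=.
rewrite (nth_map id) ?size_dirs //=.
by case: k => [|k] //=; rewrite IH.
Qed.

Section Product.
Variables (d n : nat) (V : 'I_d -> finType) (f : forall i, V i -> V i).
Local Notation X := {dffun forall i, V i}.
Hypotheses (n2 : 2 < n) (cV : forall i, #|V i| = n) (Hf : forall i, ham (@f i)).

Definition advance (x : X) i : X := [ffun j => dfwith x (f (x i)) j].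

Lemma advance_inj x : injective (advance x).
Proof.
move=> i j /ffunP/(_ i); rewrite !ffunE dfwith_in.
have [//|ji] := eqVneq j i; rewrite dfwith_out // => fx.
have /card_gt1P[y [z [_ _ yz]]] : 1 < #|V i| by rewrite cV ltnW.
have fix_ u : u = x i.
  have /hamP/(_ (x i) u)/iter_findex <- := Hf i.
  by elim: findex => //= k ->.
by rewrite (fix_ y) (fix_ z) eqxx in yz.
Qed.

(** Positions along the cycles turn the product into a torus. *)
Lemma advance_decomp : decomp [seq (fun x => advance x i) | i <- enum 'I_d].
Proof.
have n1 : 1 < n by apply: ltnW.
have coord i : exists pq : (V i -> 'Z_n) * ('Z_n -> V i),
    [/\ cancel pq.1 pq.2, cancel pq.2 pq.1 & forall x, pq.1 (f x) = (pq.1 x + 1)%R].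
  by have [p [q H]] := ham_coord n1 (cV i) (Hf i); exists (p, q).
have [c Hc] := fin_all_exists coord.
pose from (z : tor n d) : X := [ffun i : 'I_d => (c i).2 (tget z i)].
pose to (x : X) : tor n d := tmake d (fun k => if insub k is Some i then (c i).1 (x i) else 0%R).
apply: (decomp_conj (p := from) (q := to)) (torus_decomposition n2 d).
- move=> z; rewrite -[RHS]tgetK; apply: eq_tmake => k kd.
  by rewrite insubT ffunE; case: (Hc (Ordinal kd)) => _ ->.
- move=> x; apply/ffunP => i; rewrite ffunE tmakeK // valK.
  by case: (Hc i) => ->.
have sE : size (enum 'I_d) = d by rewrite -cardE card_ord.
move=> x; apply: eqP_perm; rewrite -[LHS]map_comp -[RHS]map_comp.
apply: (@eq_from_nth _ x); first by rewrite [LHS]size_map [RHS]size_map sE size_dirs.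
move=> i; rewrite size_map sE => iD.
rewrite [LHS](nth_map (Ordinal iD)) ?sE // [RHS](nth_map id) ?size_dirs //=.
rewrite [nth _ (enum _) i](_ : _ = Ordinal iD); last by apply: val_inj; rewrite /= nth_enum_ord.
apply/ffunP => j; rewrite !ffunE tget_dir //.
have E (k : 'I_d) : tget (to x) k = (c k).1 (x k) by rewrite tmakeK // valK.
rewrite E; have [pq qp pf] := Hc j; case: eqP => [ij|ij].
  have -> : Ordinal iD = j by apply: val_inj.
  by rewrite dfwith_in -pf pq.
by rewrite dfwith_out ?pq //; apply/eqP => e; apply: ij; rewrite -e.
Qed.

(** As the f i have no fixed points, the d moves from a vertex are distinct, and the
value of a colour determines the coordinate that it moves. *)
Lemma product_colours : exists c : 'I_d -> X -> 'I_d,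
  (forall x, injective (c^~ x)) /\ (forall k, ham (fun x => advance x (c k x))).
Proof.
have X0 : 0 < #|{: X}|.
  have ex i : exists x : V i, true.
    have /card_gt0P[y _] : 0 < #|V i| by rewrite cV; apply: leq_trans n2.
    by exists y.
  by have [g _] := fin_all_exists ex; apply/card_gt0P; exists [ffun i => g i].
have [l R [S H]] := decomp_size advance_decomp X0.
have ld : size l = d by rewrite S size_map size_enum_ord.
have E x : perm_eq [seq advance x i | i <- enum 'I_d] [seq g x | g <- l].
  by have := R x; rewrite -[X in perm_eq X]map_comp.
have val_l x (k : 'I_d) : exists i, nth id l k x == advance x i.
  have : nth x [seq g x | g <- l] k \in [seq g x | g <- l].
    by apply: mem_nth; rewrite size_map ld.
  by rewrite -(perm_mem (E x)) (nth_map id) ?ld // => /mapP[i _ ->]; exists i.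
pose c k x := xchoose (val_l x k).
have cE (k : 'I_d) x : nth id l k x = advance x (c k x) by apply/eqP; apply: (xchooseP (val_l x k)).
exists c; split=> [x|k]; last first.
  rewrite -(eq_ham (cE k)).
  by move/(all_nthP id): H; apply; rewrite ld.
have U y : uniq [seq g y | g <- l].
  by rewrite -(perm_uniq (E y)) (map_inj_uniq (@advance_inj y)) enum_uniq.
move=> k k' e; apply/val_inj/eqP.
have sz (m : 'I_d) : m < size [seq g x | g <- l] by rewrite size_map ld.
rewrite -(nth_uniq x (sz k) (sz k') (U x)).
by rewrite ![nth x _ _](nth_map id) ?ld // !cE e.
Qed.
End Product.

Section Cycles.
Variable G : digraph.

Lemma ham_cycle_choice (C : {set Defs.arc G}) : ham_cycle C ->
  exists a : vert G -> Defs.arc G,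
    [/\ forall v, asrc (a v) = v, C = [set a v | v : vert G] & ham (fun v => atgt (a v))].
Proof.
case=> s [-> s0 cyc U all_s].
have [e0 _] : exists e, e \in s by case: (s) s0 => // e ?; exists e; rewrite inE eqxx.
pose a v := nth e0 s (index v [seq asrc e | e <- s]).
have aK v : asrc (a v) = v.
  rewrite /a -(nth_map _ v) ?nth_index //.
  by rewrite -(size_map (@asrc G)) index_mem.
have Ka e : e \in s -> a (asrc e) = e.
  move=> es; rewrite /a -{1}(nth_index e0 es).
  rewrite -(nth_map _ (asrc e)) ?index_mem // index_uniq ?nth_index ?size_map ?index_mem //.
exists a; split=> //.
  apply/setP => e; rewrite inE; apply/idP/imsetP => [es|[v _ ->]].
    by exists (asrc e) => //; rewrite Ka.
  by apply: mem_nth; rewrite -(size_map (@asrc G)) index_mem.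
have fc : fcycle (fun v => atgt (a v)) [seq asrc e | e <- s].
  rewrite cycle_map; apply: (@sub_in_cycle _ [in s] (@consecutive G)) cyc; last exact/allP.
  by move=> e e' es _; rewrite /consecutive /= Ka.
by apply/hamP => v w; rewrite (fconnect_cycle fc).
Qed.

Lemma choice_ham_cycle (a : vert G -> Defs.arc G) : 0 < #|vert G| ->
  (forall v, asrc (a v) = v) -> ham (fun v => atgt (a v)) -> ham_cycle [set a v | v : vert G].
Proof.
case/card_gt0P => v0 _ aK H; set f := fun v => _ in H.
have mem v : v \in orbit f v0 by rewrite -fconnect_orbit; move/hamP: H; apply.
have mapK : [seq asrc e | e <- [seq a v | v <- orbit f v0]] = orbit f v0.
  by rewrite -map_comp map_id_in // => v _; apply: aK.
exists [seq a v | v <- orbit f v0]; split.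
- apply/setP => e; rewrite inE; apply/imsetP/mapP => -[v _ ->]; by exists v.
- by rewrite -size_eq0 size_map; case: (orbit f v0) (mem v0).
- rewrite cycle_map; have := cycle_orbit (ham_inj H) v0.
  by apply: sub_cycle => u v; rewrite /consecutive /= aK.
- by rewrite mapK orbit_uniq.
by move=> v; rewrite mapK.
Qed.

(** A decomposition into Hamilton cycles, seen from the vertices: the cycles, indexed by J,
correspond at each vertex to the arcs that leave it. *)
Definition arc_choices (J : finType) (a : J -> vert G -> Defs.arc G) :=
  [/\ forall j v, asrc (a j v) = v, forall j, ham (fun v => atgt (a j v)),
      forall e, exists j, a j (asrc e) = e & forall v, injective (a^~ v)].

Lemma decomposable_choices r : ham_decomposable_into G r -> exists a : 'I_r -> vert G -> Defs.arc G, arc_choices a.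
Proof.
case=> P [/and3P[/eqP cov triv _] HP] <-.
have ch (j : 'I_#|P|) : exists a : vert G -> Defs.arc G, [/\ forall v, asrc (a v) = v,
    enum_val j = [set a v | v : vert G] & ham (fun v => atgt (a v))].
  by apply/ham_cycle_choice/HP/enum_valP.
have [a Ha] := fin_all_exists ch; exists a.
have mem j v : a j v \in enum_val j by case: (Ha j) => _ -> _; apply: imset_f.
split=> [j|j|e|v i j E]; [by case: (Ha j)|by case: (Ha j)| |].
  have : e \in cover P by rewrite cov inE.
  case/bigcupP => C CP eC; exists (enum_rank_in CP C).
  have : e \in enum_val (enum_rank_in CP C) by rewrite enum_rankK_in.
  case: (Ha (enum_rank_in CP C)) => aK -> _ /imsetP[v _ ->].
  by rewrite aK.
apply: enum_val_inj; apply/eqP; apply: contraT => ne.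
have := trivIsetP triv _ _ (enum_valP i) (enum_valP j) ne.
by move/disjoint_setI0/setP/(_ (a i v)); rewrite !inE mem E mem.
Qed.

Lemma choices_decomposable (J : finType) (a : J -> vert G -> Defs.arc G) :
  0 < #|vert G| -> arc_choices a -> ham_decomposable_into G #|J|.
Proof.
move=> V0 [aK H onto inj]; have /card_gt0P[v0 _] := V0.
pose C j := [set a j v | v : vert G].
have memC e j : (e \in C j) = (a j (asrc e) == e).
  apply/imsetP/eqP => [[v _ ->]|<-]; first by rewrite aK.
  by exists (asrc e).
have Cinj : injective C.
  move=> i j /setP/(_ (a i v0)); rewrite !memC !aK eqxx => /esym/eqP E.
  by apply: (inj v0).
exists [set C j | j : J]; last by rewrite card_imset.
split; last by move=> _ /imsetP[j _ ->]; apply: choice_ham_cycle.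
apply/and3P; split.
- apply/eqP/setP => e; rewrite inE; have [j E] := onto e.
  by apply/bigcupP; exists (C j); [apply: imset_f|rewrite memC E].
- apply/trivIsetP => _ _ /imsetP[i _ ->] /imsetP[j _ ->] ij.
  rewrite disjoint_subset; apply/subsetP => e; rewrite inE !memC => /eqP Ei.
  by apply: contra ij => /eqP Ej; rewrite (inj (asrc e) i j) // Ei Ej.
apply/imsetP => -[j _ E]; have : a j v0 \in C j by rewrite memC aK.
by rewrite -E inE.
Qed.
End Cycles.

(** * The product theorem *)

(** For each j the j-th Hamilton cycles of the factors are treated together: they span a
torus, which has d Hamilton cycles. *)
Theorem cart_prod_decomposable (d n r : nat) (G : 'I_d -> digraph) :
  2 < n -> (forall i, #|vert (G i)| = n) -> (forall i, ham_decomposable_into (G i) r) ->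
  ham_decomposable_into (cart_prod G) (d * r).
Proof.
move=> n2 cV dec.
have [a Ha] := fin_all_exists (fun i => decomposable_choices (dec i)).
have aK i j v : asrc (a i j v) = v by case: (Ha i).
pose f j i v := atgt (a i j v).
have Hf j i : ham (@f j i) by case: (Ha i) => _ H _ _; apply: H.
have [c Hc] := fin_all_exists (fun j => product_colours n2 cV (Hf j)).
pose X := cart_vert G.
have X0 : 0 < #|X|.
  have ex i : exists x : vert (G i), true.
    have /card_gt0P[y _] : 0 < #|vert (G i)| by rewrite cV; apply: leq_trans n2.
    by exists y.
  by have [g _] := fin_all_exists ex; apply/card_gt0P; exists [ffun i => g i].
pose lab j i (x : X) : {i : 'I_d & Defs.arc (G i)} := Tagged (fun i => Defs.arc (G i)) (a i j (x i)).
have lab_src j i x : ((lab j i x, x).2 (tag (lab j i x, x).1) == asrc (tagged (lab j i x, x).1)).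
  by rewrite /= aK.
pose b (kj : 'I_d * 'I_r) (x : X) : cart_arc G := exist _ (lab kj.2 (c kj.2 kj.1 x) x, x) (lab_src _ _ _).
have <- : #|{: 'I_d * 'I_r}| = d * r by rewrite card_prod !card_ord.
apply: (@choices_decomposable (cart_prod G) _ b) => //; split.
- by move=> kj x.
- by case=> k j; case: (Hc j) => _ /(_ k).
- move=> [[[i e] x] xe]; rewrite [asrc _]/=.
  have /= /eqP xi := xe.
  have [j Ej] : exists j, a i j (x i) = e.
    by case: (Ha i) => _ _ onto _; rewrite xi; apply: onto.
  have [k Ek] : exists k, c j k x = i.
    by have [g _ gK] := injF_bij ((Hc j).1 x); exists (g i); apply: gK.
  exists (k, j); apply: val_inj; rewrite /= Ek; congr (_, _).
  by rewrite /lab Ej.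
move=> x [k j] [k' j'] E.
have {E} : lab j (c j k x) x = lab j' (c j' k' x) x by case: (congr1 val E).
have key i i' : lab j i x = lab j' i' x -> i = i' /\ j = j'.
  move=> E; have ii' : i = i' := congr1 tag E; rewrite -ii' in E *; split=> //.
  move/eqP: E; rewrite eq_Tagged /= => /eqP E.
  by case: (Ha i) => _ _ _ inj; apply: (inj (x i)).
by move/key => [E jj']; rewrite -jj' in E *; rewrite ((Hc j).1 x k k' E).
Qed.

Theorem corollary1p2 :
  (forall (d n r : nat) (G : 'I_d -> digraph),
      2 <= d -> 3 <= n -> 1 <= r ->
      (forall i : 'I_d, #|vert (G i)| = n) ->
      (forall i : 'I_d, ham_decomposable_into (G i) r) ->
      ham_decomposable_into (cart_prod G) (d * r)) /\
  (forall (G : digraph) (d : nat),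
      3 <= #|vert G| -> 1 <= d ->
      ham_decomposable G -> ham_decomposable (cart_pow d G)).
Proof.
split=> [d n r G _ n2 _ cV dec|G d n2 _ [P HP]].
  exact: cart_prod_decomposable n2 cV dec.
have [Q HQ _] : ham_decomposable_into (cart_prod (fun _ : 'I_d => G)) (d * #|P|).
  by apply: (cart_prod_decomposable n2) => // i; exists P.
by exists Q.
Qed.
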